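(* Let $p_1,p_2$ be primes with $p_1\equiv p_2\equiv 1\pmod 4$ such that at least two of $\left(\frac{p_1}{p_2}\right),\left(\frac{2}{p_1}\right),\left(\frac{2}{p_2}\right)$ equal $-1$, let $k=\mathbb{Q}(\sqrt{2p_1p_2},i)$ and let $k^{*}=\mathbb{Q}(\sqrt2,\sqrt{p_1},\sqrt{p_2},i)$ be the genus field of $k$. Then every class of $\mathbf{C}_{k,2}$ capitulates in $k^{*}$, i.e. $\ker j_{k^*}=\mathbf{C}_{k,2}$.
   Context: $\mathbf{C}_{k,2}$ is the $2$-Sylow subgroup of the class group of $k$. For an unramified extension $K/k$, $j_K:\mathbf{C}_{k,2}\to\mathbf{C}_{K,2}$ is the homomorphism induced by extension of ideals $\mathfrak a\mapsto \mathfrak a\mathcal O_K$; a class capitulates in $K$ if it lies in $\ker j_K$. *)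

(* Defs.v *)
From HB Require Import structures.
From mathcomp Require Import all_boot all_order all_algebra all_field.
Set Implicit Arguments. Unset Strict Implicit. Unset Printing Implicit Defensive.
Import Order.TTheory GRing.Theory Num.Theory.
Local Open Scope ring_scope.

Definition is_qr (a p : nat) : bool := [exists x : 'I_p, (x * x == a %[mod p])%N].
Definition legendre (a p : nat) : int :=
  if (p %| a)%N then 0 else if is_qr a p then 1 else -1.

Definition is_subfield (F : algC -> Prop) : Prop :=
  F 0 /\ F 1 /\ (forall x y, F x -> F y -> F (x - y)) /\
  (forall x y, F x -> F y -> F (x * y)) /\ (forall x, F x -> F x^-1).

Definition gen_field (S : algC -> Prop) : algC -> Prop :=
  fun x => forall F, is_subfield F -> (forall s, S s -> F s) -> F x.

Definition ring_of_integers (K : algC -> Prop) : algC -> Prop :=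
  fun x => K x /\ x \in Aint.

Definition is_ideal (O I : algC -> Prop) : Prop :=
  (forall x, I x -> O x) /\ I 0 /\ (forall x y, I x -> I y -> I (x + y)) /\
  (forall r x, O r -> I x -> I (r * x)).

Definition nonzero_ideal (I : algC -> Prop) : Prop := exists x, I x /\ x != 0.

Definition ideal_gen (O S : algC -> Prop) : algC -> Prop :=
  fun x => forall J, is_ideal O J -> (forall s, S s -> J s) -> J x.

Definition ideal_mul (O I J : algC -> Prop) : algC -> Prop :=
  ideal_gen O (fun z => exists a b, I a /\ J b /\ z = a * b).

Definition ideal_pow (O I : algC -> Prop) (n : nat) : algC -> Prop :=
  iter n (ideal_mul O I) O.

Definition principal (O I : algC -> Prop) : Prop :=
  exists a, O a /\ forall x, I x <-> exists r, O r /\ x = r * a.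

(* The class of a nonzero integral ideal I of O_k lies in C_{k,2} iff
   its order is a power of 2, i.e. I^(2^n) is principal for some n.
   It capitulates in K iff the extended ideal I O_K is principal. *)
Definition in_2_sylow (O I : algC -> Prop) : Prop :=
  exists n : nat, principal O (ideal_pow O I (2 ^ n)%N).

Definition capitulates (OK I : algC -> Prop) : Prop := principal OK (ideal_gen OK I).

(* Main.v *)
Require Import Defs.
From HB Require Import structures.
From mathcomp Require Import all_boot all_order all_algebra all_field.
From Stdlib Require Import Classical_Prop FunctionalExtensionality PropExtensionality.
From mathcomp Require Import all_fingroup all_solvable.
From mathcomp Require Import zify ring.
Set Implicit Arguments. Unset Strict Implicit. Unset Printing Implicit Defensive.
Import Order.TTheory GRing.Theory Num.Theory.
Local Open Scope ring_scope.

(** Write N for the norm from k to Q(i), sigma for the nontrivial automorphism of k / Q(i), and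
    d = 2 p1 p2. As Z[i] is principal, an ideal I of k satisfies I sigma(I) = (a) with
    a in Z[i]; hence if I^2 = (alpha), then N(alpha / a) is a unit of Z[i], which is the norm of a
    unit of k because +-i is not a norm at a prime p = 5 (mod 8). Hilbert 90 gives
    alpha = e c g^2 with e a unit, g in k and c in Z[i] squarefree, and c is only divisible by
    ramified primes, i.e. by 1 + i and by the primes above p1 and p2. Each of these is a unit times
    a square in k^*: for 1 + i by an explicit identity, for a prime above p because x^2 - p y^2 = -1
    is solvable. So I O_{k^*} is principal as soon as I^2 is.

    It remains to see that I^2 is principal as soon as I^4 is. In that case c is, up to a unit, a
    norm from k; by the residue conditions and reciprocity this leaves only the classes of
    1, p1 p2, x + i and x - i modulo squares, where x^2 - d y^2 = -1, and these are units times
    squares in k. If p1 = p2, then k is the field of eighth roots of unity, and the first argument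
    shows directly that I is principal. *)

(** * Pell equations *)

(** No factorization of ideals of k is used: an ideal is only accompanied by a Gaussian integer
    generating its relative norm ([norm_gen]), and the primes of c are controlled through
    integrality of traces and norms. For p1 <> p2, sigma comes from the cyclotomic automorphism zeta
    -> zeta^(1 + 4 p1 p2) on roots of unity of order dividing 8 p1 p2; it flips sqrt 2 and fixes i,
    and it fixes sqrt p1 and sqrt p2 because these are Gauss sums up to sign. Both negative Pell
    equations come from the least solution of t^2 - d u^2 = 1: with t = 2A + 1 and u = 2v it reads A
    (A + 1) = d v^2, and minimality or the residue symbols exclude all distributions of the primes
    of d except the one where d divides A + 1. The symbols enter again when c is a norm up to a
    unit: without the factor 1 + i, the product of c and its complex conjugate is a norm of the form
    p1^A p2^B, which forces A and B to be even. Since 1 + i divides x + i exactly once, multiplying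
    c by x + i repairs an odd power of 1 + i. *)

Lemma injective_orbit_returns (T : Type) (F : finType) (f : T -> T) (P : T -> Prop)
    (code : T -> F) (x0 : T) :
  P x0 -> (forall x, P x -> P (f x)) ->
  (forall x y, P x -> P y -> f x = f y -> x = y) ->
  (forall x y, P x -> P y -> code x = code y -> x = y) ->
  exists2 n, (0 < n)%N & iter n f x0 = x0.
Proof.
move=> P0 Pf finj cinj.
have Pi n : P (iter n f x0) by elim: n => //= n; apply: Pf.
pose g (i : 'I_#|F|.+1) := code (iter i f x0).
have /injectivePn[i [j ij gij]] : ~~ injectiveb g.
  apply/negP => /injectiveP /leq_card; by rewrite card_ord ltnn.
wlog lij : i j ij gij / (i < j)%N.
  move=> W; have := ij; rewrite neq_ltn => /orP[] H; first exact: (W i j).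
  by apply: (W j i) => //; rewrite eq_sym.
exists (j - i)%N; first by rewrite subn_gt0.
(* Two iterates share a code; injectivity of [f] strips the common first i steps, so the return is
   to [x0] itself. *)
have: iter i f x0 = iter (i + (j - i)) f x0 by rewrite subnKC ?(ltnW lij) //; apply: cinj.
move: (j - i)%N => k; elim: (i : nat) => [|n IH] /=; first by move=> <-.
by move=> e; apply: IH; apply: finj.
Qed.

(* Conway's river of the form x^2 - d y^2: a triple (a, b, c) with a, c > 0 stands for
   the form a X^2 + 2 b X Y - c Y^2 of discriminant 4 (b^2 + a c) = 4 d. *)
Section River.
Variable d : nat.
Hypothesis d_gt1 : (1 < d)%N.
Hypothesis d_nonsquare : forall m : int, m ^+ 2 != d%:Z.

Let form := (int * int * int)%type.

(** The form takes the value a + 2b - c at (1, 1). According to its sign, the sum of the two basis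
    vectors replaces the positive or the negative one, so opposite signs persist. *)
Definition river_step (s : form) : form :=
  let: (a, b, c) := s in
  if 0 < a + 2 * b - c then (a + 2 * b - c, b - c, c) else (a, b + a, c - 2 * b - a).

Definition river (s : form) : Prop :=
  let: (a, b, c) := s in [/\ 0 < a, 0 < c & b ^+ 2 + a * c = d%:Z].

Lemma mediant_neq0 a b c : river (a, b, c) -> a + 2 * b - c != 0.
Proof.
case=> a0 c0 e; apply/eqP => m0; have /eqP[] := d_nonsquare (a + b).
rewrite -e; have -> : c = a + 2 * b by lia.
ring.
Qed.

Lemma river_stepP s : river s -> river (river_step s).
Proof.
case: s => [[a b] c] r; have := mediant_neq0 r; case: r => a0 c0 e /= m0.
by case: ifP => m; split; try lia; rewrite -e; ring.
Qed.

(** The branch can be read off an image (A, B, C): A - 2B - C is positive after the first branch and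
    negative after the second, and each branch is linear and invertible. *)
Lemma river_step_inj s t : river s -> river t -> river_step s = river_step t -> s = t.
Proof.
case: s t => [[a b] c] [[a' b'] c'] [a0 c0 e] [a0' c0' e'] /=.
case: ifP => m; case: ifP => m' [] ? ? ?; try (exfalso; lia);
  by congr (_, _, _); lia.
Qed.

(** From b^2 + a c = d follow |b| <= d and a, c <= d; adding d to b makes every entry fit in
    0..2d. *)
Definition river_code (s : form) : 'I_(2 * d).+1 * 'I_(2 * d).+1 * 'I_(2 * d).+1 :=
  let: (a, b, c) := s in (inord `|a|, inord `|b + d%:Z|, inord `|c|).

Lemma river_code_inj s t : river s -> river t -> river_code s = river_code t -> s = t.
Proof.
have bnd a b c : river (a, b, c) ->
    [/\ (0 < a <= d)%R, (- d%:Z <= b <= d)%R & (0 < c <= d)%R].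
  by case=> a0 c0 e; split; nia.
case: s t => [[a b] c] [[a' b'] c'] /bnd[? ? ?] /bnd[? ? ?] [].
move=> /(congr1 (@nat_of_ord _)) ea /(congr1 (@nat_of_ord _)) eb /(congr1 (@nat_of_ord _)) ec.
move: ea eb ec; rewrite !inordK; try lia.
by move=> *; congr (_, _, _); lia.
Qed.

(** (x, y) and (z, w) are the basis vectors reached after n steps. Since 1 - d < 0, the first step
    replaces the second vector, so z is positive from then on. *)
Lemma river_vectors n : exists x y z w : int,
  [/\ iter n river_step (1, 0, d%:Z) =
        (x ^+ 2 - d%:Z * y ^+ 2, x * z - d%:Z * y * w, d%:Z * w ^+ 2 - z ^+ 2),
      0 < x, 0 <= y, 0 < w & if n == 0%N then [&& x == 1, y == 0 & z == 0] else 0 < z].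
Proof.
elim: n => [|n [x [y [z [w [/= -> x0 y0 w0 z0]]]]]].
  by exists 1, 0, 0, 1; split => //=; congr (_, _, _); ring.
have zn : 0 <= z by case: eqP z0 => _; [case/and3P => _ _ /eqP -> | apply: ltW].
rewrite /=; case: ifP => m.
  exists (x + z), (y + w), z, w; split; try lia.
    by congr (_, _, _); ring.
  case: n z0 m => [|n] //= /and3P[/eqP -> /eqP -> /eqP ->]; have := d_gt1; nia.
exists x, y, (x + z), (y + w); split; try lia.
by congr (_, _, _); ring.
Qed.

Lemma pell_solution : exists x y : int, [/\ 0 < x, 0 < y & x ^+ 2 - d%:Z * y ^+ 2 = 1].
Proof.
have r0 : river (1, 0, d%:Z) by split => //; lia.
have [n n0 e] := injective_orbit_returns r0 river_stepP river_step_inj river_code_inj.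
have [x [y [z [w [e' x0 y0 w0]]]]] := river_vectors n.
rewrite (gtn_eqF n0) => z0; move: e'; rewrite e => -[e1 e2 e3].
exists x, y; split => //; rewrite lt0r y0 andbT.
(* The returning form has middle coefficient x z - d y w = 0, so y = 0 would contradict x, z > 0. *)
by apply/eqP => ye; subst y; have : 0 < x * z by [rewrite mulr_gt0]; lia.
Qed.

End River.

(** * Quadratic residues *)

(** Euler's criterion: if x = g^k for a generator g and q is the order of F, the hypothesis makes q
    - 1 divide k (q - 1)/2, so k is even. *)
Lemma finField_square (F : finFieldType) (x : F) :
  odd #|F| -> x != 0 -> x ^+ (#|F|.-1)./2 = 1 -> exists y, y ^+ 2 = x.
Proof.
move=> oF x0 ex.
have [g gE] := cyclicP (field_unit_group_cyclic [set: {unit F}]).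
have : finField_unit x0 \in <[g]>%g by rewrite -gE inE.
case/cycleP => k /(congr1 val) /=; rewrite FinRing.val_unitX => xg.
have og : #[g]%g = #|F|.-1 by rewrite orderE -gE card_finField_unit.
have : (#|F|.-1 %| k * (#|F|.-1)./2)%N.
  by rewrite -og order_dvdn; apply/eqP/val_inj; rewrite FinRing.val_unitX exprM; move: xg ex => /= <-; rewrite og => ->.
have e2 : #|F|.-1 = (2 * (#|F|.-1)./2)%N.
  by have := oF; lia.
have gt1 : (1 < #|F|)%N := finNzRing_gt1 F.
have h0 : (0 < (#|F|.-1)./2)%N by move: oF gt1; lia.
rewrite {1}e2 (dvdn_pmul2r h0).
by case/dvdnP => m km; exists (val g ^+ m); rewrite -exprM -km.
Qed.

(** The class 0 counts as a square, so for p prime the value -1 of [legendre] is exactly the failure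
    of [qres]. *)
Definition qres (p : nat) (a : int) : Prop := exists y : 'F_p, y ^+ 2 = a%:~R.

Lemma Fp_int_eq0 p (a : int) : prime p -> (a%:~R == 0 :> 'F_p) = (p %| a)%Z.
Proof.
move=> pp; have Fn n : (n%:R == 0 :> 'F_p) = (p %| n)%N.
  by rewrite -(dvdn_pcharf (pchar_Fp pp)).
case: a => n; first by rewrite -pmulrn Fn.
by rewrite NegzE rmorphN /= oppr_eq0 -pmulrn Fn dvdzE abszN.
Qed.

Lemma qres_mod p (a b : int) : prime p -> (p %| a - b)%Z -> qres p a -> qres p b.
Proof.
move=> pp; rewrite -Fp_int_eq0 // rmorphB subr_eq0 => /eqP ab [y ye].
by exists y; rewrite ye.
Qed.

Lemma qres_sqr p (a b : int) : prime p -> (p %| a ^+ 2 - b)%Z -> qres p b.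
Proof. by move=> pp /(qres_mod pp); apply; exists a%:~R; rewrite rmorphXn. Qed.

Lemma qresM p (a b : int) : qres p a -> qres p b -> qres p (a * b).
Proof. by move=> [y ye] [z ze]; exists (y * z); rewrite exprMn ye ze rmorphM. Qed.

Lemma qres_divl p (a b : int) :
  prime p -> ~~ (p %| a)%Z -> qres p a -> qres p (a * b) -> qres p b.
Proof.
move=> pp; rewrite -Fp_int_eq0 // => a0 [y ye] [z ze]; exists (z / y).
by rewrite expr_div_n ye ze rmorphM /= mulrC mulKf.
Qed.

Lemma prime_mod4_odd p : (p %% 4 = 1)%N -> odd p.
Proof. lia. Qed.

Lemma qresN1 p : prime p -> (p %% 4 = 1)%N -> qres p (-1).
Proof.
move=> pp p4; apply: finField_square; rewrite ?card_Fp ?prime_mod4_odd //.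
  by rewrite rmorphN1 oppr_eq0 oner_eq0.
have -> : (p.-1)./2 = (2 * (p %/ 4))%N by lia.
by rewrite exprM rmorphN1 sqrrN expr1n expr1n.
Qed.

Lemma qresN p (a : int) : prime p -> (p %% 4 = 1)%N -> qres p a -> qres p (- a).
Proof. by move=> pp p4 ra; rewrite -mulN1r; apply: qresM ra; apply: qresN1. Qed.

Lemma is_qrP (a p : nat) : prime p -> is_qr a p <-> qres p a.
Proof.
move=> pp; have Fn (m n : nat) : (m == n %[mod p])%N = (m%:R == n%:R :> 'F_p).
  by rewrite -val_eqE /= !val_Fp_nat // !Fp_cast.
rewrite /is_qr; split=> [/existsP[x]|[y ye]].
  by rewrite Fn natrM => /eqP xa; exists (x : nat)%:R; rewrite expr2 xa.
have yp : (y < p)%N by rewrite -{2}(Fp_cast pp).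
apply/existsP; exists (Ordinal yp); rewrite Fn natrM /= natr_Zp -expr2 ye.
by rewrite -pmulrn.
Qed.

(** The inner binomial coefficients are multiples of the prime q, so q-th powers are additive up to
    q times an algebraic integer. *)
Lemma sum_exp_prime q (I : Type) (r : seq I) (F : I -> algC) :
  prime q -> (forall i, F i \in Aint) ->
  exists2 t, t \in Aint & (\sum_(i <- r) F i) ^+ q = \sum_(i <- r) F i ^+ q + q%:R * t.
Proof.
move=> qp FA; elim: r => [|i r [t tA IH]].
  exists 0; first exact: rpred0.
  by rewrite !big_nil expr0n gtn_eqF ?prime_gt0 // mulr0 addr0.
set s := \sum_(j <- r) F j in IH *.
have sA : s \in Aint by apply: rpred_sum.
case: q qp IH => // q qp IH.
pose u := \sum_(k < q) F i ^+ (q.+1 - k.+1) * s ^+ k.+1 *+ ('C(q.+1, k.+1) %/ q.+1).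
exists (t + u); last first.
  rewrite !big_cons exprDn big_ord_recl big_ord_recr /= subn0 subnn !expr0 IH bin0 /bump !add1n binn.
  rewrite !mulr1n mulr1 mul1r mulrDr mulr_sumr -!addrA; congr (_ + _).
  rewrite addrC -!addrA; congr (_ + (_ + _)); apply: eq_bigr => k _.
  rewrite add1n mulr_natl -mulrnA divnK // prime_dvd_bin //=.
  by rewrite ltnS ltn_ord.
apply: rpredD => //; apply: rpred_sum => k _.
by rewrite rpredMn // rpredM // rpredX.
Qed.

(** * Quadratic Gauss sums and reciprocity *)

Section GaussSum.
Variables (p : nat) (z : algC).
Hypotheses (p_prime : prime p) (p4 : (p %% 4 = 1)%N) (prim_z : p.-primitive_root z).

Definition Fp_char (x : 'F_p) : algC := z ^+ (x : nat).

Lemma Fp_char_nat n : Fp_char n%:R = z ^+ n.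
Proof. by rewrite /Fp_char val_Fp_nat // prim_expr_mod. Qed.

Lemma Fp_charD x y : Fp_char (x + y) = Fp_char x * Fp_char y.
Proof. by rewrite -[x]natr_Zp -[y]natr_Zp -natrD !Fp_char_nat exprD. Qed.

Lemma Fp_charX x n : Fp_char x ^+ n = Fp_char (n%:R * x).
Proof. by rewrite -[x]natr_Zp -natrM !Fp_char_nat -exprM mulnC. Qed.

Lemma Fp_char_Aint x : Fp_char x \in Aint.
Proof. by rewrite rpredX // (Aint_prim_root prim_z). Qed.

(** For u <> 0, rescale to u = 1; the shift y -> y + 1 then multiplies the sum by z, which is not
    1. *)
Lemma sum_Fp_char (u : 'F_p) : \sum_y Fp_char (u * y) = if u == 0 then p%:R else 0.
Proof.
case: eqP => [->|/eqP u0].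
  under eq_bigr do rewrite mul0r /Fp_char expr0.
  by rewrite sumr_const card_Fp.
rewrite (reindex_inj (mulfI (invr_neq0 u0))) /=.
under eq_bigr do rewrite mulrA divff // mul1r.
set s := \sum_y _.
have es : Fp_char 1 * s = s.
  rewrite {2}/s (reindex_inj (addrI 1)) /= mulr_sumr.
  by apply: eq_bigr => y _; rewrite Fp_charD.
have z1 : Fp_char 1 != 1.
  rewrite -[1 : 'F_p]/(1%:R) Fp_char_nat expr1; apply/eqP => z1.
  have := prim_order_dvd prim_z 1; rewrite z1 expr1n eqxx => /dvdn_leq.
  by have := prime_gt1 p_prime; lia.
apply/eqP; move/eqP: es; rewrite -subr_eq0 -{2}[s]mul1r -mulrBl mulf_eq0.
by rewrite subr_eq0 (negbTE z1).
Qed.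

Definition gauss_sum := \sum_(x : 'F_p) Fp_char (x ^+ 2).

(** As -1 is a square modulo p, one factor may be summed over -y^2 instead. With x = u + y the
    exponent x^2 - y^2 becomes u^2 + 2 u y, and the sum over y vanishes unless u = 0. *)
Lemma gauss_sum_sqr : gauss_sum ^+ 2 = p%:R.
Proof.
have [v ve] := qresN1 p_prime p4.
have v0 : v != 0.
  by rewrite -sqrf_eq0 ve rmorphN1 oppr_eq0 oner_eq0.
have eN : gauss_sum = \sum_(x : 'F_p) Fp_char (- x ^+ 2).
  rewrite /gauss_sum (reindex_inj (mulfI v0)) /=.
  by apply: eq_bigr => x _; rewrite exprMn ve rmorphN1 mulN1r.
rewrite expr2 {1}/gauss_sum eN mulr_suml.
transitivity (\sum_(u : 'F_p) \sum_(y : 'F_p) Fp_char (u ^+ 2) * Fp_char (2%:R * u * y)).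
  rewrite exchange_big /=; under eq_bigr do rewrite mulr_sumr.
  rewrite exchange_big /=; apply: eq_bigr => y _.
  rewrite (reindex_inj (addIr y)) /=; apply: eq_bigr => u _.
  rewrite -!Fp_charD; congr Fp_char; ring.
under eq_bigr => u _ do rewrite -mulr_sumr sum_Fp_char.
rewrite (bigD1 0) //= mulr0 eqxx expr0n /= -[0 : 'F_p]/(0%:R) Fp_char_nat expr0 mul1r.
rewrite big1 ?addr0 // => u u0.
rewrite mulf_eq0 (negbTE u0) orbF.
have -> : (2%:R == 0 :> 'F_p) = false; last by rewrite mulr0.
rewrite -(dvdn_pcharf (pchar_Fp p_prime)); apply/negP => /dvdn_leq.
by have := prime_gt1 p_prime; move: p4; lia.
Qed.

Lemma sqrtC_prime : sqrtC p%:R = gauss_sum \/ sqrtC p%:R = - gauss_sum.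
Proof.
have /eqP : sqrtC p%:R ^+ 2 = gauss_sum ^+ 2 by rewrite sqrtCK gauss_sum_sqr.
by rewrite eqf_sqr => /orP[] /eqP; [left | right].
Qed.

(** Up to sign sqrt p is a Gauss sum, hence a polynomial in z. This serves to find an automorphism
    that moves sqrt 2 but not sqrt p. *)
Lemma aut_sqrtC_prime (nu : {rmorphism algC -> algC}) :
  nu z = z -> nu (sqrtC p%:R) = sqrtC p%:R.
Proof.
move=> nz; suff e : nu gauss_sum = gauss_sum.
  by case: sqrtC_prime => ->; rewrite ?rmorphN e.
rewrite rmorph_sum; apply: eq_bigr => x _.
by rewrite rmorphXn /= nz.
Qed.

(** If q = r^2 modulo p, the Gauss sum g satisfies g^q = g modulo q, by the substitution x -> r x.
    Then p^((q + 1)/2) = g^(q + 1) is congruent to g^2 = p modulo q, and Euler's criterion applies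
    to p. *)
Lemma gauss_sum_recip q : prime q -> odd q -> q != p -> qres p q -> qres q p.
Proof.
move=> qp oq qnp [r re].
have r0 : r != 0.
  rewrite -sqrf_eq0 re Fp_int_eq0 // dvdzE /= dvdn_prime2 // eq_sym //.
have [t tA] := sum_exp_prime (index_enum 'F_p) qp (fun x => Fp_char_Aint (x ^+ 2)).
have -> : \sum_x Fp_char (x ^+ 2) ^+ q = gauss_sum.
  rewrite /gauss_sum [RHS](reindex_inj (mulfI r0)) /=.
  by apply: eq_bigr => x _; rewrite Fp_charX exprMn re -pmulrn.
rewrite -/gauss_sum => et.
have gA : gauss_sum \in Aint by apply: rpred_sum => x _; apply: Fp_char_Aint.
have pw : p%:R ^+ q.-1./2.+1 - p%:R = q%:R * (t * gauss_sum) :> algC.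
  have -> : q%:R * (t * gauss_sum) = gauss_sum ^+ q.+1 - gauss_sum ^+ 2.
    by rewrite exprS et; ring.
  have -> : q.+1 = (2 * q.-1./2.+1)%N by lia.
  by rewrite exprM gauss_sum_sqr.
have q0 : q%:R != 0 :> algC by rewrite pnatr_eq0; case: (q) qp.
(* The cofactor of q is rational and an algebraic integer, so the congruence takes place in Z. *)
have /intrP[m me] : t * gauss_sum \in Num.int.
  apply: Cint_rat_Aint; last exact: rpredM.
  rewrite -[_ * _](mulKf q0) -pw; apply: rpredM; first by rewrite rpredV rpred_nat.
  by rewrite rpredB ?rpredX ?rpred_nat.
have /(congr1 (intr : int -> 'F_q)) : p%:Z ^+ q.-1./2.+1 - p%:Z = q%:Z * m.
  apply: (@intr_inj algC); rewrite rmorphB rmorphXn rmorphM /= -me -pw.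
  by rewrite -!pmulrn.
rewrite rmorphB rmorphXn rmorphM /= -!pmulrn pchar_Fp_0 // mul0r => /eqP.
have p0 : (p%:R != 0 :> 'F_q).
  by rewrite -(dvdn_pcharf (pchar_Fp qp)) dvdn_prime2.
rewrite (_ : _ - _ = p%:R * (p%:R ^+ q.-1./2 - 1)); last by rewrite exprS; ring.
rewrite mulf_eq0 (negbTE p0) subr_eq0 /= => /eqP e1.
by apply: finField_square; rewrite ?card_Fp.
Qed.
End GaussSum.

Lemma quadratic_reciprocity p q : prime p -> prime q -> (p %% 4 = 1)%N -> (q %% 4 = 1)%N ->
  q != p -> qres p q -> qres q p.
Proof.
move=> pp qp p4 q4 qnp.
have [z zp] := C_prim_root_exists (prime_gt0 pp).
by apply: (gauss_sum_recip pp p4 zp qp _ qnp); apply: prime_mod4_odd.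
Qed.

(** * Negative Pell equations *)

Lemma coprime_mul_square A B v : coprime A B -> (A * B = v ^ 2)%N ->
  exists r s, [/\ A = r ^ 2, B = s ^ 2 & r * s = v]%N.
Proof.
have sq (C D w : nat) : coprime C D -> (C * D = w ^ 2)%N -> C = (gcdn C w ^ 2)%N.
  move=> CD e; rewrite -mulnn muln_gcdl !muln_gcdr (mulnn w) -e (mulnC w C) -!muln_gcdr.
  have -> : gcdn (gcdn C w) (gcdn w D) = 1%N; last by rewrite muln1.
  apply/eqP; rewrite -dvdn1 -(eqP CD) dvdn_gcd.
  by rewrite (dvdn_trans (dvdn_gcdl _ _) (dvdn_gcdl _ _)) (dvdn_trans (dvdn_gcdr _ _) (dvdn_gcdr _ _)).
move=> AB e; have eB : (B * A = v ^ 2)%N by rewrite mulnC.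
have BA : coprime B A by rewrite coprime_sym.
have [eA eB'] := (sq _ _ _ AB e, sq _ _ _ BA eB).
exists (gcdn A v), (gcdn B v); split => //.
by apply/eqP; rewrite -(eqn_exp2r _ _ (isT : (0 < 2)%N)) expnMn -eA -eB' e.
Qed.

(** Takes the primes of d one by one out of A (A + 1), recording which of the two coprime factors
    carries each. *)
Lemma prime_split_coprime q A B w : prime q -> coprime A B -> (A * B = q * w)%N ->
  (exists A', [/\ A = q * A', A' * B = w & coprime A' B])%N \/
  (exists B', [/\ B = q * B', A * B' = w & coprime A B'])%N.
Proof.
move=> qp AB e; have q0 := prime_gt0 qp.
have : (q %| A * B)%N by rewrite e dvdn_mulr.
rewrite Euclid_dvdM // => /orP[] /dvdnP[k ek]; [left | right]; exists k.
- split; first by rewrite mulnC.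
    by apply/eqP; rewrite -(eqn_pmul2l q0) -e ek; apply/eqP; ring.
  by move: AB; rewrite ek coprimeMl => /andP[].
- split; first by rewrite mulnC.
    by apply/eqP; rewrite -(eqn_pmul2l q0) -e ek; apply/eqP; ring.
  by move: AB; rewrite ek coprimeMr => /andP[].
Qed.

(** In the least solution of t^2 = d u^2 + 1, t even is impossible modulo 4, and t, u both odd would
    make 8 divide d. So t = 2A + 1 and u = 2v, and v < u <= r for every other solution. *)
Lemma pell_minimal_half d : (1 < d)%N -> (forall m : int, m ^+ 2 != d%:Z) ->
  (d %% 4 = 1)%N \/ (d %% 4 = 2)%N ->
  exists A v : nat, [/\ 0 < v, A * A.+1 = d * v ^ 2 &
    forall r s, s ^ 2 = d * r ^ 2 + 1 -> 0 < r -> v < r]%N.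
Proof.
move=> d1 dns d4.
(* Bounding t, which is at most t^2 = d u^2 + 1, makes the property of u boolean, as a minimum over
   nat requires. *)
have ex : exists u, (0 < u)%N && [exists t : 'I_(d * u ^ 2).+2, t ^ 2 == d * u ^ 2 + 1]%N.
  have [x [y [x0 y0 e]]] := pell_solution d1 dns.
  exists `|y|%N; rewrite absz_gt0 gt_eqF //=.
  have e' : (`|x| ^ 2 = d * `|y| ^ 2 + 1)%N by lia.
  have lx : (`|x| < (d * `|y| ^ 2).+2)%N by rewrite ltnS -addn1 -e'; nia.
  by apply/existsP; exists (Ordinal lx); rewrite /= e'.
case: (ex_minnP ex) => u /andP[u0 /existsP[t /eqP te]] umin.
pose T : nat := t; rewrite -/T in te.
have oT : odd T.
  apply/negPn/negP => eT; have [a ea] : exists a, T = (2 * a)%N by exists T./2; lia.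
  case: (boolP (odd u)) => ou.
    have [b eb] : exists b, u = (2 * b).+1 by exists u./2; lia.
    case: d4 => d4; have [c ec] : exists c, d = (4 * c + d %% 4)%N by exists (d %/ 4)%N; lia.
      by rewrite d4 in ec; move: te; rewrite ea eb ec; lia.
    by rewrite d4 in ec; move: te; rewrite ea eb ec; lia.
  have [b eb] : exists b, u = (2 * b)%N by exists u./2; lia.
  by move: te; rewrite ea eb; lia.
have eu : ~~ odd u.
  apply/negP => ou; have [a ea] : exists a, T = (2 * a).+1 by exists T./2; lia.
  have [b eb] : exists b, u = (2 * b).+1 by exists u./2; lia.
  have [a' ea'] : exists a', (a * a.+1 = 2 * a')%N.
    by exists (a * a.+1)./2; have := oddM a a.+1; rewrite /=; case: (odd a) => /=; lia.
  have [b' eb'] : exists b', (b * b.+1 = 2 * b')%N.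
    by exists (b * b.+1)./2; have := oddM b b.+1; rewrite /=; case: (odd b) => /=; lia.
  have T2 : (T ^ 2 = 8 * a' + 1)%N by rewrite ea; lia.
  have u2 : (u ^ 2 = 8 * b' + 1)%N by rewrite eb; lia.
  have : (d * (8 * b' + 1) = 8 * a')%N by lia.
  case: d4 => d4; have [c ec] : exists c, d = (4 * c + d %% 4)%N by exists (d %/ 4)%N; lia.
    by rewrite d4 in ec; rewrite ec; lia.
  by rewrite d4 in ec; rewrite ec; lia.
have [A eA] : exists A, T = (2 * A).+1 by exists T./2; lia.
have [v ev] : exists v, u = (2 * v)%N by exists u./2; lia.
exists A, v; split; first by lia.
  by move: te; rewrite eA ev; lia.
move=> r s e r0; suff : (u <= r)%N by lia.
apply: umin; rewrite r0 /=.
have ls : (s < (d * r ^ 2).+2)%N by rewrite ltnS -addn1 -e; nia.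
by apply/existsP; exists (Ordinal ls); rewrite /= e.
Qed.

(** The coprime factors are squares r^2 and s^2 with r s = v. If d goes to A, then s^2 = d r^2 + 1
    with r <= v contradicts minimality; if d goes to A + 1, then r^2 + 1 = d s^2. *)
Lemma negative_pell_of_split d A v : (0 < v)%N -> (A * A.+1 = d * v ^ 2)%N ->
  (forall r s, s ^ 2 = d * r ^ 2 + 1 -> 0 < r -> v < r)%N ->
  forall A' B', coprime A' B' -> (A' * B' = v ^ 2)%N ->
  (A = d * A' /\ A.+1 = B' -> False)%N /\
  (A = A' /\ A.+1 = d * B' -> exists x y, x ^ 2 + 1 = d * y ^ 2)%N.
Proof.
move=> v0 e vmin A' B' cop /(coprime_mul_square cop)[r [s [-> -> rs]]]; split.
  move=> [eA eB]; have r0 : (0 < r)%N by rewrite lt0n; apply: contraTneq v0 => re; rewrite -rs re.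
  have := vmin r s; rewrite -eB eA addn1 => /(_ erefl r0).
  have : (0 < s)%N by rewrite lt0n; apply: contraTneq v0 => se; rewrite -rs se muln0.
  by nia.
by move=> [eA eB]; exists r, s; rewrite -eB eA addn1.
Qed.

Lemma prime_not_square p (m : int) : prime p -> m ^+ 2 != p%:Z.
Proof.
move=> pp; apply/eqP => /(congr1 absz); rewrite abszX /= => e.
have : (p %| `|m| ^ 2)%N by rewrite e.
rewrite Euclid_dvdX // andbT => pm.
have := dvdn_exp2r 2 pm; rewrite e => /(dvdn_leq (prime_gt0 pp)).
by have := prime_gt1 pp; nia.
Qed.

Lemma negative_pell_prime p : prime p -> (p %% 4 = 1)%N ->
  exists x y, (x ^ 2 + 1 = p * y ^ 2)%N.
Proof.
move=> pp p4.
have [A [v [v0 e vmin]]] := pell_minimal_half (prime_gt1 pp)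
  (fun m => prime_not_square m pp) (or_introl p4).
have H := negative_pell_of_split v0 e vmin.
have cop : coprime A A.+1 by rewrite coprimenS.
case: (prime_split_coprime pp cop e) => [[A' [eA eB c]]|[B' [eA eB c]]].
  by have [F _] := H _ _ c eB; case: F.
by have [_ F] := H _ _ c eB; apply: F.
Qed.

(** Modulo q dividing b one has (a r)^2 = -a, and -1 is a square; modulo q dividing a one has (b
    s)^2 = b. *)
Lemma qres_split (q : nat) (a b r s : nat) : prime q -> (q %% 4 = 1)%N ->
  (a * r ^ 2).+1 = (b * s ^ 2)%N ->
  ((q %| b)%N -> qres q a) /\ ((q %| a)%N -> qres q b).
Proof.
move=> qp q4 e; split=> qd.
  rewrite -[a%:Z]opprK; apply: qresN => //; apply: (@qres_sqr q (a * r)%N%:Z) => //.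
  have -> : (a * r)%N%:Z ^+ 2 - - a%:Z = a%:Z * ((a * r ^ 2).+1)%N%:Z by lia.
  by rewrite e; apply: dvdz_mull; rewrite dvdzE /= dvdn_mulr.
apply: (@qres_sqr q (b * s)%N%:Z) => //.
have -> : (b * s)%N%:Z ^+ 2 - b%:Z = b%:Z * ((a * r ^ 2))%N%:Z.
  have -> : (a * r ^ 2)%N%:Z = (b * s ^ 2)%N%:Z - 1 by lia.
  lia.
by apply: dvdz_mull; rewrite dvdzE /= dvdn_mulr.
Qed.

(* At most one of the three residue symbols of the hypothesis equals 1. *)
Definition few_residues (p1 p2 : nat) : Prop :=
  [/\ ~ (qres p2 p1 /\ qres p1 2), ~ (qres p2 p1 /\ qres p2 2) & ~ (qres p1 2 /\ qres p2 2)].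

Section TwoPrimes.
Variables p1 p2 : nat.
Hypotheses (p1_prime : prime p1) (p2_prime : prime p2).
Hypotheses (p1_mod4 : (p1 %% 4 = 1)%N) (p2_mod4 : (p2 %% 4 = 1)%N) (p12 : p1 != p2).
Hypothesis few : few_residues p1 p2.

Lemma few_residues_sym : few_residues p2 p1.
Proof.
have p21 : p2 != p1 by rewrite eq_sym.
have [f1 f2 f3] := few; split=> -[a b].
- by apply: f2; split => //; apply: quadratic_reciprocity a.
- by apply: f1; split => //; apply: quadratic_reciprocity a.
- by apply: f3.
Qed.

(** Reciprocity makes p2 a residue of p1 as well; cancelling it in 2 p2 leaves 2 as a residue of
    p1. *)
Lemma few_cross : qres p2 p1 -> qres p1 (2 * p2)%N -> False.
Proof.
have [f1 _ _] := few => a b; apply: f1; split=> //.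
apply: (@qres_divl p1 p2); rewrite ?dvdzE //=.
- by rewrite dvdn_prime2.
- by apply: quadratic_reciprocity a => //.
- by rewrite mulrC -PoszM.
Qed.
End TwoPrimes.

Lemma two_primes_not_square p1 p2 (m : int) : odd p1 -> odd p2 ->
  m ^+ 2 != (2 * p1 * p2)%N%:Z.
Proof.
move=> o1 o2; apply/eqP => /(congr1 absz); rewrite abszX /= => e.
have : (2 %| `|m| ^ 2)%N by rewrite e -mulnA dvdn_mulr.
rewrite Euclid_dvdX // andbT => /dvdnP[k ek]; move: e; rewrite ek => e.
have : (2 * k ^ 2 = p1 * p2)%N by lia.
by move/(congr1 odd); rewrite !oddM o1 o2.
Qed.

(** Each of 2, p1, p2 divides A or A + 1. Minimality excludes that all divide A, and in the six
    mixed cases [qres_split] yields a pair of residues forbidden by [few] or [few_cross]. Only d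
    dividing A + 1 is left. *)
Lemma negative_pell_two_primes p1 p2 : prime p1 -> prime p2 ->
  (p1 %% 4 = 1)%N -> (p2 %% 4 = 1)%N -> p1 != p2 -> few_residues p1 p2 ->
  exists x y, (x ^ 2 + 1 = 2 * p1 * p2 * y ^ 2)%N.
Proof.
move=> pp1 pp2 m1 m2 p12 few.
have o1 := prime_mod4_odd m1; have o2 := prime_mod4_odd m2.
have [p1g p2g] := (prime_gt1 pp1, prime_gt1 pp2).
have d1 : (1 < 2 * p1 * p2)%N by nia.
have d4 : (2 * p1 * p2 %% 4 = 2)%N by rewrite -modnMm -(modnMm 2 p1) m1 m2.
have p21 : p2 != p1 by rewrite eq_sym.
have [A [v [v0 e vmin]]] := pell_minimal_half d1
  (fun m => two_primes_not_square m o1 o2) (or_intror d4).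
have H := negative_pell_of_split v0 e vmin.
have cop : coprime A A.+1 by rewrite coprimenS.
have few' := few_residues_sym pp1 pp2 m1 m2 p12 few.
have X12 := few_cross pp1 pp2 m1 m2 p12 few.
have X21 := few_cross pp2 pp1 m2 m1 p21 few'.
have F2 : ~ (qres p1 2 /\ qres p2 2) by case: few.
have e' : (A * A.+1 = 2 * (p1 * (p2 * v ^ 2)))%N by rewrite e; ring.
have S a b A' B' : A = (a * A')%N -> A.+1 = (b * B')%N -> (A' * B' = v ^ 2)%N -> coprime A' B' ->
    forall q, prime q -> (q %% 4 = 1)%N -> ((q %| b)%N -> qres q a) /\ ((q %| a)%N -> qres q b).
  move=> eA eB ev c q qp q4; have [r [s [er es _]]] := coprime_mul_square c ev.
  by apply: (@qres_split q a b r s) => //; rewrite -er -es -eA.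
case: (prime_split_coprime (isT : prime 2) cop e') => {e'} [] [A1 [e1 e1' c1]];
case: (prime_split_coprime pp1 c1 e1') => [] [A2 [e2 e2' c2]];
case: (prime_split_coprime pp2 c2 e2') => [] [A3 [e3 e3' c3]].
- have [F _] := H _ _ c3 e3'; case: F; split => //; subst; lia.
- exfalso; have {}S := S (2 * p1)%N (p2)%N _ _ _ _ e3' c3.
  have [||S1 S1'] := S _ _ p1 pp1 m1; try by [subst; lia].
  have [||S2 S2'] := S _ _ p2 pp2 m2; try by [subst; lia].
  by apply: X21; [apply: S1' | apply: S2]; first [exact: dvdnn | exact: dvdn_mull | exact: dvdn_mulr].
- exfalso; have {}S := S (2 * p2)%N (p1)%N _ _ _ _ e3' c3.
  have [||S1 S1'] := S _ _ p1 pp1 m1; try by [subst; lia].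
  have [||S2 S2'] := S _ _ p2 pp2 m2; try by [subst; lia].
  by apply: X12; [apply: S2' | apply: S1]; first [exact: dvdnn | exact: dvdn_mull | exact: dvdn_mulr].
- exfalso; have {}S := S (2)%N (p1 * p2)%N _ _ _ _ e3' c3.
  have [||S1 S1'] := S _ _ p1 pp1 m1; try by [subst; lia].
  have [||S2 S2'] := S _ _ p2 pp2 m2; try by [subst; lia].
  by apply: F2; split; [apply: S1 | apply: S2]; first [exact: dvdnn | exact: dvdn_mull | exact: dvdn_mulr].
- exfalso; have {}S := S (p1 * p2)%N (2)%N _ _ _ _ e3' c3.
  have [||S1 S1'] := S _ _ p1 pp1 m1; try by [subst; lia].
  have [||S2 S2'] := S _ _ p2 pp2 m2; try by [subst; lia].
  by apply: F2; split; [apply: S1' | apply: S2']; first [exact: dvdnn | exact: dvdn_mull | exact: dvdn_mulr].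
- exfalso; have {}S := S (p1)%N (2 * p2)%N _ _ _ _ e3' c3.
  have [||S1 S1'] := S _ _ p1 pp1 m1; try by [subst; lia].
  have [||S2 S2'] := S _ _ p2 pp2 m2; try by [subst; lia].
  by apply: X12; [apply: S2 | apply: S1']; first [exact: dvdnn | exact: dvdn_mull | exact: dvdn_mulr].
- exfalso; have {}S := S (p2)%N (2 * p1)%N _ _ _ _ e3' c3.
  have [||S1 S1'] := S _ _ p1 pp1 m1; try by [subst; lia].
  have [||S2 S2'] := S _ _ p2 pp2 m2; try by [subst; lia].
  by apply: X21; [apply: S1 | apply: S2']; first [exact: dvdnn | exact: dvdn_mull | exact: dvdn_mulr].
- have [_ F] := H _ _ c3 e3'; apply: F; split => //; subst; lia.
Qed.

(** * Gaussian integers *)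

Definition Qi : {pred algC} := fun x => ('Re x \in Crat) && ('Im x \in Crat).

Lemma QiE x : (x \in Qi) = ('Re x \in Crat) && ('Im x \in Crat).
Proof. by []. Qed.

Lemma real_Qi x : x \in Crat -> x \in Qi.
Proof.
move=> xr; have xR := Creal_Crat xr.
by apply/andP; rewrite (Creal_ReP _ xR) (Creal_ImP _ xR) rpred0.
Qed.

Lemma mul_Qi x y : x \in Qi -> y \in Qi -> x * y \in Qi.
Proof.
move=> /andP[x1 x2] /andP[y1 y2]; apply/andP; rewrite ReM ImM.
by split; [apply: rpredB | apply: rpredD]; apply: rpredM.
Qed.

Lemma conj_Qi x : (x^* \in Qi) = (x \in Qi).
Proof. by rewrite !QiE Re_conj Im_conj rpredN. Qed.

Fact Qi_divring : divring_closed Qi.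
Proof.
split; first exact/real_Qi/rpred1.
  move=> x y /andP[x1 x2] /andP[y1 y2]; apply/andP.
  by rewrite !raddfB; split; apply: rpredB.
move=> x y x1 yQ; apply: mul_Qi => //.
rewrite invC_norm normC2_Re_Im; apply: mul_Qi; last by rewrite conj_Qi.
case/andP: yQ => y1 y2; apply: real_Qi.
by rewrite rpredV; apply: rpredD; apply: rpredX.
Qed.
HB.instance Definition _ := GRing.isDivringClosed.Build algC Qi Qi_divring.

Lemma i_Qi : 'i \in Qi.
Proof. by rewrite QiE Re_i Im_i rpred0 rpred1. Qed.

Lemma QiP x : x \in Qi -> exists a b, [/\ a \in Crat, b \in Crat & x = a + 'i * b].
Proof. by case/andP => a b; exists ('Re x), ('Im x); split=> //; apply: algCrect. Qed.

(** As the integers of Q(i), so that integrality arguments in [Aint] apply directly; [ZiP] recovers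
    integer coordinates. *)
Definition Zi : {pred algC} := fun x => (x \in Qi) && (x \in Aint).

Lemma ZiE x : (x \in Zi) = (x \in Qi) && (x \in Aint).
Proof. by []. Qed.

Fact Zi_subring : subring_closed Zi.
Proof.
split; first by rewrite ZiE !rpred1.
- by move=> x y /andP[? ?] /andP[? ?]; apply/andP; split; apply: rpredB.
by move=> x y /andP[? ?] /andP[? ?]; apply/andP; split; apply: rpredM.
Qed.
HB.instance Definition _ := GRing.isSubringClosed.Build algC Zi Zi_subring.

Lemma Zi_Qi x : x \in Zi -> x \in Qi. Proof. by case/andP. Qed.
Lemma Zi_Aint x : x \in Zi -> x \in Aint. Proof. by case/andP. Qed.
Lemma conj_Zi x : (x^* \in Zi) = (x \in Zi).
Proof. by rewrite !ZiE conj_Qi Aint_aut. Qed.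
Lemma Zi_int (m : int) : m%:~R \in Zi. Proof. exact: rpred_int. Qed.
Lemma i_Aint : 'i \in Aint.
Proof.
apply: (@Aint_unity_root 4) => //; apply/unity_rootP.
by rewrite (exprM 'i 2 2) sqrCi sqrrN expr1n.
Qed.
Lemma i_Zi : 'i \in Zi.
Proof. by rewrite ZiE i_Qi i_Aint. Qed.

Lemma ii : 'i * 'i = -1 :> algC. Proof. by rewrite -expr2 sqrCi. Qed.

Lemma i_neq0 : 'i != 0 :> algC.
Proof. by apply/eqP => e; have := ii; rewrite e mul0r => /eqP; rewrite eq_sym oppr_eq0 oner_eq0. Qed.

(** A natural number, for inductions and divisibility in nat; on [Zi] the truncation loses nothing,
    by [nrmE]. *)
Definition nrm (x : algC) : nat := Num.truncn (x * x^*).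

Lemma nrmE x : x \in Zi -> (nrm x)%:R = x * x^*.
Proof.
move=> xZ; rewrite /nrm truncnK //.
rewrite natrEint -normCK exprn_ge0 // andbT normCK; apply: Cint_rat_Aint.
  rewrite -normCK normC2_Re_Im; case/andP: (Zi_Qi xZ) => a b.
  by rewrite rpredD // rpredX.
by apply: rpredM; [apply: Zi_Aint | apply: Zi_Aint; rewrite conj_Zi].
Qed.

Lemma nrm_natE (n : nat) x : x \in Zi -> n%:R = x * x^* -> nrm x = n.
Proof. by move=> xZ e; apply/eqP; rewrite -(eqr_nat algC) nrmE // e. Qed.

Lemma nrmM x y : x \in Zi -> y \in Zi -> nrm (x * y) = (nrm x * nrm y)%N.
Proof.
move=> xZ yZ; apply: nrm_natE; first exact: rpredM.
by rewrite natrM !nrmE // rmorphM /=; ring.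
Qed.

Lemma nrmX x n : x \in Zi -> nrm (x ^+ n) = (nrm x ^ n)%N.
Proof.
move=> xZ; elim: n => [|n IH]; last by rewrite exprS nrmM ?rpredX // IH expnS.
by apply: nrm_natE; rewrite ?rpred1 // expr0 expn0 conjC1 mulr1.
Qed.

Lemma nrm_eq0 x : x \in Zi -> (nrm x == 0%N) = (x == 0).
Proof. by move=> xZ; rewrite -(eqr_nat algC) nrmE // mulf_eq0 fmorph_eq0 orbb. Qed.

Lemma nrm_conj x : nrm x^* = nrm x.
Proof. by rewrite /nrm conjCK mulrC. Qed.

Lemma nrm_nat (n : nat) : nrm n%:R = (n ^ 2)%N.
Proof. by apply: nrm_natE; rewrite ?rpred_nat // conjC_nat -natrM mulnn. Qed.

Lemma Zi_unit x : x \in Zi -> x != 0 -> (x^-1 \in Zi) = (nrm x == 1%N).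
Proof.
move=> xZ x0; apply/idP/eqP => [xV|n1].
  have := nrmM xZ xV; rewrite divff // (_ : nrm 1 = 1%N); last first.
    by rewrite -[1]/(1%:R) nrm_nat.
  by move/esym/eqP; rewrite muln_eq1 => /andP[/eqP].
have := nrmE xZ; rewrite n1 => e.
suff -> : x^-1 = x^* by rewrite conj_Zi.
by apply: (mulfI x0); rewrite divff // -e.
Qed.

Lemma intr_Creal (m : int) : m%:~R \is @Num.real algC.
Proof. by rewrite Rreal_int ?intr_int. Qed.

Lemma one_neq_opp1 : 1 <> -1 :> algC.
Proof. by move/eqP; rewrite -subr_eq0 opprK -(natrD _ 1 1) pnatr_eq0. Qed.

Lemma round_real (r : algC) : r \is Num.real -> exists m : int, (r - m%:~R) ^+ 2 <= 1 / 4.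
Proof.
move=> rr; have h2 : 1 / 2 \is @Num.real algC by rewrite rpred_div ?rpred1 ?realn.
have r2 : r + 1 / 2 \is Num.real by rewrite rpredD.
have /andP[] := real_floor_itv r2; set m := Num.floor _; rewrite rmorphD /= => h1 h3.
have mr := intr_Creal m.
exists m; have -> : 1 / 4 = (1 / 2) ^+ 2 :> algC by field.
have rm : r - m%:~R \is Num.real by rewrite rpredB.
rewrite -(real_normK rm) lerXn2r ?nnegrE ?divr_ge0 ?ler01 ?ler0n //.
rewrite real_ler_norml //; apply/andP; split.
  by rewrite -subr_ge0 (_ : _ - _ = r + 1 / 2 - m%:~R) ?subr_ge0 //; ring.
rewrite -subr_ge0 (_ : _ - _ = m%:~R + 1 - (r + 1 / 2)) ?subr_ge0 ?ltW //; by field.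
Qed.

Lemma Zi_round x : x \in Qi -> exists2 q, q \in Zi & `|x - q| ^+ 2 < 1.
Proof.
move=> /andP[xr xi].
have [m hm] := round_real (Creal_Crat xr); have [n hn] := round_real (Creal_Crat xi).
exists (m%:~R + 'i * n%:~R).
  by rewrite rpredD ?rpredM ?i_Zi ?Zi_int.
have -> : x - (m%:~R + 'i * n%:~R) = ('Re x - m%:~R) + 'i * ('Im x - n%:~R).
  by rewrite {1}[x]algCrect; ring.
have rm : 'Re x - m%:~R \is Num.real by rewrite rpredB ?Creal_Re ?Rreal_int ?intr_int.
have rn : 'Im x - n%:~R \is Num.real by rewrite rpredB ?Creal_Im ?Rreal_int ?intr_int.
rewrite normC2_Re_Im Re_rect // Im_rect //; apply: le_lt_trans (lerD hm hn) _.
by rewrite -subr_gt0 (_ : _ - _ = 1 / 2) ?divr_gt0 ?ltr01 ?ltr0n //; field.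
Qed.

Lemma Zi_euclid a b : a \in Zi -> b \in Zi -> b != 0 ->
  exists q r, [/\ q \in Zi, r \in Zi, a = q * b + r & (nrm r < nrm b)%N].
Proof.
move=> aZ bZ b0; have abQ : a / b \in Qi by rewrite rpred_div ?Zi_Qi.
have [q qZ hq] := Zi_round abQ; exists q, (a - q * b).
have rZ : a - q * b \in Zi by rewrite rpredB ?rpredM.
split=> //; first by ring.
rewrite -(ltr_nat algC) !nrmE // -!normCK.
have -> : a - q * b = (a / b - q) * b by field.
by rewrite normrM exprMn gtr_pMl // exprn_gt0 // normr_gt0.
Qed.

(** * Ideals, divisibility and primes of Z[i] *)

Definition Zi_ideal (P : algC -> Prop) : Prop :=
  [/\ P 0, forall x y, P x -> P y -> P (x + y) & forall r x, r \in Zi -> P x -> P (r * x)].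

(** Classical, because the predicates to be minimized speak of arbitrary ideals of [algC] and are
    not decidable. *)
Lemma least_nat (P : nat -> Prop) : (exists n, P n) ->
  exists2 n, P n & forall m, P m -> (n <= m)%N.
Proof.
case=> n; elim/ltn_ind: n => n IH Pn.
have [[m [mn Pm]]|H] := classic (exists m, (m < n)%N /\ P m); first exact: IH Pm.
exists n => // m Pm; rewrite leqNgt; apply/negP => mn; apply: H; by exists m.
Qed.

Lemma Zi_principal P : Zi_ideal P -> (forall x, P x -> x \in Zi) ->
  (exists x, P x /\ x != 0) ->
  exists g, [/\ P g, g != 0 & forall x, P x -> x / g \in Zi].
Proof.
move=> [P0 PD PM] PZ [x0 [Px0 x00]].
have [|n [g [Pg g0 <-]] gmin] :=
    @least_nat (fun n => exists g, [/\ P g, g != 0 & nrm g = n]).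
  by exists (nrm x0), x0.
exists g; split=> // x Px.
have [q [r [qZ rZ e lt]]] := Zi_euclid (PZ _ Px) (PZ _ Pg) g0.
have Pr : P r.
  have -> : r = x + (- q) * g by rewrite e; ring.
  by apply: PD => //; apply: PM => //; rewrite rpredN.
have [r0|r0] := eqVneq r 0; first by rewrite e r0 addr0 mulfK.
by have := gmin (nrm r) (ex_intro _ r (And3 Pr r0 erefl)); rewrite leqNgt lt.
Qed.

(** Since b / 0 = 0, the element 0 divides everything in this sense; hence the side conditions a !=
    0. *)
Definition gdvd (a b : algC) : bool := b / a \in Zi.

Lemma gdvdP a b : a != 0 -> gdvd a b -> exists2 t, t \in Zi & b = a * t.
Proof. by move=> a0 ab; exists (b / a) => //; rewrite mulrC divfK. Qed.

Lemma gdvd_mulr a b c : c \in Zi -> gdvd a b -> gdvd a (b * c).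
Proof. by move=> cZ ab; rewrite /gdvd mulrAC rpredM. Qed.

Lemma gdvd_mull a b c : c \in Zi -> gdvd a b -> gdvd a (c * b).
Proof. by move=> cZ ab; rewrite mulrC gdvd_mulr. Qed.

Lemma gdvdD a b c : gdvd a b -> gdvd a c -> gdvd a (b + c).
Proof. by move=> ab ac; rewrite /gdvd mulrDl rpredD. Qed.

Lemma gdvdB a b c : gdvd a b -> gdvd a c -> gdvd a (b - c).
Proof. by move=> ab ac; rewrite /gdvd mulrBl rpredB. Qed.

Lemma gdvdnn a : a != 0 -> gdvd a a.
Proof. by move=> a0; rewrite /gdvd divff ?rpred1. Qed.

Lemma gdvd_conj a b : gdvd a^* b^* = gdvd a b.
Proof. by rewrite /gdvd -fmorph_div conj_Zi. Qed.

Lemma gdvd_trans b a c : b != 0 -> gdvd a b -> gdvd b c -> gdvd a c.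
Proof.
move=> b0 ab bc; have -> : gdvd a c = ((c / b) * (b / a) \in Zi) by rewrite mulrA divfK.
exact: rpredM.
Qed.

Lemma nrm_dvd a b : a \in Zi -> b \in Zi -> a != 0 -> gdvd a b -> (nrm a %| nrm b)%N.
Proof. by move=> aZ bZ a0 /(gdvdP a0)[t tZ ->]; rewrite nrmM // dvdn_mulr. Qed.

Definition gprime (a : algC) : Prop :=
  [/\ a \in Zi, a != 0, a^-1 \notin Zi &
    forall x y, x \in Zi -> y \in Zi -> gdvd a (x * y) -> gdvd a x \/ gdvd a y].

(** A nonunit divisor a of least norm is prime: let g generate (a, x). If g is a unit, Bezout gives
    a | y; otherwise minimality makes g an associate of a, and a | x. *)
Lemma gprime_exists c : c \in Zi -> c != 0 -> c^-1 \notin Zi ->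
  exists2 a, gprime a & gdvd a c.
Proof.
move=> cZ c0 cU.
have [|n [a [[aZ a0 aU ac] <-]] amin] := @least_nat (fun n => exists a,
    [/\ a \in Zi, a != 0, a^-1 \notin Zi & gdvd a c] /\ nrm a = n).
  by exists (nrm c), c; split=> //; split=> //; apply: gdvdnn.
exists a => //; split=> // x y xZ yZ axy.
pose P z := exists u v, [/\ u \in Zi, v \in Zi & z = u * a + v * x].
have IP : Zi_ideal P.
  split; first by exists 0, 0; rewrite !rpred0; split=> //; ring.
    move=> _ _ [u [v [uZ vZ ->]]] [u' [v' [uZ' vZ' ->]]].
    by exists (u + u'), (v + v'); split; rewrite ?rpredD //; ring.
  move=> r _ rZ [u [v [uZ vZ ->]]].
  by exists (r * u), (r * v); split; rewrite ?rpredM //; ring.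
have [||g [Pg g0 gP]] := Zi_principal IP.
- by move=> z [u [v [uZ vZ ->]]]; rewrite rpredD ?rpredM.
- by exists a; split=> //; exists 1, 0; rewrite rpred1 rpred0; split=> //; ring.
have Pa : P a by exists 1, 0; rewrite rpred1 rpred0; split=> //; ring.
have Px : P x by exists 0, 1; rewrite rpred1 rpred0; split=> //; ring.
have [ga gx] := (gP _ Pa, gP _ Px).
case: Pg => u [v [uZ vZ eg]].
have gZ : g \in Zi by rewrite eg rpredD ?rpredM.
have [gU|gU] := boolP (g^-1 \in Zi).
  right; have ey : g * y = u * y * a + v * (x * y) by rewrite eg; ring.
  rewrite -[y](mulKf g0) ey.
  apply: gdvd_mull => //; apply: gdvdD; last exact: gdvd_mull.
  by apply: gdvd_mull (gdvdnn a0); apply: rpredM.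
left; have := amin _ (ex_intro _ g (conj (And4 gZ g0 gU (gdvd_trans a0 ga ac)) erefl)).
have [t tZ et] := gdvdP g0 ga.
have t0 : t != 0 by apply: contraNneq a0 => t0; rewrite et t0 mulr0.
have n0 : (0 < nrm g)%N by rewrite lt0n nrm_eq0.
have t0' : (0 < nrm t)%N by rewrite lt0n nrm_eq0.
rewrite {1}et nrmM // => le1.
have : nrm t == 1%N by rewrite eqn_leq t0' -(leq_pmul2l n0) muln1 le1.
rewrite -Zi_unit // => tU; rewrite /gdvd et invfM mulrA.
exact: rpredM.
Qed.

Lemma Zi_mul_ind (S : algC -> Prop) c : c \in Zi -> c != 0 ->
  (forall u, u \in Zi -> u^-1 \in Zi -> u != 0 -> S u) ->
  (forall a, gprime a -> gdvd a c -> S a) ->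
  (forall x y, S x -> S y -> S (x * y)) -> S c.
Proof.
move=> + + SU + SM; move eN : (nrm c) => N; elim/ltn_ind: N c eN => N IH c eN cZ c0 SP.
have [cU|cU] := boolP (c^-1 \in Zi); first exact: SU.
have [a ap ac] := gprime_exists cZ c0 cU.
have Sa := SP a ap ac; case: ap => aZ a0 aU _.
have [t tZ et] := gdvdP a0 ac.
have t0 : t != 0 by apply: contraNneq c0 => t0; rewrite et t0 mulr0.
rewrite et; apply: SM => //; apply: (IH (nrm t)) => //.
  rewrite -eN et nrmM //; move: aU; rewrite Zi_unit // => a1.
  apply: ltn_Pmull; last by rewrite lt0n nrm_eq0.
  by rewrite ltn_neqAle eq_sym a1 lt0n nrm_eq0.
move=> b bp bt; apply: SP => //; rewrite et; exact: gdvd_mull.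
Qed.

Lemma Zi_squarefree c : c \in Zi -> c != 0 ->
  exists s c', [/\ s \in Zi, s != 0, c' \in Zi, c = c' * s ^+ 2 &
    forall a, gprime a -> ~~ gdvd (a ^+ 2) c'].
Proof.
move eN : (nrm c) => N; elim/ltn_ind: N c eN => N IH c eN cZ c0.
have [[a [ap ac]]|H] := classic (exists a, gprime a /\ gdvd (a ^+ 2) c); last first.
  exists 1, c; split; rewrite ?rpred1 ?oner_neq0 ?expr1n ?mulr1 //.
  by move=> a ap; apply/negP => ac; apply: H; exists a.
case: ap => aZ a0 aU _.
have [t tZ et] := gdvdP (expf_neq0 2 a0) ac.
have t0 : t != 0 by apply: contraNneq c0 => t0; rewrite et t0 mulr0.
have [|s [c' [sZ s0 cZ' e' sf]]] := IH (nrm t) _ t erefl tZ t0.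
  rewrite -eN et nrmM ?rpredX // nrmX //; move: aU; rewrite Zi_unit // => a1.
  apply: ltn_Pmull; last by rewrite lt0n nrm_eq0.
  by rewrite -{1}(exp1n 2) ltn_exp2r // ltn_neqAle eq_sym a1 lt0n nrm_eq0.
exists (a * s), c'; split; rewrite ?rpredM ?mulf_neq0 //.
by rewrite et e'; ring.
Qed.

(** Twice the real and imaginary parts are integers M, N, and M^2 + N^2 = 4 nrm x forces both to be
    even. *)
Lemma ZiP x : x \in Zi -> exists m n : int, x = m%:~R + 'i * n%:~R.
Proof.
move=> xZ; have xA := Zi_Aint xZ; case/andP: (Zi_Qi xZ) => rR iR.
have xcA : x^* \in Aint by rewrite Aint_aut.
have eRe : 'Re x = (x + x^*) / 2 by rewrite ReE.
have eIm : 2 * 'Im x = 'i * (x^* - x) by rewrite ImE; field.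
have /intrP[M eM] : 2 * 'Re x \in Num.int.
  apply: Cint_rat_Aint; first by rewrite rpredM ?rpred_nat.
  by rewrite eRe mulrC divfK ?pnatr_eq0 // rpredD.
have /intrP[N eN] : 2 * 'Im x \in Num.int.
  apply: Cint_rat_Aint; first by rewrite rpredM ?rpred_nat.
  by rewrite eIm rpredM ?i_Aint ?rpredB.
have e4 : (M ^+ 2 + N ^+ 2)%:~R = (4 * (nrm x)%:Z)%:~R :> algC.
  rewrite rmorphD !rmorphXn rmorphM /= -pmulrn nrmE // -normCK normC2_Re_Im -eM -eN.
  by ring.
have {}e4 := intr_inj e4.
have [[m em] [n en]] : (exists m, M = 2 * m) /\ (exists n, N = 2 * n).
  have [m em] : exists m, M = 2 * m \/ M = 2 * m + 1 by exists (M %/ 2)%Z; lia.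
  have [n en] : exists n, N = 2 * n \/ N = 2 * n + 1 by exists (N %/ 2)%Z; lia.
  case: em en => em [] en; try by exfalso; move: e4; rewrite em en; lia.
  by split; [exists m | exists n].
have n2 : 2 != 0 :> algC by rewrite pnatr_eq0.
exists m, n; rewrite {1}[x]algCrect; congr (_ + 'i * _); apply: (mulfI n2).
  by rewrite eM em rmorphM.
by rewrite eN en rmorphM.
Qed.

Lemma Zi_unitP x : x \in Zi -> x^-1 \in Zi -> x != 0 -> [\/ x = 1, x = -1, x = 'i | x = - 'i].
Proof.
move=> xZ xV x0; move: xV; rewrite Zi_unit // => /eqP n1.
have [m [n e]] := ZiP xZ; have := nrmE xZ.
have mr := intr_Creal m.
have nr := intr_Creal n.
rewrite n1 -normCK normC2_Re_Im e Re_rect // Im_rect // -!rmorphXn -rmorphD /=.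
rewrite -[1%:R]/(1%:~R) => /intr_inj e1.
have [[]|[]] : (m = 0 /\ (n = 1 \/ n = -1)) \/ (n = 0 /\ (m = 1 \/ m = -1)) by nia.
  move=> -> [] ->; rewrite ?rmorphN /= ?mulrN !mulr1 !add0r; by [apply: Or43 | apply: Or44].
by move=> -> [] ->; rewrite mulr0 addr0; [apply: Or41 | apply: Or42].
Qed.

Lemma gdvd_int p a (m : int) : prime p -> a \in Zi -> nrm a = p -> gdvd a m%:~R -> (p %| m)%Z.
Proof.
move=> pp aZ na am.
have a0 : a != 0 by rewrite -nrm_eq0 // na -lt0n prime_gt0.
have := nrm_dvd aZ (Zi_int m) a0 am.
have -> : nrm m%:~R = (`|m| ^ 2)%N.
  apply: nrm_natE; first exact: Zi_int.
  by rewrite rmorph_int -rmorphM /= pmulrn; congr (_%:~R); lia.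
by rewrite na Euclid_dvdX // andbT dvdzE.
Qed.

Lemma Zi_residue p a x : prime p -> a \in Zi -> nrm a = p -> x \in Zi ->
  exists m : int, gdvd a (x - m%:~R).
Proof.
move=> pp aZ na xZ; have [e [f ex]] := ZiP xZ; have [u [v ea]] := ZiP aZ.
have p0 := prime_gt0 pp.
have a0 : a != 0 by rewrite -nrm_eq0 // na -lt0n.
have uR := intr_Creal u.
have vR := intr_Creal v.
have epa : p%:R = a * a^* by rewrite -nrmE ?na.
have euv : p%:Z = u ^+ 2 + v ^+ 2.
  apply: (@intr_inj algC); rewrite -pmulrn epa -normCK normC2_Re_Im ea Re_rect // Im_rect //.
  by rewrite rmorphD !rmorphXn.
have cop : coprimez v p.
  rewrite coprimezE /= coprime_sym prime_coprime //; apply/negP => pv.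
  have euvn : (p = `|u| ^ 2 + `|v| ^ 2)%N by lia.
  have pu : (p %| `|u| ^ 2)%N.
    by rewrite -(@dvdn_addl (`|v| ^ 2)%N) -?euvn // dvdn_exp.
  rewrite Euclid_dvdX // andbT in pu.
  have := dvdn_add (dvdn_exp2r 2 pu) (dvdn_exp2r 2 pv); rewrite -euvn => /(dvdn_leq p0).
  by rewrite -{2}[p]muln1 -mulnn leq_pmul2l // leqNgt prime_gt1.
have /coprimezP[[b c] /= ebc] := cop.
(* Modulo a = u + iv one has i = -u / v, and b inverts v modulo p; so x = e + if reduces to this
   integer. *)
exists (b * (v * e - f * u)).
have -> : x - (b * (v * e - f * u))%:~R = a * (x * c%:~R * a^* + b%:~R * f%:~R).
  have -> : a * (x * c%:~R * a^* + b%:~R * f%:~R) = x * (c%:~R * (a * a^*)) + b%:~R * f%:~R * a by ring.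
  have -> : c%:~R * (a * a^*) = 1 - b%:~R * v%:~R :> algC.
    have ecp : c * p = 1 - b * v by rewrite -ebc [RHS]addrAC subrr add0r.
    by rewrite -epa pmulrn -rmorphM ecp rmorphB rmorphM.
  by rewrite !(rmorphM, rmorphB) /= ex ea; ring.
rewrite /gdvd mulrAC divff // mul1r rpredD ?rpredM ?conj_Zi ?Zi_int //.
Qed.

Lemma qres_of_Zi_square p a (m : int) x : prime p -> a \in Zi -> nrm a = p -> x \in Zi ->
  gdvd a (x ^+ 2 - m%:~R) -> qres p m.
Proof.
move=> pp aZ na xZ axm; have [n an] := Zi_residue pp aZ na xZ.
apply: (@qres_sqr p n) => //; apply: (gdvd_int pp aZ na).
have -> : (n ^+ 2 - m)%:~R = x ^+ 2 - m%:~R - (x - n%:~R) * (x + n%:~R) :> algC.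
  by rewrite rmorphB rmorphXn /=; ring.
by apply: gdvdB => //; apply: gdvd_mulr an; rewrite rpredD ?Zi_int.
Qed.

(** Every residue class modulo a contains a rational integer, which reduces primality of a to
    Euclid's lemma for p. *)
Lemma gprime_of_prime_norm p a : prime p -> a \in Zi -> nrm a = p -> gprime a.
Proof.
move=> pp aZ na; have p1 := prime_gt1 pp.
have a0 : a != 0 by rewrite -nrm_eq0 // na -lt0n; apply: ltnW.
split=> //; first by rewrite Zi_unit // na gtn_eqF.
move=> x y xZ yZ axy.
have [m xm] := Zi_residue pp aZ na xZ; have [n yn] := Zi_residue pp aZ na yZ.
have : gdvd a (m * n)%:~R.
  have -> : (m * n)%:~R = x * y - (x - m%:~R) * y - m%:~R * (y - n%:~R) :> algC.
    by rewrite rmorphM /=; ring.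
  apply: gdvdB; last by apply: gdvd_mull yn; apply: Zi_int.
  by apply: gdvdB => //; apply: gdvd_mulr xm.
move/(gdvd_int pp aZ na); rewrite dvdzE abszM Euclid_dvdM //.
have pa k : (p %| `|k|)%N -> gdvd a k%:~R.
  move=> /dvdnP[l ek]; have -> : k%:~R = (sgz k)%:~R * (l%:R * (a * a^*)) :> algC.
    by rewrite -nrmE // na -natrM -ek pmulrn -rmorphM /= -intEsg.
  by apply: gdvd_mull; rewrite ?Zi_int //; apply: gdvd_mull; rewrite ?rpred_nat //;
     apply: gdvd_mulr (gdvdnn a0); rewrite conj_Zi.
case/orP => /pa h; [left | right].
  by rewrite -[x](subrK m%:~R); apply: gdvdD.
by rewrite -[y](subrK n%:~R); apply: gdvdD.
Qed.

Lemma Zi_unit_div x : x \in Zi -> x != 0 -> nrm x = 1%N -> x^-1 \in Zi.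
Proof. by move=> xZ x0 n1; rewrite Zi_unit // n1. Qed.

Lemma gprime_dvd_norm p a b : prime p -> a \in Zi -> nrm a = p -> gprime b ->
  gdvd b p%:R -> (a / b \in Zi /\ b / a \in Zi) \/ (a^* / b \in Zi /\ b / a^* \in Zi).
Proof.
move=> pp aZ na [bZ b0 bU bM] bp.
have aux c : c \in Zi -> nrm c = p -> gdvd b c -> c / b \in Zi /\ b / c \in Zi.
  move=> cZ nc bc; split=> //; have [t tZ et] := gdvdP b0 bc.
  have c0 : c != 0 by rewrite -nrm_eq0 // nc -lt0n prime_gt0.
  have t0 : t != 0 by apply: contraNneq c0 => t0; rewrite et t0 mulr0.
  have nbt : (nrm b * nrm t = p)%N by rewrite -nc et nrmM.
  have : (nrm b %| p)%N by rewrite -nbt dvdn_mulr.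
  move: bU; rewrite Zi_unit // => b1; have /primeP[_ h] := pp.
  move/h; rewrite (negbTE b1) /= => /eqP nb.
  have nt : nrm t = 1%N.
    by apply/eqP; rewrite -(eqn_pmul2l (prime_gt0 pp)) muln1 -{1}nb nbt.
  have -> : b / c = t^-1 by rewrite et; field; rewrite t0 b0.
  exact: Zi_unit_div.
have := bM a a^*; rewrite conj_Zi -nrmE // na => /(_ aZ aZ bp) [h|h]; [left | right].
  exact: aux.
by apply: aux; rewrite ?conj_Zi ?nrm_conj.
Qed.

(** A prime c of y divides only one of a and b, so c^2 either divides that factor or reveals c in
    both; removing it lowers the norm of y. When y is a unit, a itself divides m. *)
Lemma gdvd_coprime_split a b m y : a \in Zi -> b \in Zi -> m \in Zi -> y \in Zi ->
  a != 0 -> b != 0 -> y != 0 -> a * b = m * y ^+ 2 ->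
  (forall c, gprime c -> gdvd c a -> gdvd c b -> False) ->
  exists a' z, [/\ a' \in Zi, z \in Zi, a = a' * z ^+ 2 & gdvd a' m].
Proof.
move eN : (nrm y) => N; elim/ltn_ind: N y a b eN => N IH y a b eN aZ bZ mZ yZ a0 b0 y0 e cop.
have [yU|yU] := boolP (y^-1 \in Zi).
  exists a, 1; split; rewrite ?rpred1 ?expr1n ?mulr1 //.
  have -> : m = a * (b * y^-1 ^+ 2) by rewrite mulrA e; field.
  by apply: gdvd_mulr (gdvdnn a0); rewrite rpredM ?rpredX.
have [c cp cy] := gprime_exists yZ y0 yU.
have [cZ c0 cU cM] := cp; have [y' yZ' ey] := gdvdP c0 cy.
have y0' : y' != 0 by apply: contraNneq y0 => t0; rewrite ey t0 mulr0.
have ny : (nrm y' < N)%N.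
  rewrite -eN ey nrmM //; move: cU; rewrite Zi_unit // => c1.
  apply: ltn_Pmull; last by rewrite lt0n nrm_eq0.
  by rewrite ltn_neqAle eq_sym c1 lt0n nrm_eq0.
have half u v : u \in Zi -> v \in Zi -> u * v = m * y ^+ 2 -> gdvd c u -> ~ gdvd c v ->
    exists2 w, w \in Zi & u = c ^+ 2 * w /\ w * v = m * y' ^+ 2.
  move=> uZ vZ euv /(gdvdP c0)[u1 u1Z eu] cv.
  have e1 : u1 * v = c * (m * y' ^+ 2) by apply: (mulfI c0); transitivity (u * v); [rewrite eu | rewrite euv ey]; ring.
  have : gdvd c (u1 * v) by rewrite e1; apply: gdvd_mulr (gdvdnn c0); rewrite rpredM ?rpredX.
  case/(cM _ _ u1Z vZ) => // /(gdvdP c0)[w wZ ew]; exists w => //; split.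
    by rewrite eu ew; ring.
  by apply: (mulfI c0); rewrite -e1 ew; ring.
have : gdvd c (a * b) by rewrite e ey; apply: gdvd_mull => //; rewrite expr2 -mulrA;
  apply: gdvd_mulr (gdvdnn c0); rewrite !rpredM.
case/(cM _ _ aZ bZ) => [ca|cb].
  have [w wZ [ea ew]] := half _ _ aZ bZ e ca (cop _ cp ca).
  have w0 : w != 0 by apply: contraNneq a0 => t0; rewrite ea t0 mulr0.
  have [|a' [z [aZ' zZ ew' am]]] := IH _ ny y' w b erefl wZ bZ mZ yZ' w0 b0 y0' ew.
    move=> f fp fw fb; apply: (cop f) => //; rewrite ea.
    by apply: gdvd_mull fw; rewrite rpredX.
  exists a', (c * z); split; rewrite ?rpredM //; rewrite ea ew'; ring.
have e' : b * a = m * y ^+ 2 by rewrite mulrC.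
have [w wZ [eb ew]] := half _ _ bZ aZ e' cb (fun ca => cop _ cp ca cb).
have w0 : w != 0 by apply: contraNneq b0 => t0; rewrite eb t0 mulr0.
apply: (IH _ ny y' a w) => //; first by rewrite mulrC.
move=> f fp fa fw; apply: (cop f) => //; rewrite eb.
by apply: gdvd_mull fw; rewrite rpredX.
Qed.

Lemma odd_logn_square p n m y z : prime p -> (0 < n)%N -> (0 < m)%N -> (0 < y)%N -> (0 < z)%N ->
  (n * z ^ 2 = m * y ^ 2)%N -> odd (logn p n) = odd (logn p m).
Proof.
move=> pp n0 m0 y0 z0; rewrite -!mulnn => /(congr1 (logn p)).
by rewrite !lognM ?muln_gt0 ?n0 ?m0 ?y0 ?z0 //; lia.
Qed.

Lemma gprime_not_unit_nrm a n : gprime a -> odd n -> (nrm a %| n)%N -> ~~ gdvd a 2.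
Proof.
move=> [aZ a0 aU _] on an; apply/negP => a2; move: aU; rewrite Zi_unit // => /negP; apply.
have := nrm_dvd aZ (rpred_nat _ 2) a0 a2; rewrite nrm_nat => a4.
have : (nrm a %| gcdn n (2 ^ 2))%N by rewrite dvdn_gcd an a4.
have -> : gcdn n (2 ^ 2) = 1%N by apply/eqP; rewrite [_ == _]coprimeXr // coprimen2.
by rewrite dvdn1.
Qed.

(** * Factoring x + i for solutions of negative Pell equations *)

Lemma conj_natDi (x : nat) : (x%:R + 'i)^* = x%:R - 'i :> algC.
Proof. by rewrite rmorphD /= conjC_nat conjCi. Qed.

Lemma natDi_Zi (x : nat) : x%:R + 'i \in Zi.
Proof. by rewrite rpredD ?rpred_nat ?i_Zi. Qed.

Lemma nrm_natDi (x : nat) : nrm (x%:R + 'i) = (x ^ 2 + 1)%N.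
Proof.
apply: nrm_natE; first exact: natDi_Zi.
rewrite conj_natDi.
have -> : (x%:R + 'i) * (x%:R - 'i) = x%:R ^+ 2 - 'i * 'i :> algC by ring.
by rewrite ii opprK natrD natrX.
Qed.

Lemma nrm_gt0 a : a \in Zi -> a != 0 -> (0 < nrm a)%N.
Proof. by move=> aZ a0; rewrite lt0n nrm_eq0. Qed.

Lemma nrm_neq0 a : a \in Zi -> (0 < nrm a)%N -> a != 0.
Proof. by move=> aZ; rewrite lt0n nrm_eq0. Qed.

Lemma gdvd_2i a : gdvd a (2 * 'i) -> gdvd a 2.
Proof.
move=> h; have -> : 2 = (2 * 'i) * (- 'i) :> algC by rewrite -mulrA mulrN ii opprK mulr1.
by apply: gdvd_mulr h; rewrite rpredN i_Zi.
Qed.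

(** x + i and x - i have odd norm and difference 2i, so they are coprime, and x + i = a z^2 with a |
    p. Then nrm a divides p^2 and has odd valuation at p, so it equals p. *)
Lemma pell_factor_prime p x y : prime p -> (p %% 4 = 1)%N -> (x ^ 2 + 1 = p * y ^ 2)%N ->
  exists a z, [/\ a \in Zi, z \in Zi, nrm a = p & x%:R + 'i = a * z ^+ 2].
Proof.
move=> pp p4 e; have p0 := prime_gt0 pp.
have y0 : (0 < y)%N by move: e; case: (y) => //; lia.
have on : odd (x ^ 2 + 1).
  have [k ek] : exists k, p = (4 * k + 1)%N by exists (p %/ 4)%N; lia.
  have [l el] : exists l, y = (2 * l)%N \/ y = (2 * l + 1)%N by exists (y %/ 2)%N; lia.
  have [m em] : exists m, x = (2 * m)%N \/ x = (2 * m + 1)%N by exists (x %/ 2)%N; lia.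
  by case: em el => em [] el; move: e; rewrite em el ek; lia.
have xZ := natDi_Zi x; have xcZ : x%:R - 'i \in Zi by rewrite -conj_natDi conj_Zi.
have x0 : x%:R + 'i != 0 :> algC by rewrite -nrm_eq0 // nrm_natDi addn1.
have xc0 : x%:R - 'i != 0 :> algC by rewrite -conj_natDi fmorph_eq0.
have pZ : p%:R \in Zi by rewrite rpred_nat.
have yZ : y%:R \in Zi by rewrite rpred_nat.
have y0C : y%:R != 0 :> algC by rewrite pnatr_eq0 -lt0n.
have eC : (x%:R + 'i) * (x%:R - 'i) = p%:R * y%:R ^+ 2 :> algC.
  by rewrite -conj_natDi -nrmE // nrm_natDi e natrM natrX.
have [c cp ca cb|a [z [aZ zZ ea ap]]] := gdvd_coprime_split xZ xcZ pZ yZ x0 xc0 y0C eC.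
  have [cZ c0 _ _] := cp.
  have nd : (nrm c %| x ^ 2 + 1)%N by rewrite -nrm_natDi; apply: nrm_dvd.
  case/negP: (gprime_not_unit_nrm cp on nd).
  apply: gdvd_2i; have -> : 2 * 'i = (x%:R + 'i) - (x%:R - 'i) :> algC by ring.
  exact: gdvdB.
exists a, z; split=> //.
have a0 : a != 0 by apply: contraNneq x0 => a0; rewrite ea a0 mul0r.
have z0 : z != 0 by apply: contraNneq x0 => z0; rewrite ea z0 expr0n mulr0.
have eN : (nrm a * nrm z ^ 2 = p * y ^ 2)%N by rewrite -e -nrm_natDi ea nrmM ?rpredX // nrmX.
have := odd_logn_square pp (nrm_gt0 aZ a0) p0 y0 (nrm_gt0 zZ z0) eN.
rewrite (pfactorK 1 pp) /=.
have := nrm_dvd aZ pZ a0 ap; rewrite nrm_nat => /(dvdn_pfactor _ _ pp)[k k2 ->].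
by rewrite pfactorK //; case: k k2 => [|[|[]]].
Qed.

(** Fermat's two squares theorem, here a by-product of the negative Pell equation for p. *)
Lemma prime_norm_exists p : prime p -> (p %% 4 = 1)%N -> exists2 a, a \in Zi & nrm a = p.
Proof.
move=> pp p4; have [x [y e]] := negative_pell_prime pp p4.
by have [a [z [aZ _ na _]]] := pell_factor_prime pp p4 e; exists a.
Qed.

Lemma prime_norm_dvd p c : prime p -> (p %% 4 = 1)%N -> c \in Zi -> (p %| nrm c)%N ->
  exists a, [/\ a \in Zi, nrm a = p & gdvd a c].
Proof.
move=> pp p4 cZ pc; have [a aZ na] := prime_norm_exists pp p4.
have ccZ : c^* \in Zi by rewrite conj_Zi.
have a0 : a != 0 by apply: nrm_neq0; rewrite ?na ?prime_gt0.
have [_ _ _ aM] := gprime_of_prime_norm pp aZ na.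
have : gdvd a (c * c^*).
  have [k ek] := dvdnP pc; rewrite -nrmE // ek natrM -na nrmE //.
  apply: gdvd_mull; first exact: rpred_nat.
  by apply: gdvd_mulr (gdvdnn a0); rewrite conj_Zi.
case/(aM _ _ cZ ccZ) => h; first by exists a.
exists a^*; rewrite conj_Zi nrm_conj; split=> //.
by rewrite -gdvd_conj conjCK.
Qed.

Lemma pell_factor_two_primes p1 p2 x y : prime p1 -> prime p2 ->
  (p1 %% 4 = 1)%N -> (p2 %% 4 = 1)%N -> p1 != p2 -> (x ^ 2 + 1 = 2 * p1 * p2 * y ^ 2)%N ->
  exists a1 a2 z u, [/\ [/\ a1 \in Zi, a2 \in Zi & z \in Zi], nrm a1 = p1, nrm a2 = p2,
    u \in Zi /\ nrm u = 1%N & x%:R + 'i = (1 + 'i) * a1 * a2 * u * z ^+ 2].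
Proof.
move=> pp1 pp2 m1 m2 p12 e.
have [p10 p20] := (prime_gt0 pp1, prime_gt0 pp2).
have y0 : (0 < y)%N by move: e; case: (y) => //; lia.
have [h eh] : exists h, x = (2 * h + 1)%N.
  exists (x %/ 2)%N; suff : odd x by lia.
  have : odd (x ^ 2 + 1) = false by rewrite e -!mulnA oddM.
  by rewrite oddD oddX /=; case: (odd x).
have on : odd (p1 * p2 * y ^ 2).
  have -> : (p1 * p2 * y ^ 2 = 2 * (h ^ 2 + h) + 1)%N by move: e; rewrite eh; lia.
  by rewrite oddD oddM.
(* X = (x + i) / (1 + i) for x = 2h + 1. Its norm is odd, so X and its conjugate are coprime by the
   argument of the one-prime case. *)
pose X : algC := h%:R + 1 - 'i * h%:R.
have XZ : X \in Zi by rewrite rpredB ?rpredD ?rpredM ?rpred1 ?rpred_nat ?i_Zi.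
have XcZ : X^* \in Zi by rewrite conj_Zi.
have eX : x%:R + 'i = (1 + 'i) * X.
  rewrite /X eh natrD natrM.
  have -> : (1 + 'i) * (h%:R + 1 - 'i * h%:R) = h%:R + 1 + 'i - ('i * 'i) * h%:R :> algC by ring.
  by rewrite ii; ring.
have lZ : 1 + 'i \in Zi by rewrite rpredD ?rpred1 ?i_Zi.
have nl : nrm (1 + 'i) = 2%N by rewrite -[1]/(1%:R) nrm_natDi.
have nX : nrm X = (p1 * p2 * y ^ 2)%N.
  by apply/eqP; rewrite -(eqn_pmul2l (isT : 0 < 2)%N) -{1}nl -nrmM // -eX nrm_natDi e !mulnA.
have X0 : X != 0 by apply: nrm_neq0; rewrite // nX !muln_gt0 p10 p20 ?expn_gt0 y0.
have Xc0 : X^* != 0 by rewrite fmorph_eq0.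
have mZ : (p1 * p2)%:R \in Zi by rewrite rpred_nat.
have yZ : y%:R \in Zi by rewrite rpred_nat.
have y0C : y%:R != 0 :> algC by rewrite pnatr_eq0 -lt0n.
have eC : X * X^* = (p1 * p2)%:R * y%:R ^+ 2 by rewrite -nrmE // nX natrM natrX.
have [c cp ca cb|a [z [aZ zZ ea am]]] := gdvd_coprime_split XZ XcZ mZ yZ X0 Xc0 y0C eC.
  have [cZ c0 _ _] := cp.
  have nd : (nrm c %| p1 * p2 * y ^ 2)%N by rewrite -nX; apply: nrm_dvd.
  case/negP: (gprime_not_unit_nrm cp on nd).
  apply: gdvd_2i; have -> : 2 * 'i = (1 + 'i) * X - (1 + 'i)^* * X^* :> algC.
    have <- : x%:R - 'i = (1 + 'i)^* * X^* by rewrite -conj_natDi eX rmorphM.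
    by rewrite -eX; ring.
  by apply: gdvdB; apply: gdvd_mull; rewrite ?conj_Zi.
have a0 : a != 0 by apply: contraNneq X0 => a0; rewrite ea a0 mul0r.
have z0 : z != 0 by apply: contraNneq X0 => z0; rewrite ea z0 expr0n mulr0.
have eN : (nrm a * nrm z ^ 2 = p1 * p2 * y ^ 2)%N by rewrite -nX ea nrmM ?rpredX // nrmX.
have n0 := nrm_gt0 aZ a0; have nz0 := nrm_gt0 zZ z0.
have l12 : logn p1 p2 = 0%N by rewrite logn_prime // (negbTE p12).
have l21 : logn p2 p1 = 0%N by rewrite logn_prime // eq_sym (negbTE p12).
have m0 : (0 < p1 * p2)%N by rewrite muln_gt0 p10.
have d1 : (p1 %| nrm a)%N.
  have := odd_logn_square pp1 n0 m0 y0 nz0 eN.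
  rewrite lognM // l12 (pfactorK 1 pp1) => o; rewrite -[p1]expn1 pfactor_dvdn //.
  by move: o; case: logn.
have [a1 [a1Z na1 a1a]] := prime_norm_dvd pp1 m1 aZ d1.
have a10 : a1 != 0 by apply: nrm_neq0; rewrite ?na1.
have [t tZ et] := gdvdP a10 a1a.
have t0 : t != 0 by apply: contraNneq a0 => t0; rewrite et t0 mulr0.
have nt0 := nrm_gt0 tZ t0.
have eNt : (nrm t * nrm z ^ 2 = p2 * y ^ 2)%N.
  by apply/eqP; rewrite -(eqn_pmul2l p10) (mulnA p1 p2) -eN et nrmM // na1 mulnA.
have d2 : (p2 %| nrm t)%N.
  have := odd_logn_square pp2 nt0 p20 y0 nz0 eNt.
  rewrite (pfactorK 1 pp2) => o; rewrite -[p2]expn1 pfactor_dvdn //.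
  by move: o; case: logn.
have [a2 [a2Z na2 a2t]] := prime_norm_dvd pp2 m2 tZ d2.
have a20 : a2 != 0 by apply: nrm_neq0; rewrite ?na2.
have [u uZ eu] := gdvdP a20 a2t.
have u0 : u != 0 by apply: contraNneq t0 => u0; rewrite eu u0 mulr0.
have nu0 := nrm_gt0 uZ u0.
exists a1, a2, z, u; split=> //; last by rewrite eX ea et eu; ring.
(* The norm of u differs from 1 by squares, so a prime q occurs in it to an even power; but nrm u
   divides p1 p2, so q occurs at most once. *)
split=> //; apply/eqP/contraT => u1.
have ug1 : (1 < nrm u)%N by rewrite ltn_neqAle eq_sym u1.
set q := pdiv (nrm u); have pq : prime q := pdiv_prime ug1.
have eNu : (nrm u * nrm z ^ 2 = 1 * y ^ 2)%N.
  by apply/eqP; rewrite -(eqn_pmul2l p20) mul1n -eNt eu nrmM // na2 mulnA.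
have := odd_logn_square pq nu0 (isT : (0 < 1)%N) y0 nz0 eNu; rewrite logn1 /=.
have dNu : (nrm u %| p1 * p2)%N.
  have := nrm_dvd aZ mZ a0 am; rewrite nrm_nat et eu !nrmM ?rpredM // na1 na2 mulnA.
  by rewrite -mulnn dvdn_pmul2l.
have : (0 < logn q (nrm u))%N by rewrite logn_gt0 mem_primes pq nu0 pdiv_dvd.
have : (logn q (nrm u) <= 1)%N; last by case: logn => [|[]].
apply: leq_trans (dvdn_leq_log q m0 dNu) _.
rewrite lognM // !logn_prime //; case: (eqVneq q p1) => [->|_]; last by case: eqP.
by rewrite (negbTE p12).
Qed.

(** * Ideals *)

Lemma AintP x : x \in Aint <-> integralOver (intr : int -> algC) x.
Proof.
split=> [xA | [p mp rp]]; last first.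
  apply: (root_monic_Aint rp); first exact: monic_map.
  by apply/polyOverP => i; rewrite coef_map /= intr_int.
have /floorpP[p ep] : minCpoly x \is a polyOver Num.int by [].
exists p; last by rewrite -ep root_minCpoly.
have := minCpoly_monic x; rewrite ep !monicE lead_coef_map_inj //; last exact: intr_inj.
by rewrite -[1]/(1%:~R) (inj_eq (@intr_inj _)).
Qed.

(** Integral closure in degree 2: elements are shown integral by exhibiting integral trace t and
    norm n. *)
Lemma Aint_quadratic (t n w : algC) : t \in Aint -> n \in Aint -> w ^+ 2 = t * w - n -> w \in Aint.
Proof.
move=> tA nA e; apply/AintP.
pose p : {poly algC} := 'X^2 - t *: 'X + n%:P.
have sz : (size (- (t *: 'X) + n%:P)%R < size ('X^2 : {poly algC})%R)%N.
  rewrite size_polyXn; apply: leq_ltn_trans (size_polyD _ _) _.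
  rewrite gtn_max size_polyN; apply/andP; split; last by apply: leq_ltn_trans (size_polyC_leq1 _) _.
  by apply: leq_ltn_trans (size_scale_leq _ _) _; rewrite size_polyX.
have ep : p = 'X^2 + (- (t *: 'X) + n%:P) by rewrite addrA.
have mp : p \is monic by rewrite ep monicE lead_coefDl // lead_coefXn.
apply: (integral_root_monic mp).
  by rewrite /root /p !hornerE e; apply/eqP; ring.
move=> c /(nthP 0)[i _ <-]; apply/AintP.
rewrite /p !coefE; apply: rpredD; last by case: eqP.
by apply: rpredB; rewrite ?rpred_nat // rpredM ?rpred_nat.
Qed.

Lemma Aint_sqrt (w : algC) : w ^+ 2 \in Aint -> w \in Aint.
Proof.
move=> wA; apply: (@Aint_quadratic 0 (- w ^+ 2)); rewrite ?rpred0 ?rpredN //; ring.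
Qed.

Definition subring (O : algC -> Prop) : Prop :=
  [/\ O 0, O 1, forall x y, O x -> O y -> O (x + y) & forall x y, O x -> O y -> O (x * y)].

Lemma ring_of_integers_subring K : is_subfield K -> subring (ring_of_integers K).
Proof.
move=> [K0 [K1 [KB [KM KV]]]]; split.
- by split=> //; apply: rpred0.
- by split=> //; apply: rpred1.
- move=> x y [Kx xA] [Ky yA]; split; last exact: rpredD.
  have -> : x + y = x - (0 - y) by ring.
  by apply: (KB) => //; apply: KB.
by move=> x y [Kx xA] [Ky yA]; split; [apply: KM | apply: rpredM].
Qed.

Section Ideals.
Variable O : algC -> Prop.
Hypothesis O_ring : subring O.
Implicit Types I J : algC -> Prop.

Lemma pred_ext (P Q : algC -> Prop) : (forall x, P x <-> Q x) -> P = Q.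
Proof. by move=> PQ; apply: functional_extensionality => x; apply: propositional_extensionality. Qed.

Lemma ideal_unit : is_ideal O O.
Proof. by case: O_ring => O0 O1 OD OM; split=> //; split=> //; split. Qed.

Lemma ideal_sub I x : is_ideal O I -> I x -> O x.
Proof. by case=> IO _; apply: IO. Qed.

Lemma ideal_gen_ideal S : (forall x, S x -> O x) -> is_ideal O (ideal_gen O S).
Proof.
move=> SO; split; first by move=> x Gx; apply: Gx => //; apply: ideal_unit.
split; first by move=> J [_ [J0 _]].
split=> [x y Gx Gy J JI SJ|r x Or Gx J JI SJ]; have [_ [_ [JD JM]]] := JI.
  by apply: JD; [apply: Gx | apply: Gy].
by apply: (JM) => //; apply: Gx.
Qed.

Lemma ideal_mul_ideal I J : is_ideal O I -> is_ideal O J -> is_ideal O (ideal_mul O I J).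
Proof.
case: O_ring => _ _ _ OM II JI; apply: ideal_gen_ideal => _ [a [b [Ia [Jb ->]]]].
by apply: OM; [apply: ideal_sub Ia | apply: ideal_sub Jb].
Qed.

Lemma mem_ideal_mul I J a b : I a -> J b -> ideal_mul O I J (a * b).
Proof. by move=> Ia Jb M MI; apply; exists a, b. Qed.

Lemma ideal_mul_sub I J (P : algC -> Prop) : is_ideal O I -> is_ideal O J ->
  P 0 -> (forall x y, P x -> P y -> P (x + y)) -> (forall r x, O r -> P x -> P (r * x)) ->
  (forall a b, I a -> J b -> P (a * b)) -> forall x, ideal_mul O I J x -> P x.
Proof.
case: O_ring => O0 O1 OD OM II JI P0 PD PM PP x xM.
suff [] : O x /\ P x by [].
apply: (xM (fun x => O x /\ P x)).
  split; first by move=> y [].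
  split; first by split.
  split; first by move=> y z [Oy Py] [Oz Pz]; split; [apply: OD | apply: PD].
  by move=> r y Or [Oy Py]; split; [apply: OM | apply: PM].
move=> _ [a [b [Ia [Jb ->]]]]; split; last exact: PP.
by apply: OM; [apply: ideal_sub Ia | apply: ideal_sub Jb].
Qed.

Lemma ideal_mulA I J K : is_ideal O I -> is_ideal O J -> is_ideal O K ->
  ideal_mul O I (ideal_mul O J K) = ideal_mul O (ideal_mul O I J) K.
Proof.
move=> II JI KI; have [IJ JK] := (ideal_mul_ideal II JI, ideal_mul_ideal JI KI).
have [_ [L0 [LD LM]]] := ideal_mul_ideal II JK; have [_ [R0 [RD RM]]] := ideal_mul_ideal IJ KI.
apply: pred_ext => x; split.
  apply: ideal_mul_sub => // a c Ia; move: c.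
  apply: (ideal_mul_sub JI KI) => [|c d|r c Or|b k Jb Kk]; first by rewrite mulr0.
  - by rewrite mulrDr; apply: RD.
  - by rewrite mulrCA; apply: RM.
  by rewrite mulrA; apply: mem_ideal_mul => //; apply: mem_ideal_mul.
apply: ideal_mul_sub => // c k + Kk; move: c.
apply: (ideal_mul_sub II JI) => [|c d|r c Or|a b Ia Jb]; first by rewrite mul0r.
- by rewrite mulrDl; apply: LD.
- by rewrite -mulrA; apply: LM.
by rewrite -mulrA; apply: mem_ideal_mul => //; apply: mem_ideal_mul.
Qed.

Lemma ideal_mul1l I : is_ideal O I -> ideal_mul O O I = I.
Proof.
move=> II; have [_ [I0 [ID IM]]] := II; apply: pred_ext => x; split.
  by apply: (ideal_mul_sub ideal_unit II) => // a b; apply: IM.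
by move=> Ix; rewrite -[x]mul1r; apply: mem_ideal_mul => //; case: O_ring.
Qed.

Lemma ideal_mul1r I : is_ideal O I -> ideal_mul O I O = I.
Proof.
move=> II; have [_ [I0 [ID IM]]] := II; apply: pred_ext => x; split.
  by apply: (ideal_mul_sub II ideal_unit) => // a b Ia Ob; rewrite mulrC; apply: IM.
by move=> Ix; rewrite -[x]mulr1; apply: mem_ideal_mul => //; case: O_ring.
Qed.

Lemma ideal_pow_ideal I n : is_ideal O I -> is_ideal O (ideal_pow O I n).
Proof.
move=> II; elim: n => [|n IH]; first exact: ideal_unit.
exact: ideal_mul_ideal.
Qed.

Lemma ideal_powD I m n : is_ideal O I ->
  ideal_pow O I (m + n) = ideal_mul O (ideal_pow O I m) (ideal_pow O I n).
Proof.
move=> II; elim: m => [|m IH]; first by rewrite ideal_mul1l //; apply: ideal_pow_ideal.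
rewrite addSn [LHS]/= -/(ideal_pow O I (m + n)) IH ideal_mulA //; exact: ideal_pow_ideal.
Qed.

Definition ideal_sqr I := ideal_mul O I I.

Lemma ideal_sqr_ideal I : is_ideal O I -> is_ideal O (ideal_sqr I).
Proof. by move=> II; apply: ideal_mul_ideal. Qed.

Lemma ideal_pow_exp2 I n : is_ideal O I -> ideal_pow O I (2 ^ n) = iter n ideal_sqr I.
Proof.
move=> II; elim: n => [|n IH]; first exact: ideal_mul1r.
by rewrite expnS mul2n -addnn ideal_powD // IH.
Qed.

Lemma ideal_gen_id I : is_ideal O I -> ideal_gen O I = I.
Proof. by move=> II; apply: pred_ext => x; split=> [|Ix J _ IJ]; [apply | apply: IJ]. Qed.

Lemma principal_sqr I : is_ideal O I -> principal O I -> principal O (ideal_sqr I).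
Proof.
case: O_ring => O0 O1 OD OM II [a [Oa Ia]]; exists (a * a); split; first exact: OM.
have aI : I a by apply/Ia; exists 1; rewrite mul1r.
move=> x; split=> [|[r [Or ->]]].
  apply: (ideal_mul_sub II II (P := fun x => exists r, O r /\ x = r * (a * a))) =>
    [|y z|r y Or|y z].
  - by exists 0; rewrite mul0r.
  - by move=> [s [Os ->]] [t [Ot ->]]; exists (s + t); split; [apply: OD | ring].
  - by move=> [s [Os ->]]; exists (r * s); split; [apply: OM | ring].
  by move=> /Ia[s [Os ->]] /Ia[t [Ot ->]]; exists (s * t); split; [apply: OM | ring].
have [_ [_ [_ SM]]] := ideal_sqr_ideal II.
by apply: (SM) => //; apply: mem_ideal_mul.
Qed.

Lemma ideal_sqr_nonzero I : nonzero_ideal I -> nonzero_ideal (ideal_sqr I).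
Proof.
by move=> [x [Ix x0]]; exists (x * x); split; [apply: mem_ideal_mul | rewrite mulf_neq0].
Qed.

(** Applies the descent from fourth powers to squares to the iterated squares of I, until only I^2
    is left. *)
Lemma principal_sqr_of_iter I n :
  (forall J, is_ideal O J -> nonzero_ideal J -> principal O (ideal_sqr (ideal_sqr J)) ->
     principal O (ideal_sqr J)) ->
  is_ideal O I -> nonzero_ideal I -> principal O (iter n ideal_sqr I) -> principal O (ideal_sqr I).
Proof.
move=> desc II I0.
have In m : is_ideal O (iter m ideal_sqr I) /\ nonzero_ideal (iter m ideal_sqr I).
  elim: m => [//|m [h1 h2]].
  by split; [apply: ideal_sqr_ideal | apply: ideal_sqr_nonzero].
case: n => [|n]; first exact: principal_sqr.
elim: n => [//|n IH] h; apply: IH; have [h1 h2] := In n; exact: desc h.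
Qed.
End Ideals.

(** The generator of the extended ideal is [de]. For x in I, (x / de)^2 = r u is integral, so de
    divides x. Conversely de = u^-1 al / de, and al is a sum of products ab of elements of I, where
    ab / de = (a / de) b lies in the extension. *)
Lemma extension_principal (k K : algC -> Prop) I al u de :
  is_subfield k -> is_subfield K -> (forall x, k x -> K x) ->
  is_ideal (ring_of_integers k) I ->
  (forall x, ideal_sqr (ring_of_integers k) I x <->
     exists r, ring_of_integers k r /\ x = r * al) ->
  K u -> u \in Aint -> u^-1 \in Aint -> u != 0 -> K de -> de != 0 -> al = u * de ^+ 2 ->
  capitulates (ring_of_integers K) I.
Proof.
move=> sk sK kK II Sal Ku uA uVA u0 Kde de0 eal.
have kR := ring_of_integers_subring sk; have KR := ring_of_integers_subring sK.
have [K0 [K1 [KB [KM KV]]]] := sK.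
set Ok := ring_of_integers k in II Sal kR *; set OK := ring_of_integers K in KR *.
have [OK0 OK1 OKD OKM] := KR; have [Ok0 Ok1 OkD OkM] := kR.
have kO x : Ok x -> OK x by case=> kx xA; split=> //; apply: kK.
have Idiv x : I x -> OK (x / de).
  move=> Ix; have [kx xA] := kO _ (ideal_sub II Ix).
  split; first by apply: KM => //; apply: KV.
  apply: Aint_sqrt; have /Sal[r [[_ rA] e]] := @mem_ideal_mul Ok _ _ _ _ Ix Ix.
  have -> : (x / de) ^+ 2 = r * u by rewrite expr_div_n expr2 e eal; field.
  exact: rpredM.
have OKde : OK de.
  split=> //; apply: Aint_sqrt; have -> : de ^+ 2 = u^-1 * al by rewrite eal; field.
  apply: rpredM => //; have /(ideal_sub (ideal_sqr_ideal kR II)) [] // : ideal_sqr Ok I al.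
  by apply/Sal; exists 1; rewrite mul1r.
exists de; split=> // x; split=> [xI | [r [Or ->]] J JI IJ].
  exists (x / de); rewrite divfK //; split=> //.
  suff [] : OK x /\ OK (x / de) by [].
  apply: (xI (fun x => OK x /\ OK (x / de))); last first.
    by move=> s Is; split; [apply/kO/(ideal_sub II) | apply: Idiv].
  split; first by move=> y [].
  split; first by rewrite mul0r.
  split=> [y z [y1 y2] [z1 z2]|s y Os [y1 y2]]; first by rewrite mulrDl; split; apply: OKD.
  by rewrite -mulrA; split; apply: OKM.
have [JO [J0 [JD JM]]] := JI; apply: (JM) => //.
have -> : de = u^-1 * (al / de) by rewrite eal; field; rewrite u0 de0.
apply: (JM); first by split=> //; apply: KV.
have : ideal_sqr Ok I al by apply/Sal; exists 1; rewrite mul1r.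
apply: (ideal_mul_sub kR II II (P := fun x => J (x / de))).
- by rewrite mul0r.
- by move=> y z ? ?; rewrite mulrDl; apply: JD.
- by move=> s y Os ?; rewrite -mulrA; apply: (JM) => //; apply: kO.
by move=> a b Ia Ib; rewrite mulrAC; apply: (JM); [apply: Idiv | apply: IJ].
Qed.

(** * Quadratic extensions of Q(i) *)

Lemma gen_field_subfield S : is_subfield (gen_field S).
Proof.
split; first by move=> F [F0 _] _.
split; first by move=> F [_ [F1 _]] _.
split; first by move=> x y kx ky F FF SF; have [_ [_ [FB _]]] := FF; apply: FB; [apply: kx | apply: ky].
split; first by move=> x y kx ky F FF SF; have [_ [_ [_ [FM _]]]] := FF; apply: FM; [apply: kx | apply: ky].
by move=> x kx F FF SF; have [_ [_ [_ [_ FV]]]] := FF; apply: FV; apply: kx.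
Qed.

Lemma mem_gen_field (S : algC -> Prop) x : S x -> gen_field S x.
Proof. by move=> Sx F _; apply. Qed.

(** A unit of the ring of all algebraic integers. As 0^-1 = 0, this also holds for 0; hence the
    accompanying u != 0. *)
Definition unitA (x : algC) : bool := (x \in Aint) && (x^-1 \in Aint).

Lemma unitAM x y : unitA x -> unitA y -> unitA (x * y).
Proof. by move=> /andP[x1 x2] /andP[y1 y2]; rewrite /unitA invfM !rpredM. Qed.

Lemma unitAV x : unitA x -> unitA x^-1.
Proof. by rewrite /unitA invrK andbC. Qed.

Lemma unitA_aut (nu : {rmorphism algC -> algC}) x : unitA (nu x) = unitA x.
Proof. by rewrite /unitA -fmorphV !Aint_aut. Qed.

Lemma unitA_sqrt x : unitA (x ^+ 2) -> unitA x.
Proof. by move=> /andP[x1 x2]; apply/andP; split; apply: Aint_sqrt; rewrite ?exprVn. Qed.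

Lemma unitA_Zi x : x \in Zi -> x^-1 \in Zi -> unitA x.
Proof. by move=> xZ xV; apply/andP; split; apply: Zi_Aint. Qed.

Lemma Crat_denom a : a \in Crat -> exists2 m : nat, (0 < m)%N & m%:R * a \in Num.int.
Proof.
case/CratP=> q ->; exists `|denq q|%N; first by rewrite absz_gt0 denq_neq0.
have -> : (`|denq q|%N)%:R = (denq q)%:~R :> algC by rewrite pmulrn absz_denq.
rewrite -[X in ratr X]divq_num_den fmorph_div /= !ratr_int mulrC divfK ?intr_int //.
by rewrite intr_eq0 denq_neq0.
Qed.

Lemma Qi_denom x : x \in Qi -> exists2 m : nat, (0 < m)%N & m%:R * x \in Zi.
Proof.
case/QiP=> a [b [/Crat_denom[m m0 ma] /Crat_denom[n n0 nb] ->]].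
exists (m * n)%N; first by rewrite muln_gt0 m0.
have -> : (m * n)%:R * (a + 'i * b) = n%:R * (m%:R * a) + 'i * (m%:R * (n%:R * b)).
  by rewrite natrM; ring.
have iZ y : y \in Num.int -> y \in Zi by move=> /intrP[k ->]; apply: Zi_int.
have Zn k : k%:R \in Zi by apply: rpred_nat.
apply: rpredD; first exact: rpredM (Zn _) (iZ _ ma).
exact: rpredM i_Zi (rpredM (Zn _) (iZ _ nb)).
Qed.

Lemma absz_sum_sqr (p : nat) (m n : int) : p%:Z = m ^+ 2 + n ^+ 2 -> (p = `|m| ^ 2 + `|n| ^ 2)%N.
Proof. lia. Qed.

(** The subgroup of units times squares in the multiplicative group of K, which is exactly what
    [extension_principal] asks of al. *)
Definition unit_sqr (K : algC -> Prop) (c : algC) : Prop :=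
  exists u e, [/\ K u, unitA u, u != 0, K e & e != 0 /\ c = u * e ^+ 2].

Section UnitSqr.
Variable K : algC -> Prop.
Hypothesis K_field : is_subfield K.

Lemma unit_sqrM c c' : unit_sqr K c -> unit_sqr K c' -> unit_sqr K (c * c').
Proof.
have [_ [_ [_ [KM _]]]] := K_field.
move=> [u [e [Ku uU u0 Ke [e0 ->]]]] [u' [e' [Ku' uU' u0' Ke' [e0' ->]]]].
exists (u * u'), (e * e'); rewrite unitAM // !mulf_neq0 //.
split=> //; [exact: KM | exact: KM | by split=> //; ring].
Qed.

Lemma unit_sqrV c : unit_sqr K c -> unit_sqr K c^-1.
Proof.
have [_ [_ [_ [_ KV]]]] := K_field.
move=> [u [e [Ku uU u0 Ke [e0 ->]]]]; exists u^-1, e^-1.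
rewrite unitAV // !invr_eq0; split=> //; [exact: KV | exact: KV |].
by split=> //; rewrite invfM exprVn.
Qed.

Lemma unit_sqr_sqr e : K e -> e != 0 -> unit_sqr K (e ^+ 2).
Proof.
have [_ [K1 _]] := K_field.
by move=> Ke e0; exists 1, e; rewrite /unitA invr1 rpred1 oner_neq0 mul1r.
Qed.

Lemma unit_sqr_unit u : K u -> unitA u -> u != 0 -> unit_sqr K u.
Proof.
have [_ [K1 _]] := K_field.
by move=> Ku uU u0; exists u, 1; rewrite oner_neq0 expr1n mulr1.
Qed.

Lemma unit_sqr_mul_sqr c e : K e -> e != 0 -> unit_sqr K (c * e ^+ 2) -> unit_sqr K c.
Proof.
move=> Ke e0 h; have -> : c = c * e ^+ 2 * (e ^+ 2)^-1 by rewrite mulfK // expf_neq0.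
by apply: unit_sqrM => //; apply/unit_sqrV/unit_sqr_sqr.
Qed.
End UnitSqr.

Lemma unit_sqr_mono (K K' : algC -> Prop) c : (forall x, K x -> K' x) ->
  unit_sqr K c -> unit_sqr K' c.
Proof.
move=> KK [u [e [Ku uU u0 Ke h]]].
by exists u, e; split=> //; apply: KK.
Qed.

(** * Primes above 2, p1 and p2, and when they are units times squares *)

Lemma gprime_associate p a b : prime p -> a \in Zi -> nrm a = p -> gprime b -> gdvd b p%:R ->
  exists w, [/\ w \in Zi, w^-1 \in Zi, w != 0 & b = w * a \/ b = w * a^*].
Proof.
move=> pp aZ na bp bd; have [_ b0 _ _] := bp.
have a0 : a != 0 by apply: nrm_neq0; rewrite ?na ?prime_gt0.
have ac0 : a^* != 0 by rewrite fmorph_eq0.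
case: (gprime_dvd_norm pp aZ na bp bd) => -[h1 h2].
  exists (b / a); rewrite invf_div h1 h2 mulf_neq0 ?invr_neq0 //; split=> //; left.
  by rewrite divfK.
exists (b / a^*); rewrite invf_div h1 h2 mulf_neq0 ?invr_neq0 //; split=> //; right.
by rewrite divfK.
Qed.

Lemma lambda_Zi : 1 + 'i \in Zi.
Proof. by rewrite rpredD ?rpred1 ?i_Zi. Qed.

Lemma nrm_lambda : nrm (1 + 'i) = 2%N.
Proof. by rewrite -[1]/(1%:R) nrm_natDi. Qed.

Lemma lambda_conj : (1 + 'i)^* = - 'i * (1 + 'i) :> algC.
Proof.
rewrite -[1]/(1%:R) conj_natDi.
by transitivity (- ('i * 'i) - 'i : algC); [rewrite ii opprK | ring].
Qed.

Lemma lambda_sqr : (1 + 'i) ^+ 2 = 2 * 'i :> algC.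
Proof. by transitivity (1 + ('i * 'i) + 2 * 'i : algC); [|rewrite ii]; ring. Qed.

Lemma lambda_neq0 : 1 + 'i != 0 :> algC.
Proof. by rewrite -nrm_eq0 ?nrm_lambda ?lambda_Zi. Qed.

Lemma iV_Zi : 'i^-1 \in Zi.
Proof.
have -> : 'i^-1 = - 'i :> algC; last by rewrite rpredN i_Zi.
by apply: (mulfI i_neq0); rewrite divff ?i_neq0 // mulrN ii opprK.
Qed.

(** Up to units, the only primes dividing 4 p1 p2 are 1 + i, a1, a2 and the conjugates of a1 and
    a2. *)
Lemma Zi_gen_ind (S : algC -> Prop) p1 p2 a1 a2 c : prime p1 -> prime p2 ->
  a1 \in Zi -> a2 \in Zi -> nrm a1 = p1 -> nrm a2 = p2 -> c \in Zi -> c != 0 ->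
  (forall p, gprime p -> gdvd p c -> gdvd p (2 * (2 * p1 * p2)%:R)) ->
  (forall u, u \in Zi -> u^-1 \in Zi -> u != 0 -> S u) ->
  S (1 + 'i) -> S a1 -> S a1^* -> S a2 -> S a2^* ->
  (forall x y, S x -> S y -> S (x * y)) -> S c.
Proof.
move=> pp1 pp2 a1Z a2Z na1 na2 cZ c0 cP SU Sl Sa1 Sa1c Sa2 Sa2c SM.
apply: Zi_mul_ind => // b bp /(cP _ bp); have [_ _ _ bM] := bp.
have Zn n : n%:R \in Zi by apply: rpred_nat.
have ass p a : prime p -> a \in Zi -> nrm a = p -> S a -> S a^* -> gdvd b p%:R -> S b.
  move=> pp aZ na Sa Sac bpd.
  have [w [wZ wV w0 [->|->]]] := gprime_associate pp aZ na bp bpd; apply: SM => //; exact: SU.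
have Slc : S (1 + 'i)^*.
  rewrite lambda_conj; apply: SM => //; apply: SU.
  - by rewrite rpredN i_Zi.
  - by rewrite invrN rpredN iV_Zi.
  - by rewrite oppr_eq0 i_neq0.
have S2 : gdvd b 2%:R -> S b := ass 2%N _ isT lambda_Zi nrm_lambda Sl Slc.
have ZM x y : x \in Zi -> y \in Zi -> x * y \in Zi by apply: rpredM.
have -> : 2 * (2 * p1 * p2)%:R = 2%:R * (2%:R * (p1%:R * p2%:R)) :> algC by rewrite !natrM; ring.
have Zp12 := ZM _ _ (Zn p1) (Zn p2).
case/(bM _ _ (Zn 2%N) (ZM _ _ (Zn 2%N) Zp12)) => [/S2 //|].
case/(bM _ _ (Zn 2%N) Zp12) => [/S2 //|].
by case/(bM _ _ (Zn p1) (Zn p2)) => h; [apply: (ass p1 a1) | apply: (ass p2 a2)].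
Qed.

Lemma two_unit_sqr (K : algC -> Prop) : is_subfield K -> K 'i -> unit_sqr K 2.
Proof.
move=> Kf Ki; have [_ [K1 [KB [KM KV]]]] := Kf; have [_ _ KD _] := ring_of_integers_subring Kf.
have i0 := i_neq0; have -> : 2 = 'i^-1 * (1 + 'i) ^+ 2 :> algC by rewrite lambda_sqr; field.
have Kl : K (1 + 'i).
  by have [] : ring_of_integers K (1 + 'i) by apply: KD; split; rewrite ?i_Aint ?rpred1.
apply: unit_sqrM => //; last by apply: unit_sqr_sqr; rewrite ?lambda_neq0.
apply: unit_sqr_unit; rewrite ?invr_eq0 //; first exact: KV.
by rewrite /unitA invrK i_Aint (Zi_Aint iV_Zi).
Qed.

Lemma subfield_D (K : algC -> Prop) x y : is_subfield K -> K x -> K y -> K (x + y).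
Proof.
move=> [K0 [_ [KB _]]] Kx Ky; have -> : x + y = x - (0 - y) by ring.
by apply: (KB) => //; apply: KB.
Qed.

Lemma subfield_Qi (K : algC -> Prop) x : is_subfield K -> K 'i -> x \in Qi -> K x.
Proof.
move=> Kf Ki /QiP[a [b [aQ bQ ->]]]; have [K0 [K1 [KB [KM KV]]]] := Kf.
have Kn n : K n%:R by elim: n => [|n IH] //; rewrite mulrSr; apply: subfield_D.
have KQ c : c \in Crat -> K c.
  move=> /Crat_denom[m m0 /intrP[z ez]]; have mC : m%:R != 0 :> algC by rewrite pnatr_eq0 -lt0n.
  have -> : c = m%:R^-1 * z%:~R by rewrite -ez mulKf.
  apply: (KM); first exact: KV.
  case: z {ez} => n; first exact: Kn.
  by rewrite NegzE rmorphN -sub0r; apply: KB => //; apply: Kn.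
by apply: subfield_D => //; [apply: KQ | apply: (KM) => //; apply: KQ].
Qed.

(* (x + i + y t)^2 = 2 (x + i) (x + y t), where x + y t is a unit. *)
Lemma pell_unit_sqr (K : algC -> Prop) t n x y : is_subfield K -> K 'i -> K t -> t ^+ 2 = n%:R ->
  (x ^ 2 + 1 = n * y ^ 2)%N -> unit_sqr K (x%:R + 'i).
Proof.
move=> Kf Ki Kt tn eP; have [K0 [K1 [KB [KM KV]]]] := Kf.
have KZ z : z \in Zi -> K z by move=> zZ; apply: subfield_Qi => //; apply: Zi_Qi.
have Kn m : K m%:R by apply: KZ; apply: rpred_nat.
have tA : t \in Aint by apply: Aint_sqrt; rewrite tn rpred_nat.
set X : algC := x%:R + 'i; have XZ : X \in Zi := natDi_Zi x.
have X0 : X != 0 by rewrite -nrm_eq0 // nrm_natDi addn1.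
pose eps := x%:R + y%:R * t.
have epsV : eps * (y%:R * t - x%:R) = 1.
  have -> : eps * (y%:R * t - x%:R) = y%:R ^+ 2 * t ^+ 2 - x%:R ^+ 2 by rewrite /eps; ring.
  by rewrite tn -!natrX -natrM mulnC -eP natrD; ring.
have eps0 : eps != 0.
  by apply/eqP => e0; move/eqP: epsV; rewrite e0 mul0r eq_sym oner_eq0.
have epsE : eps^-1 = y%:R * t - x%:R by apply: (mulfI eps0); rewrite divff ?epsV.
have eX2 : (X + y%:R * t) ^+ 2 = 2 * X * eps.
  have e1 : X * (x%:R - 'i) = y%:R ^+ 2 * t ^+ 2.
    by rewrite -conj_natDi -nrmE // nrm_natDi eP tn -natrX -natrM mulnC.
  transitivity (X ^+ 2 + 2 * X * (y%:R * t) + y%:R ^+ 2 * t ^+ 2); first by ring.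
  by rewrite -e1 /eps /X; ring.
have n2 : 2 != 0 :> algC by rewrite pnatr_eq0.
have -> : X = (X + y%:R * t) ^+ 2 * (2^-1 * eps^-1) by rewrite eX2; field; rewrite eps0.
apply: unit_sqrM => //.
  apply: unit_sqr_sqr => //; first by apply: subfield_D => //; [apply: KZ | apply: KM].
  by rewrite -sqrf_eq0 eX2 !mulf_neq0.
apply: unit_sqrM => //; apply: unit_sqrV => //; first exact: two_unit_sqr.
apply: unit_sqr_unit => //; first by apply: subfield_D => //; apply: KM.
by rewrite /unitA epsE rpredD ?rpredB ?rpredM ?rpred_nat.
Qed.

(** Write x + i = b z^2 with nrm b = p. Then b is a unit times a square since x + i is, so is its
    conjugate t^2 / b, and a is associated to one of the two. *)
Lemma prime_norm_unit_sqr (K : algC -> Prop) p t a : is_subfield K -> K 'i -> K t -> t ^+ 2 = p%:R ->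
  prime p -> (p %% 4 = 1)%N -> a \in Zi -> nrm a = p -> unit_sqr K a.
Proof.
move=> Kf Ki Kt tp pp p4 aZ na.
have KZ z : z \in Zi -> K z by move=> zZ; apply: subfield_Qi => //; apply: Zi_Qi.
have [x [y eP]] := negative_pell_prime pp p4.
have [b [z [bZ zZ nb eX]]] := pell_factor_prime pp p4 eP.
have b0 : b != 0 by apply: nrm_neq0; rewrite ?nb ?prime_gt0.
have X0 : x%:R + 'i != 0 :> algC by rewrite -nrm_eq0 ?natDi_Zi // nrm_natDi addn1.
have z0 : z != 0 by apply: contraNneq X0 => z0; rewrite eX z0 expr0n mulr0.
have Tb : unit_sqr K b.
  by apply: (unit_sqr_mul_sqr Kf (KZ _ zZ) z0); rewrite -eX; apply: (pell_unit_sqr Kf Ki Kt tp eP).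
have pb : p%:R = b * b^* by rewrite -nrmE ?nb.
have t0 : t != 0 by rewrite -sqrf_eq0 tp pnatr_eq0 -lt0n prime_gt0.
have Tbc : unit_sqr K b^*.
  have -> : b^* = t ^+ 2 * b^-1 by rewrite tp pb mulrC mulKf.
  by apply: unit_sqrM => //; [apply: unit_sqr_sqr | apply: unit_sqrV].
have ap : gdvd a p%:R.
  rewrite -na nrmE //; apply: gdvd_mulr; first by rewrite conj_Zi.
  by apply: gdvdnn; apply: nrm_neq0; rewrite ?na ?prime_gt0.
have [w [wZ wV w0 [->|->]]] := gprime_associate pp bZ nb (gprime_of_prime_norm pp aZ na) ap.
  by apply: unit_sqrM => //; apply: unit_sqr_unit => //; [apply: KZ | apply: unitA_Zi].
by apply: unit_sqrM => //; apply: unit_sqr_unit => //; [apply: KZ | apply: unitA_Zi].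
Qed.

Lemma eighth_root_sqr : ((1 + 'i) / sqrtC 2) ^+ 2 = 'i :> algC.
Proof. by rewrite expr_div_n sqrtCK lambda_sqr mulrC mulKf ?pnatr_eq0. Qed.

(* 1 + i = (sqrt 2 - 1) (1 + z)^2, where z = (1 + i) / sqrt 2. *)
Lemma lambda_unit_sqr (K : algC -> Prop) : is_subfield K -> K 'i -> K (sqrtC 2) ->
  unit_sqr K (1 + 'i).
Proof.
move=> Kf Ki K2; have [K0 [K1 [KB [KM KV]]]] := Kf.
have r2 : sqrtC 2 ^+ 2 = 2 :> algC by rewrite sqrtCK.
have r0 : sqrtC 2 != 0 :> algC by rewrite -sqrf_eq0 r2 pnatr_eq0.
have rA : sqrtC 2 \in Aint by apply: Aint_sqrt; rewrite r2 rpred_nat.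
set r : algC := sqrtC 2 in r2 r0 rA K2 *; set z := (1 + 'i) / r.
have z2 : z ^+ 2 = 'i := eighth_root_sqr.
have e1 : (r - 1) * (r + 1) = 1 by rewrite -subr_sqr_1 r2 -[1]/(1%:R) -natrB.
have u0 : r - 1 != 0 by apply/eqP => h; move/eqP: e1; rewrite h mul0r eq_sym oner_eq0.
have eV : (r - 1)^-1 = r + 1 by apply: (mulfI u0); rewrite divff ?e1.
have el : 1 + 'i = (r - 1) * (1 + z) ^+ 2.
  transitivity ((r - 1) * (1 + z ^+ 2 + 2 * z)); last by ring.
  rewrite z2; transitivity ((r - 1) * ((1 + 'i) * (r + 1))); first by rewrite mulrCA e1 mulr1.
  by congr (_ * _); rewrite /z -r2; field.
have z10 : 1 + z != 0.
  by apply/eqP => h; have := lambda_neq0; rewrite el h expr0n mulr0 eqxx.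
have Kl : K (1 + 'i) by apply: subfield_D.
rewrite el; apply: unit_sqrM => //.
  apply: unit_sqr_unit => //; first exact: KB.
  by rewrite /unitA eV rpredB ?rpredD ?rpred1.
by apply: unit_sqr_sqr => //; apply: subfield_D => //; apply: (KM) => //; apply: KV.
Qed.

(* sg is the nontrivial automorphism of Q(i, s) over Q(i), extended to the algebraic numbers. *)
Section Quadratic.
Variables (s : algC) (d : nat) (sg : {rmorphism algC -> algC}).
Hypotheses (d_gt0 : (0 < d)%N) (s_sqr : s ^+ 2 = d%:R) (sg_i : sg 'i = 'i) (sg_s : sg s = - s).

(** For x = u + v s the two quantities are 2u and 2dv, so this is the field Q(i, s) described
    without choosing coordinates; see [kqP]. *)
Definition kq : {pred algC} := fun x => (x + sg x \in Qi) && ((x - sg x) * s \in Qi).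
Definition N (x : algC) := x * sg x.

Lemma d_neq0 : d%:R != 0 :> algC.
Proof. by rewrite pnatr_eq0 -lt0n. Qed.

Lemma s_neq0 : s != 0.
Proof. by rewrite -sqrf_eq0 s_sqr d_neq0. Qed.

Lemma sg_Qi x : x \in Qi -> sg x = x.
Proof. by case/QiP=> a [b [aR bR ->]]; rewrite rmorphD rmorphM /= sg_i !aut_Crat. Qed.

Lemma kqP x : reflect (exists u v, [/\ u \in Qi, v \in Qi & x = u + v * s]) (x \in kq).
Proof.
have two : 2 != 0 :> algC by rewrite pnatr_eq0.
apply: (iffP andP) => [[xu xv]|[u [v [uQ vQ ->]]]].
  exists ((x + sg x) / 2), ((x - sg x) * s / (2 * d%:R)).
  split; first by rewrite rpred_div ?rpred_nat.
    by apply: rpred_div => //; rewrite rpredM ?rpred_nat.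
  have -> : (x - sg x) * s / (2 * d%:R) * s = (x - sg x) * s ^+ 2 / (2 * d%:R) by field; rewrite d_neq0.
  by rewrite s_sqr; field; rewrite d_neq0.
rewrite rmorphD rmorphM /= sg_s !sg_Qi //.
have -> : u + v * s + (u + v * - s) = 2 * u by ring.
have -> : (u + v * s - (u + v * - s)) * s = 2 * v * s ^+ 2 by ring.
by rewrite s_sqr !rpredM ?rpred_nat.
Qed.

Lemma Qi_kq x : x \in Qi -> x \in kq.
Proof. by move=> xQ; apply/kqP; exists x, 0; rewrite rpred0; split=> //; ring. Qed.

Lemma s_kq : s \in kq.
Proof. by apply/kqP; exists 0, 1; rewrite rpred0 rpred1; split=> //; ring. Qed.

Lemma sg_kq x : x \in kq -> sg x \in kq.
Proof.
case/kqP=> u [v [uQ vQ ->]]; apply/kqP; exists u, (- v); rewrite rpredN; split=> //.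
by rewrite rmorphD rmorphM /= sg_s !sg_Qi //; ring.
Qed.

Lemma sgK x : x \in kq -> sg (sg x) = x.
Proof.
case/kqP=> u [v [uQ vQ ->]].
by rewrite !(rmorphD, rmorphM) /= !(sg_Qi uQ, sg_Qi vQ) sg_s rmorphN /= sg_s opprK.
Qed.

Lemma N_formula u v : u \in Qi -> v \in Qi -> N (u + v * s) = u ^+ 2 - d%:R * v ^+ 2.
Proof.
by move=> uQ vQ; rewrite /N rmorphD rmorphM /= sg_s !sg_Qi // -s_sqr; ring.
Qed.

Lemma N_Qi x : x \in kq -> N x \in Qi.
Proof.
case/kqP=> u [v [uQ vQ ->]]; rewrite N_formula //.
by rewrite rpredB ?rpredM ?rpredX ?rpred_nat.
Qed.

Lemma kq_mul x y : x \in kq -> y \in kq -> x * y \in kq.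
Proof.
move=> /kqP[u [v [uQ vQ ->]]] /kqP[u' [v' [uQ' vQ' ->]]]; apply/kqP.
exists (u * u' + d%:R * v * v'), (u * v' + v * u'); split.
- by rewrite rpredD ?rpredM ?rpred_nat.
- by rewrite rpredD ?rpredM.
by rewrite -s_sqr; ring.
Qed.

Fact kq_divring : divring_closed kq.
Proof.
split; first exact/Qi_kq/rpred1.
  move=> x y /kqP[u [v [uQ vQ ->]]] /kqP[u' [v' [uQ' vQ' ->]]]; apply/kqP.
  by exists (u - u'), (v - v'); rewrite !rpredB //; split=> //; ring.
move=> x y xk yk; have [->|y0] := eqVneq y 0; first by rewrite invr0 mulr0 Qi_kq ?rpred0.
apply: kq_mul => //; have -> : y^-1 = sg y * (N y)^-1.
  by rewrite /N invfM mulrCA divff ?mulr1 // fmorph_eq0.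
by apply: kq_mul; [apply: sg_kq | rewrite Qi_kq // rpredV N_Qi].
Qed.
HB.instance Definition _ := GRing.isDivringClosed.Build algC kq kq_divring.

Lemma NM x y : N (x * y) = N x * N y.
Proof. by rewrite /N rmorphM; ring. Qed.

Lemma NV x : N x^-1 = (N x)^-1.
Proof. by rewrite /N fmorphV invfM. Qed.

Lemma N_eq0 x : (N x == 0) = (x == 0).
Proof. by rewrite mulf_eq0 fmorph_eq0 orbb. Qed.

Lemma N_sqr_Qi x : x \in Qi -> N x = x ^+ 2.
Proof. by move=> xQ; rewrite /N sg_Qi. Qed.

Lemma N_Zi x : x \in kq -> x \in Aint -> N x \in Zi.
Proof. by move=> xk xA; rewrite ZiE N_Qi // rpredM ?Aint_aut. Qed.

Lemma Tr_Zi x : x \in kq -> x \in Aint -> x + sg x \in Zi.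
Proof. by move=> /andP[xk _] xA; rewrite ZiE xk rpredD ?Aint_aut. Qed.

Lemma kq_subfield : is_subfield (fun x => x \in kq).
Proof.
split; first exact: rpred0.
split; first exact: rpred1.
split; first by move=> *; apply: rpredB.
split; first by move=> *; apply: rpredM.
by move=> *; rewrite rpredV.
Qed.

(** * Relative norms of ideals and the shape of al *)

Let O := ring_of_integers (fun x => x \in kq).
Let O_ring : subring O := ring_of_integers_subring kq_subfield.

(** Says that I sigma(I) is generated by a: every product x sigma(y) is divisible by a, and a lies
    in the Z[i]-ideal generated by the norms of elements of I. *)
Definition norm_gen (I : algC -> Prop) (a : algC) : Prop :=
  [/\ a \in Zi, a != 0, forall x y, I x -> I y -> x * sg y / a \in Aint &
    forall P, Zi_ideal P -> (forall x, I x -> P (N x)) -> P a].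

Lemma norm_gen_exists I : is_ideal O I -> nonzero_ideal I -> exists a, norm_gen I a.
Proof.
move=> II [x0 [Ix0 x00]]; have [IO [I0 [ID IM]]] := II.
pose P0 z := z \in Zi /\ forall P, Zi_ideal P -> (forall x, I x -> P (N x)) -> P z.
have NP0 x : I x -> P0 (N x).
  by move=> Ix; have [xk xA] := IO _ Ix; split=> [|P _]; [apply: N_Zi | apply].
have IP0 : Zi_ideal P0.
  split.
  - by split; [apply: rpred0 | move=> P []].
  - move=> x y [xZ xP] [yZ yP]; split; first exact: rpredD.
    by move=> P PI PN; have [_ PD _] := PI; apply: PD; [apply: xP | apply: yP].
  - move=> r x rZ [xZ xP]; split; first exact: rpredM.
    by move=> P PI PN; have [_ _ PM] := PI; apply: PM => //; apply: xP.
have [||a [[aZ aP] a0 aD]] := Zi_principal IP0; first by move=> x [].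
  by exists (N x0); split; [apply: NP0 | rewrite N_eq0].
exists a; split=> // x y Ix Iy.
have [[xk xA] [yk yA]] := (IO _ Ix, IO _ Iy).
have aQ : a \in Qi := Zi_Qi aZ.
have div z : I z -> N z / a \in Aint by move=> Iz; apply/Zi_Aint/aD/NP0.
pose w := x * sg y / a.
have ew : sg w = y * sg x / a.
  by rewrite /w !rmorphM fmorphV /= sgK // (sg_Qi aQ); ring.
(* Trace and norm of w are expressed by N (x + y), N x and N y, all divisible by a. *)
apply: (@Aint_quadratic (w + sg w) (w * sg w)); last by rewrite -/w; ring.
  have -> : w + sg w = N (x + y) / a - N x / a - N y / a.
    by rewrite ew /w /N rmorphD; ring.
  by rewrite !rpredB // div //; apply: ID.
have -> : w * sg w = N x / a * (N y / a) by rewrite ew /w /N; ring.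
by rewrite rpredM // div.
Qed.

Lemma norm_gen_sqr I a : is_ideal O I -> norm_gen I a -> norm_gen (ideal_sqr O I) (a ^+ 2).
Proof.
move=> II [aZ a0 aI aP]; have [IO _] := II; split; [exact: rpredX | by rewrite expf_neq0 | | ].
  move=> x y Sx Sy.
  have xbc b c : I b -> I c -> x * sg (b * c) / a ^+ 2 \in Aint.
    move=> Ib Ic; move: x Sx.
    apply: (ideal_mul_sub O_ring II II (P := fun x => x * sg (b * c) / a ^+ 2 \in Aint)).
    - by rewrite !mul0r rpred0.
    - by move=> z t zA tA; rewrite 2!mulrDl rpredD.
    - by move=> r z [_ rA] zA; rewrite -2!mulrA rpredM // mulrA.
    move=> e f Ie If; have -> : e * f * sg (b * c) / a ^+ 2 = (e * sg b / a) * (f * sg c / a).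
      by rewrite rmorphM; field.
    by rewrite rpredM // aI.
  move: y Sy; apply: (ideal_mul_sub O_ring II II (P := fun y => x * sg y / a ^+ 2 \in Aint)).
  - by rewrite rmorph0 mulr0 mul0r rpred0.
  - by move=> z t zA tA; rewrite rmorphD mulrDr mulrDl rpredD.
  - by move=> r z [_ rA] zA; rewrite rmorphM mulrCA -mulrA rpredM // Aint_aut.
  by move=> b c Ib Ic; apply: xbc.
move=> P [P0 PD PM] PN; rewrite expr2.
(* The last clause of [norm_gen] is used once for each factor of a^2, which reduces the claim to N x
   * N y = N (x y). *)
apply: (aP (fun z => P (a * z))).
  split; first by rewrite mulr0.
    by move=> z t ? ?; rewrite mulrDr; apply: PD.
  by move=> r z rZ ?; rewrite mulrCA; apply: PM.
move=> x Ix; rewrite mulrC; apply: (aP (fun z => P (N x * z))).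
  split; first by rewrite mulr0.
    by move=> z t ? ?; rewrite mulrDr; apply: PD.
  by move=> r z rZ ?; rewrite mulrCA; apply: PM.
by move=> y Iy; rewrite -NM; apply: PN; apply: mem_ideal_mul.
Qed.

Lemma norm_gen_principal I a al : norm_gen I a -> al != 0 -> O al ->
  (forall x, I x <-> exists r, O r /\ x = r * al) -> N al / a \in Zi /\ (N al / a)^-1 \in Zi.
Proof.
move=> [aZ a0 aI aP] al0 [alk alA] Ial.
have Nal0 : N al != 0 by rewrite N_eq0.
have al_in : I al by apply/Ial; exists 1; rewrite mul1r; case: O_ring.
split; first by rewrite ZiE rpred_div ?N_Qi ?(Zi_Qi aZ) //= aI.
rewrite invf_div; apply: (aP (fun z => z / N al \in Zi)).
  split; first by rewrite mul0r rpred0.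
    by move=> x y ? ?; rewrite mulrDl rpredD.
  by move=> r x ? ?; rewrite -mulrA rpredM.
move=> _ /Ial[r [[rk rA] ->]].
by rewrite NM mulfK //; apply: N_Zi.
Qed.

(** Here g = 1 + x, with g = s for x = -1. The usual quotient g / sigma(g) is written g^2 / N g to
    exhibit x modulo squares as an element of Q(i). *)
Lemma hilbert90 x : x \in kq -> N x = 1 -> exists g, [/\ g \in kq, g != 0 & x = g ^+ 2 / N g].
Proof.
move=> xk Nx; have [e|x1] := eqVneq (1 + x) 0.
  exists s; rewrite s_kq s_neq0; split=> //.
  rewrite /N sg_s mulrN -expr2 invrN mulrN divff ?expf_neq0 ?s_neq0 //.
  by apply/eqP; rewrite -addr_eq0 addrC e.
exists (1 + x); rewrite rpredD ?rpred1 //; split=> //.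
have sx1 : 1 + sg x != 0 by rewrite -[1](rmorph1 sg) -rmorphD fmorph_eq0.
have ex : x * (1 + sg x) = 1 + x by rewrite mulrDr mulr1 -/(N x) Nx addrC.
by apply: (mulIf sx1); rewrite ex /N rmorphD rmorph1; field; rewrite x1 sx1.
Qed.

(** Whenever a unit of Z[i] is the norm of an element of k, it is also the norm of a unit of k. *)
Definition units_surject : Prop := forall b, b \in kq -> b != 0 -> N b \in Zi -> (N b)^-1 \in Zi ->
  exists e, [/\ e \in kq, e != 0, unitA e & N e = N b].

Lemma ideal_sqr_principal_neq0 I al : nonzero_ideal I ->
  (forall x, ideal_sqr O I x <-> exists r, O r /\ x = r * al) -> al != 0.
Proof.
move=> [x [Ix x0]] Sal; apply/eqP => al0.
have /Sal[r [_ e]] := @mem_ideal_mul O _ _ _ _ Ix Ix.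
by have := mulf_neq0 x0 x0; rewrite e al0 mulr0 eqxx.
Qed.

Lemma sgB_s_Zi x : x \in kq -> x \in Aint -> (x - sg x) * s \in Zi.
Proof.
move=> /andP[_ xk] xA; rewrite ZiE xk rpredM ?rpredB ?Aint_aut //.
by apply: Aint_sqrt; rewrite s_sqr rpred_nat.
Qed.

(* A prime of Z[i] not dividing 2 d is unramified in Q(i, s), so it cannot divide the
   squarefree element c when c is the square of an ideal. *)
Lemma ramified_prime I al e c g p : is_ideal O I ->
  (forall x, ideal_sqr O I x <-> exists r, O r /\ x = r * al) ->
  e \in kq -> e != 0 -> unitA e -> c \in Zi -> c != 0 -> g \in kq -> g != 0 -> al = e * c * g ^+ 2 ->
  gprime p -> gdvd p c -> ~~ gdvd (p ^+ 2) c -> gdvd p (2 * d%:R).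
Proof.
move=> II Sal ek e0 /andP[eA eVA] cZ c0 gk g0 eal pp pc p2c; have [IO _] := II.
have [pZ p0 pU pM] := pp; have [c1 c1Z ec] := gdvdP p0 pc.
have cQ := Zi_Qi cZ; have pQ := Zi_Qi pZ.
(* For z = x / g, z^2 is an integral multiple of c. Hence c divides N z and (z + sg z)^2, so p
   divides the trace and then (z - sg z) s; finally 2 d z = d (z + sg z) + (z - sg z) s * s. *)
have key x : I x -> 2 * d%:R * (x / g) / p \in Aint.
  move=> Ix; have [xk xA] := IO _ Ix; set z := x / g.
  have zk : z \in kq by rewrite rpred_div.
  have /Sal[r [[rk rA] er]] := @mem_ideal_mul O _ _ _ _ Ix Ix.
  have ez : z ^+ 2 = r * e * c.
    by rewrite /z expr_div_n expr2 er eal; field.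
  have zA : z \in Aint by apply: Aint_sqrt; rewrite ez !rpredM // Zi_Aint.
  have trZ := Tr_Zi zk zA; have nZ := N_Zi zk zA; have hZ := sgB_s_Zi zk zA.
  have pd y : y \in Zi -> gdvd p (y ^+ 2) -> gdvd p y.
    by move=> yZ; rewrite expr2 => /(pM _ _ yZ yZ)[].
  have cn : N z / c \in Aint.
    apply: Aint_sqrt; have -> : (N z / c) ^+ 2 = N (r * e).
      have -> : (N z / c) ^+ 2 = N (z ^+ 2) / c ^+ 2 by rewrite expr_div_n !expr2 NM.
      by rewrite ez NM (N_sqr_Qi cQ) mulfK // expf_neq0.
    by rewrite rpredM ?Aint_aut // rpredM.
  have pn : gdvd p (N z).
    have cnZ : N z / c \in Zi by rewrite ZiE cn rpred_div ?N_Qi // (Zi_Qi cZ).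
    by rewrite -(divfK c0 (N z)); apply: gdvd_mull.
  have pt : gdvd p (z + sg z).
    apply: pd => //; have tz : (z + sg z) * z / c \in Aint.
      have -> : (z + sg z) * z / c = z ^+ 2 / c + N z / c by rewrite /N; field.
      by rewrite rpredD // ez mulfK // rpredM.
    have tzk : (z + sg z) * z / c \in kq.
      apply: rpred_div; last exact: Qi_kq.
      by apply: rpredM => //; apply/Qi_kq/Zi_Qi.
    have := Tr_Zi tzk tz.
    have -> : (z + sg z) * z / c + sg ((z + sg z) * z / c) = (z + sg z) ^+ 2 / c.
      have stz : sg (z + sg z) = z + sg z by apply/sg_Qi/Zi_Qi.
      have -> : sg ((z + sg z) * z / c) = (z + sg z) * sg z / c.
        by rewrite -[in RHS]stz -{2}(sg_Qi cQ) -fmorphV -!rmorphM.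
      by field.
    by move=> h; rewrite -(divfK c0 (_ ^+ 2)); apply: gdvd_mull.
  have ph : gdvd p ((z - sg z) * s).
    apply: pd => //.
    have -> : ((z - sg z) * s) ^+ 2 = d%:R * ((z + sg z) ^+ 2 - 4 * N z).
      by rewrite exprMn s_sqr /N; ring.
    apply: gdvd_mull; first exact: rpred_nat.
    apply: gdvdB; first by rewrite expr2; apply: gdvd_mull.
    by apply: gdvd_mull => //; apply: rpred_nat.
  have sA : s \in Aint by apply: Aint_sqrt; rewrite s_sqr rpred_nat.
  have -> : 2 * d%:R * z / p = d%:R * ((z + sg z) / p) + (z - sg z) * s / p * s.
    have -> : (z - sg z) * s / p * s = (z - sg z) * s ^+ 2 / p by field.
    by rewrite s_sqr; field.
  by rewrite rpredD // rpredM ?rpred_nat // Zi_Aint.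
(* As al is a sum of products of two elements of I, applying [key] to both factors gains p^2, while
   c = p c1 accounts for only one p: so p divides (2d)^2 c1. *)
have kal : (2 * d%:R) ^+ 2 * al / (g ^+ 2 * p ^+ 2) \in Aint.
  have : ideal_sqr O I al by apply/Sal; exists 1; rewrite mul1r; case: O_ring.
  apply: (ideal_mul_sub O_ring II II
    (P := fun y => (2 * d%:R) ^+ 2 * y / (g ^+ 2 * p ^+ 2) \in Aint)).
  - by rewrite mulr0 mul0r rpred0.
  - by move=> y t ? ?; rewrite mulrDr mulrDl rpredD.
  - by move=> r y [_ rA] ?; rewrite mulrCA -mulrA rpredM.
  move=> a b Ia Ib.
  have -> : (2 * d%:R) ^+ 2 * (a * b) / (g ^+ 2 * p ^+ 2) =
      (2 * d%:R * (a / g) / p) * (2 * d%:R * (b / g) / p) by field; rewrite g0 p0.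
  by rewrite rpredM // key.
have h : (2 * d%:R) ^+ 2 * c1 / p \in Zi.
  have tQ : 2 * d%:R \in Qi by rewrite rpredM ?rpred_nat.
  have hQ : (2 * d%:R) ^+ 2 * c1 / p \in Qi by rewrite rpred_div // rpredM ?rpredX // Zi_Qi.
  rewrite ZiE hQ /=.
  have -> : (2 * d%:R) ^+ 2 * c1 / p = e^-1 * ((2 * d%:R) ^+ 2 * al / (g ^+ 2 * p ^+ 2)).
    by rewrite eal ec; field; rewrite e0 g0 p0.
  by rewrite rpredM.
have tZ : 2 * d%:R \in Zi by rewrite rpredM ?rpred_nat.
have [||] := pM ((2 * d%:R) ^+ 2) c1 _ c1Z h; first by rewrite rpredX.
  by rewrite expr2 => /(pM _ _ tZ tZ)[].
move=> pc1; case/negP: p2c; rewrite /gdvd ec.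
by have -> : p * c1 / p ^+ 2 = c1 / p by field.
Qed.

(** The norm of al / a is a unit of Z[i]. Dividing al / a by a unit e of the same norm gives norm 1,
    so al = e (a / N g) g^2 by Hilbert 90. *)
Theorem sqr_principal_shape I a al : units_surject -> is_ideal O I -> norm_gen I a -> al != 0 ->
  (forall x, ideal_sqr O I x <-> exists r, O r /\ x = r * al) ->
  exists e c g, [/\ [/\ e \in kq, e != 0 & unitA e], c \in Zi /\ c != 0, g \in kq /\ g != 0,
    al = e * c * g ^+ 2 & forall p, gprime p -> gdvd p c -> gdvd p (2 * d%:R)].
Proof.
move=> US II Ia al0 Sal.
have Oal : O al.
  apply: (ideal_sub (ideal_sqr_ideal O_ring II)).
  by apply/Sal; exists 1; rewrite mul1r; case: O_ring.
have [omZ omV] := norm_gen_principal (norm_gen_sqr II Ia) al0 Oal Sal.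
have [aZ a0 _ _] := Ia; have [alk alA] := Oal; have aQ := Zi_Qi aZ.
have Nb : N (al / a) = N al / a ^+ 2 by rewrite NM NV (N_sqr_Qi aQ).
have bk : al / a \in kq by rewrite rpred_div // Qi_kq.
have b0 : al / a != 0 by rewrite mulf_neq0 ?invr_neq0.
rewrite -Nb in omZ omV.
have [e [ek e0 eU eN]] := US _ bk b0 omZ omV.
have [||g [gk g0 eg]] := @hilbert90 (al / a / e); first by rewrite rpred_div.
  by rewrite NM NV eN divff // N_eq0.
have Ng0 : N g != 0 by rewrite N_eq0.
have [m m0 mZ] : exists2 m : nat, (0 < m)%N & m%:R * (a / N g) \in Zi.
  by apply: Qi_denom; rewrite rpred_div ?N_Qi.
have mC : m%:R != 0 :> algC by rewrite pnatr_eq0 -lt0n.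
(* Multiplying a / N g twice by its denominator m makes it a Gaussian integer without changing it
   modulo squares. *)
have [||t [c [tZ t0 cZ ec sf]]] := @Zi_squarefree (m%:R * (m%:R * (a / N g))).
- by rewrite rpredM ?rpred_nat.
- by rewrite !mulf_neq0 ?invr_neq0.
have c0 : c != 0.
  apply/eqP => c0; have : m%:R * (m%:R * (a / N g)) != 0 by rewrite !mulf_neq0 ?invr_neq0.
  by rewrite ec c0 mul0r eqxx.
have gk' : g * t / m%:R \in kq by rewrite rpred_div ?rpredM ?rpred_nat ?(Qi_kq (Zi_Qi tZ)).
have g0' : g * t / m%:R != 0 by rewrite !mulf_neq0 ?invr_neq0.
have eal : al = e * c * (g * t / m%:R) ^+ 2.
  have -> : e * c * (g * t / m%:R) ^+ 2 = e * (c * t ^+ 2) * g ^+ 2 / m%:R ^+ 2 by field.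
  rewrite -ec; have -> : e * (m%:R * (m%:R * (a / N g))) * g ^+ 2 / m%:R ^+ 2 = e * a * (g ^+ 2 / N g).
    by field; rewrite mC Ng0.
  by rewrite -eg; field; rewrite a0 e0.
exists e, c, (g * t / m%:R); split=> // p pp pc.
by apply: (ramified_prime II Sal ek e0 eU cZ c0 gk' g0' eal pp pc); apply: sf.
Qed.

(** Up to a unit, a^4 = N al = N e c^2 (N g)^2. So the square of w = c N g / a^2 is a unit, hence w
    is, and c = w N (a / g). *)
Lemma fourth_power_norm I a al e c g : is_ideal O I -> norm_gen I a -> al != 0 ->
  (forall x, ideal_sqr O (ideal_sqr O I) x <-> exists r, O r /\ x = r * al) ->
  e != 0 -> e \in kq -> unitA e -> c \in Zi -> c != 0 -> g \in kq -> g != 0 -> al = e * c * g ^+ 2 ->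
  exists w th, [/\ w \in Zi, w^-1 \in Zi, th \in kq, th != 0 & c = w * N th].
Proof.
move=> II Ia al0 Sal e0 ek eU cZ c0 gk g0 eal.
have SI := ideal_sqr_ideal O_ring II.
have Oal : O al.
  apply: (ideal_sub (ideal_sqr_ideal O_ring SI)).
  by apply/Sal; exists 1; rewrite mul1r; case: O_ring.
have [omZ omV] := norm_gen_principal (norm_gen_sqr SI (norm_gen_sqr II Ia)) al0 Oal Sal.
have [aZ a0 _ _] := Ia; have aQ := Zi_Qi aZ; have cQ := Zi_Qi cZ.
have Ng0 : N g != 0 by rewrite N_eq0.
have Ne0 : N e != 0 by rewrite N_eq0.
pose w := c * N g / a ^+ 2.
have ew : w ^+ 2 = N al / (a ^+ 2) ^+ 2 / N e.
  rewrite eal 3!NM (N_sqr_Qi cQ) /w; field; rewrite ?a0 ?Ne0 ?andbT //.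
have wU : unitA w.
  apply: unitA_sqrt; rewrite ew; apply: unitAM; first exact: unitA_Zi.
  by apply: unitAV; rewrite unitAM // /unitA -fmorphV !Aint_aut; case/andP: eU => -> ->.
have wQ : w \in Qi.
  by apply: rpred_div; [apply: rpredM => //; apply: N_Qi | apply: rpredX].
case/andP: wU => wA wVA.
exists w, (a / g); split.
- by rewrite ZiE wQ.
- by rewrite ZiE rpredV wQ.
- by rewrite rpred_div // Qi_kq.
- by rewrite mulf_neq0 ?invr_neq0.
by rewrite NM NV (N_sqr_Qi aQ) /w; field; rewrite a0 Ng0.
Qed.

(** * Local conditions on norms from k *)

Lemma norm_local_square p (d' : nat) a g th : prime p -> a \in Zi -> nrm a = p -> d = (p * d')%N ->
  ~~ (p %| d')%N -> odd p -> g \in Zi -> ~~ gdvd a g -> th \in kq -> N th = g ->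
  exists2 z, z \in Zi & gdvd a (z ^+ 2 - g).
Proof.
move=> pp aZ na ed pd' op gZ ag /kqP[u [v [uQ vQ ->]]]; rewrite N_formula // => eN.
have p0 := prime_gt0 pp.
have a0 : a != 0 by apply: nrm_neq0; rewrite ?na.
have [_ _ _ aM] := gprime_of_prime_norm pp aZ na.
have asq y : y \in Zi -> gdvd a (y ^+ 2) -> gdvd a y by move=> yZ; rewrite expr2 => /(aM _ _ yZ yZ)[].
have acZ : a^* \in Zi by rewrite conj_Zi.
have ep : p%:R = a * a^* by rewrite -nrmE ?na.
(* An odd p is unramified in Z[i]: for a = m + in, a dividing its conjugate would divide 2m and 2n,
   so p^2 would divide p. Hence a divides d exactly once. *)
have ac : ~~ gdvd a a^*.
  apply/negP => aac; have [m [n em]] := ZiP aZ.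
  have mr := intr_Creal m.
  have nr := intr_Creal n.
  have emc : a^* = m%:~R - 'i * n%:~R by rewrite em rmorphD rmorphM /= conjCi !conj_Creal // mulNr.
  have half k : (p %| 2 * k)%Z -> (p %| `|k|)%N.
    rewrite dvdzE abszM /= Euclid_dvdM // => /orP[|//].
    by move/(dvdn_leq (isT : 0 < 2)%N) => p2; move: op pp; case: (p) p2 => [|[|[|]]].
  have pm : (p %| `|m|)%N.
    apply/half/(gdvd_int pp aZ na); have -> : (2 * m)%:~R = a + a^* by rewrite emc em rmorphM /=; ring.
    by apply: gdvdD => //; apply: gdvdnn.
  have pn : (p %| `|n|)%N.
    apply/half/(gdvd_int pp aZ na).
    have -> : (2 * n)%:~R = (a - a^*) * (- 'i).
      by rewrite emc em rmorphM /=; transitivity (- ('i * 'i) * (2 * n%:~R) : algC); [rewrite ii|]; ring.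
    by apply: gdvd_mulr; [rewrite rpredN i_Zi | apply: gdvdB => //; apply: gdvdnn].
  have epn : (p = `|m| ^ 2 + `|n| ^ 2)%N.
    apply: absz_sum_sqr; apply: (@intr_inj algC); rewrite -pmulrn ep -normCK normC2_Re_Im em Re_rect // Im_rect //.
    by rewrite rmorphD !rmorphXn.
  have := dvdn_add (dvdn_exp2r 2 pm) (dvdn_exp2r 2 pn); rewrite -epn => /(dvdn_leq p0).
  by rewrite -{2}[p]muln1 -mulnn leq_pmul2l // leqNgt prime_gt1.
have ad' : ~~ gdvd a d'%:R.
  by apply/negP => h; case/negP: pd'; have := @gdvd_int p a d' pp aZ na; rewrite dvdzE -pmulrn; apply.
have edC : d%:R = a * (a^* * d'%:R) :> algC by rewrite ed natrM ep mulrA.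
(* Denominators are cleared, and U^2 - d V^2 = g W^2 is treated in Z[i] by descent on the norm of
   W. *)
suff main W : forall U V, U \in Zi -> V \in Zi -> W \in Zi -> W != 0 ->
    U ^+ 2 - d%:R * V ^+ 2 = g * W ^+ 2 -> exists2 z, z \in Zi & gdvd a (z ^+ 2 - g).
  have [m m0 mu] := Qi_denom uQ; have [n n0 nv] := Qi_denom vQ.
  have Zn k : k%:R \in Zi by apply: rpred_nat.
  apply: (main (m * n)%:R (n%:R * (m%:R * u)) (m%:R * (n%:R * v))).
  - exact: rpredM (Zn _) mu.
  - exact: rpredM (Zn _) nv.
  - exact: Zn.
  - by rewrite pnatr_eq0 muln_eq0 negb_or -!lt0n m0.
  by rewrite -eN natrM; ring.
move eM : (nrm W) => M; elim/ltn_ind: M W eM => M IH W eM U V UZ VZ WZ W0 e.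
have dvdV : gdvd a (d%:R * V ^+ 2).
  rewrite edC -mulrA; apply: gdvd_mulr (gdvdnn a0).
  by rewrite !rpredM ?rpredX ?rpred_nat.
(* If a divides W, it divides U, then also V since d contains a only once, and all three can be
   divided by a. Otherwise W is invertible modulo a and U / W is a square root of g. *)
have [aW|aW] := boolP (gdvd a W).
  have aU : gdvd a U.
    apply: asq => //; rewrite -[_ ^+ 2](subrK (d%:R * V ^+ 2)) e; apply: gdvdD => //.
    by rewrite expr2; apply: gdvd_mull => //; apply: gdvd_mull.
  have [U' U'Z eU] := gdvdP a0 aU; have [W' W'Z eW] := gdvdP a0 aW.
  have eV : a^* * d'%:R * V ^+ 2 = a * (U' ^+ 2 - g * W' ^+ 2).
    apply: (mulfI a0); rewrite mulrA mulrA -mulrA -edC.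
    have -> : d%:R * V ^+ 2 = U ^+ 2 - g * W ^+ 2 by rewrite -e; ring.
    by rewrite eU eW; ring.
  have aV : gdvd a V.
    apply: asq => //; have : gdvd a (a^* * d'%:R * V ^+ 2).
      by rewrite eV; apply: gdvd_mulr (gdvdnn a0); rewrite rpredB ?rpredM ?rpredX.
    have dZ : d'%:R \in Zi by apply: rpred_nat.
    have acdZ : a^* * d'%:R \in Zi by rewrite rpredM.
    case/(aM _ _ acdZ (rpredX 2 VZ)) => //.
    by case/(aM _ _ acZ dZ) => h; [rewrite h in ac | rewrite h in ad'].
  have [V' V'Z eV'] := gdvdP a0 aV.
  have W'0 : W' != 0 by apply: contraNneq W0 => t0; rewrite eW t0 mulr0.
  apply: (IH (nrm W') _ W' erefl U' V') => //.
    rewrite -eM eW nrmM // na; apply: ltn_Pmull; [exact: prime_gt1 | exact: nrm_gt0].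
  apply: (mulfI (expf_neq0 2 a0)).
  transitivity (U ^+ 2 - d%:R * V ^+ 2); first by rewrite eU eV'; ring.
  by rewrite e eW; ring.
have [m Wm] := Zi_residue pp aZ na WZ.
have pm : coprimez m p.
  rewrite coprimezE /= coprime_sym prime_coprime //; apply/negP => /dvdnP[l el].
  case/negP: aW; rewrite -[W](subrK m%:~R); apply: gdvdD => //.
  have -> : m%:~R = (sgz m)%:~R * (l%:R * (a * a^*)).
    by rewrite -nrmE // na -natrM -el pmulrn -rmorphM /= -intEsg.
  apply: gdvd_mull; first exact: Zi_int.
  by apply: gdvd_mull; [apply: rpred_nat | apply: gdvd_mulr (gdvdnn a0)].
case/coprimezP: pm => -[b c] /= ebc.
have bZ : b%:~R \in Zi := Zi_int b.
have aWb : gdvd a (W * b%:~R - 1).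
  have -> : W * b%:~R - 1 = (W - m%:~R) * b%:~R - c%:~R * a^* * a.
    have e1 : c * p = 1 - b * m by rewrite -ebc [RHS]addrAC subrr add0r.
    have -> : c%:~R * a^* * a = 1 - b%:~R * m%:~R.
      by rewrite -mulrA (mulrC _ a) -ep pmulrn -rmorphM e1 rmorphB rmorphM.
    by ring.
  apply: gdvdB; first by apply: gdvd_mulr.
  by apply: gdvd_mull (gdvdnn a0); rewrite rpredM // Zi_int.
exists (U * b%:~R); first exact: rpredM.
have -> : (U * b%:~R) ^+ 2 - g = b%:~R ^+ 2 * (d%:R * V ^+ 2) + g * (W * b%:~R + 1) * (W * b%:~R - 1).
  have -> : d%:R * V ^+ 2 = U ^+ 2 - g * W ^+ 2 by rewrite -e; ring.
  by ring.
apply: gdvdD; first by apply: gdvd_mull => //; apply: rpredX.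
by apply: gdvd_mull => //; rewrite rpredM // rpredD ?rpredM ?rpred1.
Qed.

(** w m is a square modulo a. For w = 1 or -1 the sign is harmless as p = 1 modulo 4; for w = i or
    -i, multiplying by the square (1 + i)^2 = 2i turns it into 2m up to sign. *)
Lemma norm_residue p (d' : nat) a (m : int) w th : prime p -> a \in Zi -> nrm a = p ->
  d = (p * d')%N -> ~~ (p %| d')%N -> (p %% 4 = 1)%N -> ~~ (p %| m)%Z ->
  w \in Zi -> w^-1 \in Zi -> w != 0 -> th \in kq -> N th = w * m%:~R ->
  (w ^+ 2 = 1 /\ qres p m) \/ (w ^+ 2 = -1 /\ qres p (2 * m)).
Proof.
move=> pp aZ na ed pd' p4 pm wZ wV w0 thk eN.
have a0 : a != 0 by apply: nrm_neq0; rewrite ?na ?prime_gt0.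
have gZ : w * m%:~R \in Zi by rewrite rpredM ?Zi_int.
have ag : ~~ gdvd a (w * m%:~R).
  apply: contra pm => h; apply: (gdvd_int pp aZ na).
  by rewrite -[m%:~R](mulKf w0); apply: gdvd_mull.
have [z zZ az] := norm_local_square pp aZ na ed pd' (prime_mod4_odd p4) gZ ag thk eN.
have lZ := lambda_Zi.
have sq x n : x \in Zi -> gdvd a (x ^+ 2 - n%:~R) -> qres p n.
  by move=> xZ; apply: qres_of_Zi_square pp aZ na xZ.
have l2 := lambda_sqr.
case: (Zi_unitP wZ wV w0) az => ew az; rewrite ew.
- by left; rewrite expr1n; split=> //; apply: (sq z) => //; rewrite ew mul1r in az.
- left; rewrite sqrrN expr1n; split=> //; rewrite -[m]opprK; apply: qresN => //.
  by apply: (sq z) => //; rewrite ew mulN1r -rmorphN in az.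
- right; rewrite sqrCi; split=> //; rewrite -[2 * m]opprK; apply: qresN => //.
  apply: (sq ((1 + 'i) * z)); first exact: rpredM.
  have -> : ((1 + 'i) * z) ^+ 2 - (- (2 * m))%:~R = (1 + 'i) ^+ 2 * (z ^+ 2 - w * m%:~R).
    rewrite l2 ew rmorphN rmorphM /= exprMn l2.
    transitivity (2 * 'i * z ^+ 2 - ('i * 'i) * (2 * m%:~R)); [rewrite ii|]; ring.
  by apply: gdvd_mull => //; apply: rpredX.
right; rewrite sqrrN sqrCi; split=> //; apply: (sq ((1 + 'i) * z)); first exact: rpredM.
have -> : ((1 + 'i) * z) ^+ 2 - (2 * m)%:~R = (1 + 'i) ^+ 2 * (z ^+ 2 - w * m%:~R).
  rewrite l2 ew rmorphM /= exprMn l2.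
  transitivity (2 * 'i * z ^+ 2 + ('i * 'i) * (2 * m%:~R)); [rewrite ii|]; ring.
by apply: gdvd_mull => //; apply: rpredX.
Qed.

Lemma ndvd_two_mul p q : prime p -> prime q -> odd p -> p != q -> ~~ (p %| 2 * q)%N.
Proof.
move=> pp pq op pnq; rewrite Euclid_dvdM // negb_or !dvdn_prime2 // pnq andbT.
by apply: contraL op => /eqP ->.
Qed.

Lemma N_s_mul x : N (s * x) = - d%:R * N x.
Proof. by rewrite NM {1}/N sg_s mulrN -expr2 s_sqr. Qed.

(** The norm w p is tested at q; at p one tests s th / p instead, of norm -2 q w. Both tests share
    w^2, and each of its values leads to [few_cross], with p and q exchanged when w^2 = -1. *)
Lemma prime_not_norm p q w th : prime p -> prime q -> (p %% 4 = 1)%N -> (q %% 4 = 1)%N ->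
  p != q -> d = (2 * p * q)%N -> few_residues p q -> w \in Zi -> w^-1 \in Zi -> w != 0 ->
  th \in kq -> N th = w * p%:R -> False.
Proof.
move=> pp pq p4 q4 pnq ed few wZ wV w0 thk eN.
have [op oq] := (prime_mod4_odd p4, prime_mod4_odd q4).
have qnp : q != p by rewrite eq_sym.
have few' := few_residues_sym pp pq p4 q4 pnq few.
have [a aZ na] := prime_norm_exists pp p4; have [b bZ nb] := prime_norm_exists pq q4.
have edp : d = (p * (2 * q))%N by rewrite ed; ring.
have edq : d = (q * (2 * p))%N by rewrite ed; ring.
have pC : p%:R != 0 :> algC by rewrite pnatr_eq0 -lt0n prime_gt0.
have q_p : ~~ (q %| p%:Z)%Z by rewrite dvdzE /= dvdn_prime2.
have eN1 : N th = w * p%:Z%:~R by rewrite eN pmulrn.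
have p_2q : ~~ (p %| (2 * q)%N%:Z)%Z by rewrite dvdzE /= ndvd_two_mul.
have eN2 : N (s * th / p%:R) = - w * ((2 * q)%N%:Z)%:~R.
  have pQ : p%:R \in Qi by apply: rpred_nat.
  rewrite NM N_s_mul NV (N_sqr_Qi pQ) eN edp -pmulrn natrM.
  by field.
have th'k : s * th / p%:R \in kq by rewrite rpred_div ?rpred_nat // rpredM ?s_kq.
have nwZ : - w \in Zi by rewrite rpredN.
have nwV : (- w)^-1 \in Zi by rewrite invrN rpredN.
have nw0 : - w != 0 by rewrite oppr_eq0.
have R1 := norm_residue pq bZ nb edq (ndvd_two_mul pq pp oq qnp) q4 q_p wZ wV w0 thk eN1.
have R2 := norm_residue pp aZ na edp (ndvd_two_mul pp pq op pnq) p4 p_2q nwZ nwV nw0 th'k eN2.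
have m11 := one_neq_opp1.
rewrite sqrrN in R2.
case: R1 R2 => -[w2 r1] [] [w2' r2]; try by (case: m11; first [exact: etrans (esym w2) w2' | exact: etrans (esym w2') w2]).
  exact: (few_cross pp pq p4 q4 pnq few r1 r2).
apply: (few_cross pq pp q4 p4 qnp few').
  apply: (@qres_divl p 4) => //.
  - have : ~~ (p %| 2 ^ 2)%N; last by rewrite dvdzE.
    rewrite Euclid_dvdX // andbT dvdn_prime2 //.
    by apply: contraL op => /eqP ->.
  - by exists 2; rewrite -natrX.
  by have -> : 4 * q%:Z = 2 * (2 * q)%N%:Z by rewrite PoszM mulrA.
by rewrite PoszM.
Qed.

(** Then s th / (p q) has norm -2, which makes 2 a residue modulo both p and q. *)
Lemma prime_product_not_norm p q th : prime p -> prime q -> (p %% 4 = 1)%N -> (q %% 4 = 1)%N ->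
  p != q -> d = (2 * p * q)%N -> few_residues p q -> th \in kq -> N th = (p * q)%:R -> False.
Proof.
move=> pp pq p4 q4 pnq ed few thk eN.
have [op oq] := (prime_mod4_odd p4, prime_mod4_odd q4).
have qnp : q != p by rewrite eq_sym.
have [a aZ na] := prime_norm_exists pp p4; have [b bZ nb] := prime_norm_exists pq q4.
have edp : d = (p * (2 * q))%N by rewrite ed; ring.
have edq : d = (q * (2 * p))%N by rewrite ed; ring.
have pC : p%:R != 0 :> algC by rewrite pnatr_eq0 -lt0n prime_gt0.
have qC : q%:R != 0 :> algC by rewrite pnatr_eq0 -lt0n prime_gt0.
have eN2 : N (s * th / (p * q)%:R) = -1 * (2%N%:Z)%:~R.
  have pqQ : (p * q)%:R \in Qi by apply: rpred_nat.
  rewrite NM N_s_mul NV (N_sqr_Qi pqQ) eN edp -pmulrn !natrM.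
  by field; rewrite pC qC.
have th'k : s * th / (p * q)%:R \in kq by rewrite rpred_div ?rpred_nat // rpredM ?s_kq.
have N1 : -1 \in Zi by rewrite rpredN rpred1.
have N1V : (-1)^-1 \in Zi by rewrite invrN1.
have N10 : -1 != 0 :> algC by rewrite oppr_eq0 oner_eq0.
have n2 r : prime r -> odd r -> ~~ (r %| 2)%Z.
  by move=> pr or; rewrite dvdzE /= dvdn_prime2 //; apply: contraL or => /eqP ->.
have R1 := norm_residue pp aZ na edp (ndvd_two_mul pp pq op pnq) p4 (n2 _ pp op) N1 N1V N10 th'k eN2.
have R2 := norm_residue pq bZ nb edq (ndvd_two_mul pq pp oq qnp) q4 (n2 _ pq oq) N1 N1V N10 th'k eN2.
have m11 := one_neq_opp1.
rewrite sqrrN expr1n in R1 R2.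
case: R1 => -[// _ r1]; case: R2 => -[// _ r2].
by have [_ _ F] := few; apply: F.
Qed.

(** * Gaussian integers that are norms up to a unit *)

Definition norm_up_to_unit (c : algC) : Prop :=
  exists w th, [/\ w \in Zi, w^-1 \in Zi, w != 0, th \in kq & th != 0 /\ c = w * N th].

Lemma norm_up_to_unitM c c' : norm_up_to_unit c -> norm_up_to_unit c' -> norm_up_to_unit (c * c').
Proof.
move=> [w [t [wZ wV w0 tk [t0 ->]]]] [w' [t' [wZ' wV' w0' tk' [t0' ->]]]].
exists (w * w'), (t * t'); rewrite invfM !mulf_neq0 // !rpredM //.
by split=> //; split=> //; rewrite NM; ring.
Qed.

Lemma norm_up_to_unit_sqr c e : e \in Qi -> e != 0 -> norm_up_to_unit (c * e ^+ 2) ->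
  norm_up_to_unit c.
Proof.
move=> eQ e0 [w [t [wZ wV w0 tk [t0 e1]]]]; exists w, (t / e).
split=> //; first by rewrite rpred_div // Qi_kq.
split; first by rewrite mulf_neq0 ?invr_neq0.
rewrite NM NV (N_sqr_Qi eQ); apply: (mulIf (expf_neq0 2 e0)); rewrite e1.
by rewrite -!mulrA mulVf ?mulr1 // expf_neq0.
Qed.

Let k := fun x : algC => is_true (x \in kq).
Let k_field : is_subfield k := kq_subfield.

(** If c = u e^2 lies in Q(i), then c^2 = N c = N u (N e)^2, so c / N e has a unit as its square. *)
Lemma unit_sqr_norm c : c \in Qi -> c != 0 -> unit_sqr k c -> norm_up_to_unit c.
Proof.
move=> cQ c0 [u [e [uk uU u0 ek [e0 ec]]]]; have Ne0 : N e != 0 by rewrite N_eq0.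
have wU : unitA (c / N e).
  apply: unitA_sqrt; have -> : (c / N e) ^+ 2 = N u.
    rewrite expr_div_n -(N_sqr_Qi cQ) {1}ec NM expr2 NM -expr2 mulfK //.
    by rewrite expf_neq0.
  by apply: unitAM => //; rewrite unitA_aut.
have wQ : c / N e \in Qi by rewrite rpred_div ?N_Qi.
case/andP: wU => wA wVA; exists (c / N e), e; split=> //.
- by rewrite ZiE wQ.
- by rewrite ZiE rpredV wQ.
- by rewrite mulf_neq0 ?invr_neq0.
by split=> //; rewrite divfK.
Qed.

Section TwoPrimesUnits.
Variables (p1 p2 : nat).
Hypotheses (p1_prime : prime p1) (p2_prime : prime p2).
Hypotheses (p1_mod4 : (p1 %% 4 = 1)%N) (p2_mod4 : (p2 %% 4 = 1)%N) (p12 : p1 != p2).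
Hypotheses (ed : d = (2 * p1 * p2)%N) (few : few_residues p1 p2) (s_conj : s^* = s).

Lemma conj_kq x : x \in kq -> x^* \in kq.
Proof.
case/kqP=> u [v [uQ vQ ->]]; apply/kqP; exists u^*, v^*.
by rewrite !conj_Qi rmorphD rmorphM /= s_conj.
Qed.

Lemma N_conj x : x \in kq -> N x^* = (N x)^*.
Proof.
case/kqP=> u [v [uQ vQ ->]].
rewrite N_formula // rmorphD rmorphM /= s_conj N_formula ?conj_Qi //.
by rewrite rmorphB rmorphXn rmorphM rmorphXn /= conjC_nat.
Qed.

(** Multiplying by the complex conjugate removes the unknown unit w and leaves a norm of the form c
    c^*, which is a natural number for c in Z[i]. *)
Lemma norm_mul_conj c : norm_up_to_unit c -> exists2 th, th \in kq & N th = c * c^*.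
Proof.
move=> [w [t [wZ wV w0 tk [t0 ->]]]]; exists (t * t^*); first by rewrite rpredM ?conj_kq.
have -> : (w * N t)^* = w^* * (N t)^* by apply: rmorphM.
rewrite NM N_conj //.
have e1 : w * w^* = 1 by rewrite -nrmE //; move: wV; rewrite Zi_unit // => /eqP ->.
by transitivity (w * w^* * (N t * (N t)^*)); [rewrite e1 mul1r | ring].
Qed.

Lemma norm_parity A B th : th \in kq -> N th = (p1 ^ A * p2 ^ B)%N%:R -> ~~ odd A && ~~ odd B.
Proof.
move=> tk eN; have p21 : p2 != p1 by rewrite eq_sym.
have p1C : p1%:R != 0 :> algC by rewrite pnatr_eq0 -lt0n prime_gt0.
have p2C : p2%:R != 0 :> algC by rewrite pnatr_eq0 -lt0n prime_gt0.
pose m : algC := p1%:R ^+ A./2 * p2%:R ^+ B./2.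
have m0 : m != 0 by rewrite mulf_neq0 ?expf_neq0.
have mQ : m \in Qi by rewrite rpredM ?rpredX ?rpred_nat.
have tmk : th / m \in kq by apply: rpred_div => //; apply: Qi_kq.
have eN' : N (th / m) = (p1 ^ odd A * p2 ^ odd B)%N%:R.
  rewrite NM NV (N_sqr_Qi mQ) eN -{1}(odd_double_half A) -{1}(odd_double_half B) !expnD.
  rewrite -!muln2 !expnM !natrM !natrX /m.
  by field; rewrite !expf_neq0.
have [u1 u1V u10] : [/\ 1 \in Zi, 1^-1 \in Zi & 1 != 0 :> algC].
  by rewrite invr1 rpred1 oner_neq0.
have ed' : d = (2 * p2 * p1)%N by rewrite ed mulnAC.
have few' := few_residues_sym p1_prime p2_prime p1_mod4 p2_mod4 p12 few.
case: (odd A) (odd B) eN' => [] [] // eN'; exfalso.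
- by apply: (prime_product_not_norm p1_prime p2_prime p1_mod4 p2_mod4 p12 ed few tmk).
- apply: (prime_not_norm p1_prime p2_prime p1_mod4 p2_mod4 p12 ed few u1 u1V u10 tmk).
  by rewrite eN' expn1 expn0 muln1 mul1r.
apply: (prime_not_norm p2_prime p1_prime p2_mod4 p1_mod4 p21 ed' few' u1 u1V u10 tmk).
by rewrite eN' expn1 expn0 mul1n mul1r.
Qed.

Lemma k_i : k 'i.
Proof. exact/Qi_kq/i_Qi. Qed.

Lemma two_primes_unit_sqr : unit_sqr k (p1%:R * p2%:R).
Proof.
have n2 : 2 != 0 :> algC by rewrite pnatr_eq0.
have -> : p1%:R * p2%:R = s ^+ 2 * 2^-1 :> algC by rewrite s_sqr ed !natrM; field.
apply: unit_sqrM => //; first by apply: unit_sqr_sqr; [|exact: s_kq | exact: s_neq0].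
by apply: unit_sqrV => //; apply: two_unit_sqr => //; apply: k_i.
Qed.

(** The product of the monomial and its conjugate is p1^(e1 + f1) p2^(e2 + f2), so e_j and f_j have
    equal parity. Modulo squares only w, w p1, w p2 and w p1 p2 remain; the middle two are not
    norms, and p1 p2 = s^2 / 2. *)
Lemma norm_monomial_unit_sqr a1 a2 w e1 f1 e2 f2 : a1 \in Zi -> a2 \in Zi -> nrm a1 = p1 ->
  nrm a2 = p2 -> w \in Zi -> w^-1 \in Zi -> w != 0 ->
  norm_up_to_unit (w * (a1 ^+ e1 * a1^* ^+ f1) * (a2 ^+ e2 * a2^* ^+ f2)) ->
  unit_sqr k (w * (a1 ^+ e1 * a1^* ^+ f1) * (a2 ^+ e2 * a2^* ^+ f2)).
Proof.
move=> a1Z a2Z na1 na2 wZ wV w0 Nc; have p21 : p2 != p1 by rewrite eq_sym.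
have e1' : p1%:R = a1 * a1^* by rewrite -nrmE ?na1.
have e2' : p2%:R = a2 * a2^* by rewrite -nrmE ?na2.
have ew : w * w^* = 1 by rewrite -nrmE //; move: (wV); rewrite Zi_unit // => /eqP ->.
have a10 : a1 != 0 by apply: nrm_neq0; rewrite ?na1 ?prime_gt0.
have a20 : a2 != 0 by apply: nrm_neq0; rewrite ?na2 ?prime_gt0.
have [th thk eN] := norm_mul_conj Nc.
have /andP[o1 o2] : ~~ odd (e1 + f1) && ~~ odd (e2 + f2).
  apply: (norm_parity thk); rewrite eN natrM !natrX e1' e2'.
  have -> : (w * (a1 ^+ e1 * a1^* ^+ f1) * (a2 ^+ e2 * a2^* ^+ f2))^* =
      w^* * (a1^* ^+ e1 * a1 ^+ f1) * (a2^* ^+ e2 * a2 ^+ f2).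
    by rewrite !rmorphM !rmorphXn /= !conjCK.
  rewrite !exprD !exprMn.
  transitivity (w * w^* * ((a1 ^+ e1 * a1^* ^+ f1) * (a1^* ^+ e1 * a1 ^+ f1)) *
    ((a2 ^+ e2 * a2^* ^+ f2) * (a2^* ^+ e2 * a2 ^+ f2))); first by ring.
  by rewrite ew; ring.
have split_pow (a : algC) e f : odd (e + f) = false ->
    a ^+ e * a^* ^+ f = (a * a^*) ^+ odd e * (a ^+ e./2 * a^* ^+ f./2) ^+ 2.
  move=> o; have of_e : odd f = odd e by move: o; rewrite oddD; case: (odd e); case: (odd f).
  rewrite -{1}(odd_double_half e) -{1}(odd_double_half f) of_e -!muln2 !exprD !exprM.
  by rewrite !exprMn; ring.
have hk a n m : a \in Zi -> k (a ^+ n * a^* ^+ m).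
  by move=> aZ; rewrite /k rpredM ?rpredX ?Qi_kq ?conj_Qi ?(Zi_Qi aZ).
have h0 (a : algC) n m : a != 0 -> a ^+ n * a^* ^+ m != 0.
  by move=> a0; rewrite mulf_neq0 ?expf_neq0 ?fmorph_eq0.
have Qh a n m : a \in Zi -> a ^+ n * a^* ^+ m \in Qi.
  by move=> aZ; rewrite rpredM ?rpredX ?conj_Qi ?(Zi_Qi aZ).
move: Nc; rewrite (split_pow a1 e1 f1 (negbTE o1)) (split_pow a2 e2 f2 (negbTE o2)).
set x1 := a1 ^+ _ * _; set x2 := a2 ^+ _ * _; rewrite -e1' -e2'.
have -> : w * (p1%:R ^+ odd e1 * x1 ^+ 2) * (p2%:R ^+ odd e2 * x2 ^+ 2) =
  w * p1%:R ^+ odd e1 * p2%:R ^+ odd e2 * (x1 * x2) ^+ 2 by ring.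
have x0 : x1 * x2 != 0 by rewrite mulf_neq0 ?h0.
move/(norm_up_to_unit_sqr (rpredM (Qh _ _ _ a1Z) (Qh _ _ _ a2Z)) x0) => Nc.
apply: unit_sqrM => //; last first.
  by apply: unit_sqr_sqr => //; rewrite /k rpredM; [|exact: hk|exact: hk].
have Tw : unit_sqr k w.
  by apply: unit_sqr_unit => //; [exact/Qi_kq/Zi_Qi | exact: unitA_Zi].
have ed' : d = (2 * p2 * p1)%N by rewrite ed mulnAC.
have few' := few_residues_sym p1_prime p2_prime p1_mod4 p2_mod4 p12 few.
have not_norm p q y : prime p -> prime q -> (p %% 4 = 1)%N -> (q %% 4 = 1)%N ->
    p != q -> d = (2 * p * q)%N -> few_residues p q -> norm_up_to_unit (w * p%:R) -> unit_sqr k y.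
  move=> pp pq p4 q4 pnq ed'' fpq [w' [t [wZ' wV' w0' tk [t0 ec]]]]; exfalso.
  apply: (prime_not_norm pp pq p4 q4 pnq ed'' fpq (w := w'^-1 * w) _ _ _ tk).
  - exact: rpredM.
  - by rewrite invfM invrK rpredM.
  - by rewrite mulf_neq0 ?invr_eq0.
  by rewrite -mulrA ec mulKf.
move: Nc; case: (odd e1) (odd e2) => [] []; rewrite !(expr1, expr0, mulr1) => Nc //.
- by rewrite -mulrA; apply: unit_sqrM => //; apply: two_primes_unit_sqr.
- exact: (not_norm p1 p2).
exact: (not_norm p2 p1).
Qed.

(** If 1 + i occurs to an even power, c reduces to a monomial in the primes above p1 and p2;
    otherwise this is applied to c (x + i). *)
Lemma norm_unit_sqr c : c \in Zi -> c != 0 ->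
  (forall p, gprime p -> gdvd p c -> gdvd p (2 * d%:R)) -> norm_up_to_unit c -> unit_sqr k c.
Proof.
move=> cZ c0 cP Nc.
have [x [y eP]] := negative_pell_two_primes p1_prime p2_prime p1_mod4 p2_mod4 p12 few.
have [a1 [a2 [z [u [[a1Z a2Z zZ] na1 na2 [uZ nu] eX]]]]] :=
  pell_factor_two_primes p1_prime p2_prime p1_mod4 p2_mod4 p12 eP.
set X : algC := x%:R + 'i in eX; have XZ : X \in Zi := natDi_Zi x.
have X0 : X != 0 by rewrite -nrm_eq0 // nrm_natDi addn1.
have [u0 z0] : u != 0 /\ z != 0.
  by split; apply: contraNneq X0 => t0; rewrite eX t0 ?mulr0 ?mul0r // expr0n mulr0.
have a10 : a1 != 0 by apply: nrm_neq0; rewrite ?na1 ?prime_gt0.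
have a20 : a2 != 0 by apply: nrm_neq0; rewrite ?na2 ?prime_gt0.
have uV : u^-1 \in Zi by rewrite Zi_unit ?nu.
have sA : s \in Aint by apply: Aint_sqrt; rewrite s_sqr rpred_nat.
have l0 := lambda_neq0.
have TX : unit_sqr k X by apply: (pell_unit_sqr k_field k_i s_kq s_sqr); rewrite eP ed.
have NX := unit_sqr_norm (Zi_Qi XZ) X0 TX.
pose mono w e1 f1 e2 f2 := w * (a1 ^+ e1 * a1^* ^+ f1) * (a2 ^+ e2 * a2^* ^+ f2).
have [w [e0 [e1 [f1 [e2 [f2 [[wZ wV w0] ec]]]]]]] : exists w e0 e1 f1 e2 f2,
    [/\ w \in Zi, w^-1 \in Zi & w != 0] /\ c = (1 + 'i) ^+ e0 * mono w e1 f1 e2 f2.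
  have cP' p : gprime p -> gdvd p c -> gdvd p (2 * (2 * p1 * p2)%:R) by rewrite -ed; apply: cP.
  have o1 : [/\ 1 \in Zi, 1^-1 \in Zi & 1 != 0 :> algC] by rewrite invr1 rpred1 oner_neq0.
  apply: (Zi_gen_ind (S := fun c => exists w e0 e1 f1 e2 f2, [/\ w \in Zi, w^-1 \in Zi & w != 0] /\
    c = (1 + 'i) ^+ e0 * mono w e1 f1 e2 f2) p1_prime p2_prime a1Z a2Z na1 na2 cZ c0 cP').
  - by move=> v vZ vV v0; exists v, 0, 0, 0, 0, 0; split=> //; rewrite /mono !expr0; ring.
  - by exists 1, 1%N, 0, 0, 0, 0; split=> //; rewrite /mono !expr0 expr1; ring.
  - by exists 1, 0, 1%N, 0, 0, 0; split=> //; rewrite /mono !expr0 expr1; ring.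
  - by exists 1, 0, 0, 1%N, 0, 0; split=> //; rewrite /mono !expr0 expr1; ring.
  - by exists 1, 0, 0, 0, 1%N, 0; split=> //; rewrite /mono !expr0 expr1; ring.
  - by exists 1, 0, 0, 0, 0, 1%N; split=> //; rewrite /mono !expr0 expr1; ring.
  move=> b b' [v [g0 [g1 [h1 [g2 [h2 [[vZ vV v0] ->]]]]]]].
  move=> [v' [g0' [g1' [h1' [g2' [h2' [[vZ' vV' v0'] ->]]]]]]].
  exists (v * v'), (g0 + g0')%N, (g1 + g1')%N, (h1 + h1')%N, (g2 + g2')%N, (h2 + h2')%N.
  split; first by rewrite invfM !rpredM ?mulf_neq0.
  by rewrite /mono !exprD; ring.
have reduce w' g1 h1 g2 h2 b r : [/\ w' \in Zi, w'^-1 \in Zi & w' != 0] -> r \in Zi -> r != 0 ->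
    b = mono w' g1 h1 g2 h2 * r ^+ 2 -> norm_up_to_unit b -> unit_sqr k b.
  move=> [wZ' wV' w0'] rZ r0 -> /(norm_up_to_unit_sqr (Zi_Qi rZ) r0) h.
  apply: unit_sqrM => //; first exact: norm_monomial_unit_sqr.
  by apply: unit_sqr_sqr => //; apply/Qi_kq/Zi_Qi.
have lX n : (1 + 'i) ^+ n \in Zi by rewrite rpredX // lambda_Zi.
have [o|o] := boolP (odd e0); last first.
  apply: (reduce w e1 f1 e2 f2 c ((1 + 'i) ^+ e0./2)) => //; first by rewrite expf_neq0.
  rewrite ec -exprM muln2; have -> : e0./2.*2 = e0 by rewrite -[RHS]odd_double_half (negbTE o).
  by rewrite mulrC.
(* X = (1 + i) a1 a2 u z^2 makes the power of 1 + i even and raises e1 and e2 by one; X is a unit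
   times a square in k, so c X is still a norm up to a unit. *)
have TcX : unit_sqr k (c * X).
  apply: (reduce (w * u) e1.+1 f1 e2.+1 f2 _ ((1 + 'i) ^+ (e0./2).+1 * z)).
  - by rewrite invfM !rpredM ?mulf_neq0.
  - exact: rpredM.
  - by rewrite mulf_neq0 ?expf_neq0.
  - have -> : c = (1 + 'i) * ((1 + 'i) ^+ e0./2) ^+ 2 * mono w e1 f1 e2 f2.
      by rewrite ec -{1}(odd_double_half e0) o -muln2 exprD exprM.
    by rewrite eX /mono !exprS; ring.
  exact: norm_up_to_unitM.
have -> : c = c * X * X^-1 by rewrite mulfK.
by apply: unit_sqrM => //; apply: unit_sqrV.
Qed.
End TwoPrimesUnits.

(** * Norms of units, and conclusions for ideals *)

Lemma unitA_i : unitA 'i.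
Proof. by rewrite /unitA i_Aint (Zi_Aint iV_Zi). Qed.

Lemma N_i : N 'i = -1.
Proof. by rewrite /N sg_i ii. Qed.

Lemma units_surject_of : (forall b, b \in kq -> N b = 'i \/ N b = - 'i ->
    exists e, [/\ e \in kq, e != 0, unitA e & N e = N b]) -> units_surject.
Proof.
move=> H b bk b0 NZ NV; have N0 : N b != 0 by rewrite N_eq0.
case: (Zi_unitP NZ NV N0) => eN; [| |by apply: H => //; left |by apply: H => //; right].
  exists 1; rewrite eN /N rmorph1 mulr1 rpred1 oner_neq0.
  by split=> //; rewrite /unitA invr1 rpred1.
exists 'i; rewrite eN N_i i_neq0; split=> //; last exact: unitA_i.
exact/Qi_kq/i_Qi.
Qed.

(** The values 1 and -1 are norms of 1 and i. A norm i or -i would make 2 a residue modulo both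
    primes. *)
Lemma units_surject_two_primes p1 p2 : prime p1 -> prime p2 -> (p1 %% 4 = 1)%N -> (p2 %% 4 = 1)%N ->
  p1 != p2 -> d = (2 * p1 * p2)%N -> few_residues p1 p2 -> units_surject.
Proof.
move=> pp1 pp2 m1 m2 p12 ed few; apply: units_surject_of => b bk eN; exfalso.
have p21 : p2 != p1 by rewrite eq_sym.
suff res p q : prime p -> prime q -> (p %% 4 = 1)%N -> p != q -> d = (2 * p * q)%N -> qres p 2.
  have [_ _ F] := few; apply: F; split; first exact: (res p1 p2).
  by apply: (res p2 p1) => //; rewrite ed mulnAC.
move=> pp pq p4 pnq {}ed; have op := prime_mod4_odd p4.
have [a aZ na] := prime_norm_exists pp p4.
have edp : d = (p * (2 * q))%N by rewrite ed; ring.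
have p1' : ~~ (p %| 1)%Z by rewrite dvdzE /= dvdn1 gtn_eqF // prime_gt1.
have m11 := one_neq_opp1.
have fin w : w \in Zi -> w^-1 \in Zi -> w != 0 -> w ^+ 2 = -1 -> N b = w -> qres p 2.
  move=> wZ wV w0 w2 e; have e' : N b = w * 1%:~R by rewrite mulr1.
  have := norm_residue pp aZ na edp (ndvd_two_mul pp pq op pnq) p4 p1' wZ wV w0 bk e'.
  by case=> -[]; rewrite w2 => h //; case: m11.
case: eN => e; first by apply: fin e => //; rewrite ?i_Zi ?iV_Zi ?i_neq0 ?sqrCi.
apply: fin e; rewrite ?invrN ?rpredN ?oppr_eq0 ?i_Zi ?iV_Zi ?i_neq0 //.
by rewrite sqrrN sqrCi.
Qed.

(** The eighth root of unity z = (1 + i) / s satisfies sigma(z) = -z, so N z = -i and N (i z) =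
    i. *)
Lemma units_surject_eighth : d = 2%N -> units_surject.
Proof.
move=> d2; apply: units_surject_of => b bk eN.
have s2 : s ^+ 2 = 2 by rewrite s_sqr d2.
have s0 := s_neq0; have n2 : 2 != 0 :> algC by rewrite pnatr_eq0.
pose z := (1 + 'i) / s.
have z2 : z ^+ 2 = 'i by rewrite expr_div_n s2 lambda_sqr mulrC mulKf.
have zU : unitA z by apply: unitA_sqrt; rewrite z2 unitA_i.
have zk : z \in kq by rewrite rpred_div ?s_kq // Qi_kq // rpredD ?rpred1 ?i_Qi.
have z0 : z != 0 by rewrite -sqrf_eq0 z2 i_neq0.
have Nz : N z = - 'i.
  have sz : sg z = - z.
    by rewrite /z rmorphM fmorphV rmorphD rmorph1 /= sg_i sg_s invrN mulrN.
  by rewrite /N sz mulrN -expr2 z2.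
case: eN => ->; last by exists z.
exists ('i * z); split; [|exact: mulf_neq0 i_neq0 z0|exact: unitAM unitA_i zU|].
  by rewrite rpredM // Qi_kq ?i_Qi.
by rewrite NM N_i Nz mulN1r opprK.
Qed.

Lemma capitulation K I : is_subfield K -> (forall x, x \in kq -> K x) -> units_surject ->
  (forall c, c \in Zi -> c != 0 -> (forall p, gprime p -> gdvd p c -> gdvd p (2 * d%:R)) ->
     unit_sqr K c) ->
  is_ideal O I -> nonzero_ideal I -> principal O (ideal_sqr O I) ->
  capitulates (ring_of_integers K) I.
Proof.
move=> Kf kK US HK II I0 [al [Oal Sal]]; have [_ [_ [_ [KM _]]]] := Kf.
have [a Ia] := norm_gen_exists II I0.
have al0 := ideal_sqr_principal_neq0 I0 Sal.
have [e [c [g [[ek e0 eU] [cZ c0] [gk g0] eal cP]]]] := sqr_principal_shape US II Ia al0 Sal.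
have [u [r [Ku uU u0 Kr [r0 ec]]]] := HK c cZ c0 cP.
have /andP[euA euV] := unitAM eU uU.
apply: (extension_principal k_field Kf kK II Sal (u := e * u) (de := r * g)) => //.
- by apply: (KM) => //; apply: kK.
- by rewrite mulf_neq0.
- by apply: KM => //; apply: kK.
- by rewrite mulf_neq0.
by rewrite eal ec; ring.
Qed.

(** [extension_principal] is applied to J^2 with K = k, where capitulating just means being
    principal. *)
Lemma sqr_principal_of_fourth p1 p2 J : prime p1 -> prime p2 ->
  (p1 %% 4 = 1)%N -> (p2 %% 4 = 1)%N -> p1 != p2 -> d = (2 * p1 * p2)%N -> few_residues p1 p2 ->
  s^* = s -> is_ideal O J -> nonzero_ideal J ->
  principal O (ideal_sqr O (ideal_sqr O J)) -> principal O (ideal_sqr O J).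
Proof.
move=> pp1 pp2 m1 m2 p12 ed few sc JI J0 [al [Oal Sal]].
have SI := ideal_sqr_ideal O_ring JI; have S0 := ideal_sqr_nonzero O J0.
have [a Ja] := norm_gen_exists JI J0.
have al0 := ideal_sqr_principal_neq0 S0 Sal.
have US := units_surject_two_primes pp1 pp2 m1 m2 p12 ed few.
have [e [c [g [[ek e0 eU] [cZ c0] [gk g0] eal cP]]]] :=
  sqr_principal_shape US SI (norm_gen_sqr JI Ja) al0 Sal.
have [w [th [wZ wV thk th0 ec]]] :=
  fourth_power_norm JI Ja al0 Sal e0 ek eU cZ c0 gk g0 eal.
have w0 : w != 0 by apply: contraNneq c0 => w0; rewrite ec w0 mul0r.
have Nc : norm_up_to_unit c by exists w, th.
have [u [r [Ku uU u0 Kr [r0 ecr]]]] := norm_unit_sqr pp1 pp2 m1 m2 p12 ed few sc cZ c0 cP Nc.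
have /andP[euA euV] := unitAM eU uU.
have : capitulates O (ideal_sqr O J).
  apply: (extension_principal k_field k_field _ SI Sal (u := e * u) (de := r * g)) => //.
  - exact: rpredM.
  - by rewrite mulf_neq0.
  - exact: rpredM.
  - by rewrite mulf_neq0.
  by rewrite eal ecr; ring.
by rewrite /capitulates (ideal_gen_id SI).
Qed.

(** For d = 2 the only prime that can divide c is 1 + i, and sqrt 2 lies in k, so the identity for 1
    + i is available in k itself. *)
Lemma eighth_unit_sqr c : d = 2%N -> c \in Zi -> c != 0 ->
  (forall p, gprime p -> gdvd p c -> gdvd p (2 * d%:R)) -> unit_sqr k c.
Proof.
move=> d2 cZ c0 cP.
have r_k : sqrtC 2 \in kq.
  have /eqP : sqrtC 2 ^+ 2 = s ^+ 2 by rewrite sqrtCK s_sqr d2.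
  by rewrite eqf_sqr => /orP[] /eqP ->; rewrite ?rpredN s_kq.
have Sl : unit_sqr k (1 + 'i) by apply: lambda_unit_sqr => //; exact/Qi_kq/i_Qi.
have SU u : u \in Zi -> u^-1 \in Zi -> u != 0 -> unit_sqr k u.
  by move=> uZ uV u0; apply: unit_sqr_unit => //; [exact/Qi_kq/Zi_Qi | exact: unitA_Zi].
apply: Zi_mul_ind => // [b bp bc|x y]; last exact: unit_sqrM.
have [_ _ _ bM] := bp; have Z2 : 2%:R \in Zi by apply: rpred_nat.
have b2 : gdvd b 2%:R by have := cP b bp bc; rewrite d2 => /(bM _ _ Z2 Z2)[].
have [w [wZ wV w0 [->|->]]] := gprime_associate (isT : prime 2) lambda_Zi nrm_lambda bp b2.
  by apply: unit_sqrM => //; apply: SU.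
apply: unit_sqrM => //; first exact: SU.
rewrite lambda_conj; apply: unit_sqrM => //; apply: SU.
- by rewrite rpredN i_Zi.
- by rewrite invrN rpredN iV_Zi.
- by rewrite oppr_eq0 i_neq0.
Qed.

Lemma principal_of_iter_sqr_eighth I n : d = 2%N -> is_ideal O I -> nonzero_ideal I ->
  principal O (iter n (ideal_sqr O) I) -> principal O I.
Proof.
move=> d2 II I0; have desc J : is_ideal O J -> nonzero_ideal J ->
    principal O (ideal_sqr O J) -> principal O J.
  move=> JI J0 Sp; rewrite -[J in principal O J](ideal_gen_id JI).
  apply: (capitulation k_field _ (units_surject_eighth d2) _ JI J0 Sp) => // c.
  exact: eighth_unit_sqr.
have In m : is_ideal O (iter m (ideal_sqr O) I) /\ nonzero_ideal (iter m (ideal_sqr O) I).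
  elim: m => [//|m [h1 h2]].
  by split; [apply: (ideal_sqr_ideal O_ring) | apply: ideal_sqr_nonzero].
by elim: n => [//|n IH] h; apply: IH; have [h1 h2] := In n; apply: desc h.
Qed.
End Quadratic.

(** * Capitulation *)

(** Take zeta -> zeta^(1 + 4m). A primitive eighth root z goes to z (-1)^m = -z, so i = z^2 is fixed
    and sqrt 2 = (1 + i) / z changes sign, while m-th roots of unity are fixed. *)
Lemma aut_flip_sqrt2 m : odd m -> exists sg : {rmorphism algC -> algC},
  [/\ sg 'i = 'i, sg (sqrtC 2) = - sqrtC 2 & forall z, z ^+ m = 1 -> sg z = z].
Proof.
move=> om.
have cop : coprime (1 + 4 * m) (8 * m).
  rewrite coprimeMr; apply/andP; split.
    by rewrite -[8%N]/(2 ^ 3)%N coprimeXr // coprimen2 oddD oddM.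
  by rewrite /coprime addnC gcdnC gcdnMDl gcdn1.
have [sg sgE] := Qn_aut_exists cop; exists sg.
set r : algC := sqrtC 2; have r2 : r ^+ 2 = 2 by rewrite sqrtCK.
have r0 : r != 0 by rewrite -sqrf_eq0 r2 pnatr_eq0.
pose z := (1 + 'i) / r; have z2 : z ^+ 2 = 'i := eighth_root_sqr.
have z4 : z ^+ 4 = -1 by rewrite (exprM z 2 2) z2 sqrCi.
have z0 : z != 0 by rewrite -sqrf_eq0 z2 i_neq0.
have sz : sg z = - z.
  rewrite sgE; last by rewrite exprM (exprM z 4 2) z4 sqrrN !expr1n.
  by rewrite exprD expr1 exprM z4 -signr_odd om expr1 mulrN1.
have si : sg 'i = 'i by rewrite -z2 rmorphXn /= sz sqrrN.
split=> //.
  have -> : r = (1 + 'i) / z by rewrite /z invf_div mulrCA divff ?mulr1 // lambda_neq0.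
  by rewrite rmorphM fmorphV rmorphD rmorph1 /= si sz invrN mulrN.
move=> y ym; rewrite sgE; last by rewrite mulnC exprM ym expr1n.
by rewrite exprD expr1 mulnC exprM ym expr1n mulr1.
Qed.

(** The factor r covers p1 = p2 = p, where the given generator is p sqrt 2 and s = sqrt 2. *)
Lemma gen_field_kq s d (sg : {rmorphism algC -> algC}) s0 r :
  (0 < d)%N -> s ^+ 2 = d%:R -> sg 'i = 'i -> sg s = - s -> r \in Qi -> r != 0 -> s0 = r * s ->
  gen_field (fun x => x = s0 \/ x = 'i) = (fun x => is_true (x \in kq s sg)).
Proof.
move=> d0 s2 si ss rQ r0 es0.
apply: pred_ext => x; split.
  move=> gx; apply: (gx _ (kq_subfield d0 s2 si ss)) => _ [->|->].
    rewrite es0; apply: (kq_mul d0 s2 si ss); last exact: (s_kq d0 s2 si ss).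
    exact: (Qi_kq d0 s2 si ss).
  exact/(Qi_kq d0 s2 si ss)/i_Qi.
move/(kqP d0 s2 si ss) => [u [v [uQ vQ ->]]].
set F := gen_field _; have FF : is_subfield F := gen_field_subfield _.
have [_ [_ [_ [FM FV]]]] := FF.
have Fi : F 'i by apply: mem_gen_field; right.
have Fs0 : F s0 by apply: mem_gen_field; left.
have FQ y : y \in Qi -> F y := subfield_Qi FF Fi.
apply: (subfield_D FF); first exact: FQ.
have -> : s = r^-1 * s0 by rewrite es0 mulKf.
apply: (FM); first exact: FQ.
by apply: (FM); [apply: FQ; rewrite rpredV | exact: Fs0].
Qed.

Lemma legendreN1 a p : prime p -> legendre a p = -1 -> ~ qres p a /\ ~~ (p %| a)%N.
Proof.
move=> pp; rewrite /legendre; case: ifP => // _; case: ifP => // h _.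
by split=> // /(is_qrP a pp); rewrite h.
Qed.

Theorem mainTheorem13 (p1 p2 : nat) :
  prime p1 -> prime p2 -> (p1 %% 4 = 1)%N -> (p2 %% 4 = 1)%N ->
  (   (legendre p1 p2 = -1 /\ legendre 2 p1 = -1)
   \/ (legendre p1 p2 = -1 /\ legendre 2 p2 = -1)
   \/ (legendre 2 p1 = -1 /\ legendre 2 p2 = -1)) ->
  let k := gen_field (fun x => x = sqrtC (2 * p1 * p2)%:R \/ x = 'i) in
  let kstar := gen_field (fun x => x = sqrtC 2 \/ x = sqrtC p1%:R \/
                                   x = sqrtC p2%:R \/ x = 'i) in
  forall I : algC -> Prop,
    is_ideal (ring_of_integers k) I -> nonzero_ideal I ->
    in_2_sylow (ring_of_integers k) I ->
    capitulates (ring_of_integers kstar) I.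
Proof.
move=> pp1 pp2 m1 m2 leg k K I II I0 [n].
have Kf : is_subfield K := gen_field_subfield _.
have [_ [_ [_ [KM KV]]]] := Kf.
have Ki : K 'i by apply: mem_gen_field; do 3 right.
have K2 : K (sqrtC 2) by apply: mem_gen_field; left.
have Kp1 : K (sqrtC p1%:R) by apply: mem_gen_field; right; left.
have Kp2 : K (sqrtC p2%:R) by apply: mem_gen_field; do 2 right; left.
have kf : is_subfield k := gen_field_subfield _.
rewrite (ideal_pow_exp2 (ring_of_integers_subring kf) n II).
have s0E : sqrtC (2 * p1 * p2)%:R = sqrtC 2 * sqrtC p1%:R * sqrtC p2%:R :> algC.
  by rewrite !natrM !rootCMl ?rpred_nat ?mulr_ge0 ?ler0n.
have KQ x : x \in Qi -> K x := subfield_Qi Kf Ki.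
have kK s d (sg : {rmorphism algC -> algC}) (d0 : (0 < d)%N) (s2 : s ^+ 2 = d%:R)
    (si : sg 'i = 'i) (ss : sg s = - s) : K s -> forall x, x \in kq s sg -> K x.
  move=> Ks x /(kqP d0 s2 si ss)[u [v [uQ vQ ->]]].
  by apply: (subfield_D Kf); [apply: KQ | apply: KM => //; apply: KQ].
have [o1 o2] := (prime_mod4_odd m1, prime_mod4_odd m2).
have [p10 p20] := (prime_gt0 pp1, prime_gt0 pp2).
(* The statement allows p1 = p2; then d is not squarefree and k is Q(sqrt 2, i), to be treated with
   2 in place of d. *)
have [e12|p12] := eqVneq p1 p2.
  have [sg [si sr _]] := aut_flip_sqrt2 (isT : odd 1).
  have r2 : sqrtC 2 ^+ 2 = 2%N%:R :> algC by rewrite sqrtCK.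
  have ek : k = (fun x => is_true (x \in kq (sqrtC 2) sg)).
    apply: (gen_field_kq (isT : 0 < 2)%N r2 si sr (r := p1%:R)).
    - exact: rpred_nat.
    - by rewrite pnatr_eq0 -lt0n.
    by rewrite s0E e12 -mulrA -expr2 sqrtCK mulrC.
  rewrite ek in II *.
  have Or := ring_of_integers_subring (kq_subfield (isT : 0 < 2)%N r2 si sr).
  move/(principal_of_iter_sqr_eighth (isT : 0 < 2)%N r2 si sr erefl II I0) => Ip.
  have kqK := kK _ _ sg (isT : 0 < 2)%N r2 si sr K2.
  apply: (capitulation (isT : 0 < 2)%N r2 si sr Kf kqK) => //.
  - exact: (units_surject_eighth (isT : 0 < 2)%N r2 si sr).
  - move=> c cZ c0 cP; apply: unit_sqr_mono kqK _.
    exact: (eighth_unit_sqr (isT : 0 < 2)%N r2 si sr).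
  exact: principal_sqr.
have few : few_residues p1 p2.
  case: leg => [[/(legendreN1 pp2)[a _] /(legendreN1 pp1)[b _]]|[]].
  - by split=> -[].
  - by move=> [/(legendreN1 pp2)[a _] /(legendreN1 pp2)[b _]]; split=> -[].
  by move=> [/(legendreN1 pp1)[a _] /(legendreN1 pp2)[b _]]; split=> -[].
have o12 : odd (p1 * p2) by rewrite oddM o1.
(* With m = p1 p2 the automorphism fixes the p1-th and p2-th roots of unity, hence sqrt p1 and sqrt
   p2, so it changes the sign of s. *)
have [sg [si sr sz]] := aut_flip_sqrt2 o12.
have fixp p q : prime p -> (p %% 4 = 1)%N -> (p1 * p2 = p * q)%N -> sg (sqrtC p%:R) = sqrtC p%:R.
  move=> pp p4 epq; have [z zp] := C_prim_root_exists (prime_gt0 pp).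
  apply: (aut_sqrtC_prime pp p4 zp); apply: sz.
  by rewrite epq exprM (prim_expr_order zp) expr1n.
have fix1 := fixp p1 p2 pp1 m1 erefl.
have fix2 := fixp p2 p1 pp2 m2 (mulnC _ _).
set d := (2 * p1 * p2)%N.
have d0 : (0 < d)%N by rewrite !muln_gt0 p10.
pose s : algC := sqrtC d%:R.
have sE : s = sqrtC 2 * sqrtC p1%:R * sqrtC p2%:R := s0E.
have s2 : s ^+ 2 = d%:R by rewrite sqrtCK.
have ss : sg s = - s by rewrite sE !rmorphM /= sr fix1 fix2 !mulNr.
have sc : s^* = s by apply: conj_Creal; rewrite ger0_real // sqrtC_ge0 ler0n.
have ek : k = (fun x => is_true (x \in kq s sg)).
  by apply: (gen_field_kq d0 s2 si ss (r := 1)); rewrite ?rpred1 ?oner_neq0 ?mul1r.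
rewrite ek in II *.
have kqf := kq_subfield d0 s2 si ss; have Or := ring_of_integers_subring kqf.
move/(principal_sqr_of_iter Or) => Sp.
apply: (capitulation d0 s2 si ss Kf) => //.
- by apply: kK d0 s2 si ss _; rewrite sE; do 2 apply: (KM) => //.
- exact: (units_surject_two_primes d0 s2 si ss pp1 pp2 m1 m2 p12).
- move=> c cZ c0 cP.
  have [a1 a1Z na1] := prime_norm_exists pp1 m1.
  have [a2 a2Z na2] := prime_norm_exists pp2 m2.
  have T p a : prime p -> (p %% 4 = 1)%N -> K (sqrtC p%:R) -> a \in Zi -> nrm a = p -> unit_sqr K a.
    by move=> pp p4 Kp; apply: (prime_norm_unit_sqr Kf Ki Kp) => //; rewrite sqrtCK.
  apply: (Zi_gen_ind pp1 pp2 a1Z a2Z na1 na2 cZ c0 cP).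
  + move=> u uZ uV u0; apply: (unit_sqr_unit Kf) => //; first by apply: KQ; apply: Zi_Qi.
    exact: unitA_Zi.
  + exact: lambda_unit_sqr.
  + exact: (T p1).
  + by apply: (T p1) => //; rewrite ?conj_Zi ?nrm_conj.
  + exact: (T p2).
  + by apply: (T p2) => //; rewrite ?conj_Zi ?nrm_conj.
  by move=> x y; apply: unit_sqrM.
apply: Sp => // J JI J0.
exact: (sqr_principal_of_fourth d0 s2 si ss pp1 pp2 m1 m2 p12).
Qed.
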